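(* Let $1<p<\infty$, let $\Omega\subset\mathbb{R}^N$ be a bounded open set, and let $\{a_\varepsilon\}_{\varepsilon>0}$, $a_\varepsilon\colon\Omega\times\mathbb{R}^N\to\mathbb{R}^N$, be a family satisfying the structure conditions (as defined in the context) with constants independent of $\varepsilon$. Let $Y=[0,1]^N$, let $\rho\in L^\infty(\mathbb{R}^N)$ be $Y$-periodic with nontrivial positive and negative parts, put $\rho_\varepsilon(x)=\rho(x/\varepsilon)$ and $\bar\rho=\int_Y\rho(y)\,dy$. Let $\lambda_{\varepsilon,k}^{+}$ and $\lambda_{\varepsilon,k}^-$ denote the $k$-th positive and $k$-th negative variational eigenvalues associated with $a_\varepsilon$ and the weight $\rho_\varepsilon$ in $\Omega$. Then: (1) if $\bar\rho=0$, then $\lambda_{\varepsilon,1}^{\pm}=O(\varepsilon^{-1})$ as $\varepsilon\downarrow0$; (2) if $\bar\rho>0$, then $\varepsilon\lambda_{\varepsilon,1}^-$ is bounded away from zero as $\varepsilon\downarrow0$; (3) if $\bar\rho<0$, then $\varepsilon\lambda_{\varepsilon,1}^+$ is bounded away from zero as $\varepsilon\downarrow0$. Moreover, in the case of periodic homogenization, i.e. $a_\varepsilon(x,\xi)=a(x/\varepsilon,\xi)$ with $a(y,\xi)$ $Y$-periodic in $y$, for every $k\ge1$: (1') if $\bar\rho=0$, then $\lambda_{\varepsilon,k}^{\pm}=O(\varepsilon^{-1})$ as $\varepsilon\downarrow0$; (2') if $\bar\rho>0$, then $\varepsilon^p\lambda_{\varepsilon,k}^-$ is bounded away from infinity (i.e.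 $\varepsilon^p|\lambda_{\varepsilon,k}^-|$ stays bounded) as $\varepsilon\downarrow0$; (3') if $\bar\rho<0$, then $\varepsilon^p\lambda_{\varepsilon,k}^+$ is bounded away from infinity (i.e. stays bounded) as $\varepsilon\downarrow0$.
   Context: Structure conditions. A function $a\colon\Omega\times\mathbb{R}^N\to\mathbb{R}^N$ satisfies the structure conditions with constants $\alpha,\beta,c>0$ if, for a.e. $x\in\Omega$ and all $\xi,\xi_1,\xi_2,\dots\in\mathbb{R}^N$, with $\Psi(x,\xi_1,\xi_2)=a(x,\xi_1)\cdot\xi_1+a(x,\xi_2)\cdot\xi_2$, $\delta=\min\{p/2,p-1\}$ and $\gamma=\max\{2,p\}$: - $a$ is a Carathéodory function ($a(x,\cdot)$ continuous for a.e. $x$, $a(\cdot,\xi)$ measurable for every $\xi$); - monotonicity: $0\le(a(x,\xi_1)-a(x,\xi_2))\cdot(\xi_1-\xi_2)$; - coercivity: $\alpha|\xi|^p\le a(x,\xi)\cdot\xi$; - continuity: $|a(x,\xi)|\le\beta|\xi|^{p-1}$; - homogeneity: $a(x,t\xi)=t^{p-1}a(x,\xi)$ for every $t>0$; - oddness: $a(x,-\xi)=-a(x,\xi)$; - equi-continuity: $|a(x,\xi_1)-a(x,\xi_2)|\le c\,\Psi(x,\xi_1,\xi_2)^{(p-1-\delta)/p}\big((a(x,\xi_1)-a(x,\xi_2))\cdot(\xi_1-\xi_2)\big)^{\delta/p}$; - cyclical monotonicity: $\sum_{i=1}^k a(x,\xi_i)\cdot(\xi_{i+1}-\xi_i)\le0$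 for all $k\ge1$ and $\xi_1,\dots,\xi_{k+1}$ with $\xi_{k+1}=\xi_1$; - strict monotonicity: $\alpha|\xi_1-\xi_2|^\gamma\,\Psi(x,\xi_1,\xi_2)^{1-\gamma/p}\le(a(x,\xi_1)-a(x,\xi_2))\cdot(\xi_1-\xi_2)$. Potential. For such $a$ there is a unique Carathéodory function $\Phi(x,\xi)$, even, $p$-homogeneous, strictly convex and differentiable in $\xi$, with $\nabla_\xi\Phi(x,\xi)=p\,a(x,\xi)$ and $\Phi(x,0)=0$; it satisfies $\alpha|\xi|^p\le\Phi(x,\xi)\le\beta|\xi|^p$. Variational eigenvalues. For $a$ satisfying the structure conditions, with potential $\Phi$, and a weight $\rho\in L^\infty(\Omega)$ with $\rho^+\ne0$, the $k$-th positive variational eigenvalue of $-\operatorname{div}(a(x,\nabla u))=\lambda\rho|u|^{p-2}u$ in $\Omega$, $u=0$ on $\partial\Omega$, is $$\lambda_k^+=\inf_{C\in\mathcal{C}_k}\ \sup_{v\in C}\ \frac{\int_\Omega\Phi(x,\nabla v)\,dx}{\int_\Omega\rho|v|^p\,dx},$$ where $\mathcal{C}_k$ is the family of compact symmetric ($C=-C$) subsets $C$ of $M^+=\{u\in W_0^{1,p}(\Omega):\int_\Omega\rho|u|^p\,dx>0\}$ with $\gamma(C)\ge k$, and $\gamma(A)=\min\{k\in\mathbb{N}:\text{there is an odd continuous } f\colon A\to\mathbb{R}^k\setminus\{0\}\}$ ($\infty$ if there is none) is the Krasnoselskii genus. If $\rho^-\neq0$, the negative variational eigenvalues are defined analogously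 with $M^-=\{u\in W_0^{1,p}(\Omega):\int_\Omega\rho|u|^p\,dx<0\}$; equivalently, $\lambda_k^-$ for the weight $\rho$ equals $-\lambda_k^+$ for the weight $-\rho$. For $\rho_\varepsilon(x)=\rho(x/\varepsilon)$ as in the statement, these eigenvalues are defined for all sufficiently small $\varepsilon$. *)

(* Defs.v *)
From HB Require Import structures.
From mathcomp Require Import all_boot all_order all_algebra.
From mathcomp Require Import all_classical all_reals all_analysis.

Set Implicit Arguments.
Unset Strict Implicit.
Unset Printing Implicit Defensive.

Import Order.TTheory GRing.Theory Num.Theory.
Import numFieldNormedType.Exports.

Local Open Scope classical_set_scope.
Local Open Scope ring_scope.

(* R^N is 'rV[R]_N. Its sigma-algebra is the one generated by the coordinates,
   i.e. the Borel sigma-algebra. *)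

Section measurable_rV.
Context {d} {T : measurableType d} (n : nat).

Let coords (i : 'I_n) (v : 'rV[T]_n) : T := v ord0 i.

Let rV_set0 : g_sigma_preimage coords set0.
Proof. exact: sigma_algebra0. Qed.

Let rV_setC A : g_sigma_preimage coords A -> g_sigma_preimage coords (~` A).
Proof. exact: sigma_algebraC. Qed.

Let rV_bigcup (F : (set 'rV[T]_n)^nat) :
  (forall i, g_sigma_preimage coords (F i)) ->
  g_sigma_preimage coords (\bigcup_i (F i)).
Proof. exact: sigma_algebra_bigcup. Qed.

HB.instance Definition _ := @isMeasurable.Build (measure_tuple_display d)
  'rV[T]_n (g_sigma_preimage coords) rV_set0 rV_setC rV_bigcup.

End measurable_rV.

Section measurable_coord.
Context {d} {T : measurableType d} {d'} {S : measurableType d'} (n : nat).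

Lemma measurable_coord (i : 'I_n) :
  measurable_fun [set: 'rV[T]_n] (fun v : 'rV[T]_n => v ord0 i).
Proof.
move=> _ A mA; apply: sub_sigma_algebra.
case: n i => [[] []//|m i].
rewrite -bigcup_mkord_ord; exists i; first exact: ltn_ord.
by exists A => //; rewrite inord_val.
Qed.

Lemma measurable_rVP (f : S -> 'rV[T]_n) :
  measurable_fun setT f <->
  forall i, measurable_fun setT (fun x => f x ord0 i).
Proof.
split=> [mf i|mf]; first exact: measurableT_comp (measurable_coord i) mf.
move=> _ A; rewrite setTI; move: A; apply: smallest_sub.
  split=> [|A mA|F mF] /=; first by rewrite preimage_set0.
  - by rewrite setTD preimage_setC; exact: measurableC.
  - by rewrite preimage_bigcup; exact: bigcupT_measurable.
case: n f mf => [|m] f mf; first by rewrite big_ord0.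
rewrite -bigcup_mkord_ord; apply: bigcup_sub => i Ii _ [A mA <-] /=.
by rewrite setTI -comp_preimage -[X in measurable X]setTI; exact: mf.
Qed.

End measurable_coord.

Section lebesgue_rV.
Context (R : realType).

Definition rV_cons n (x : R * 'rV[R]_n) : 'rV[R]_n.+1 :=
  \row_i if unlift ord0 i is Some j then x.2 ord0 j else x.1.

Definition rV_uncons n (v : 'rV[R]_n.+1) : R * 'rV[R]_n :=
  (v ord0 ord0, \row_j v ord0 (lift ord0 j)).

Lemma rV_consK n : cancel (@rV_cons n) (@rV_uncons n).
Proof.
move=> [x v]; rewrite /rV_uncons mxE unlift_none; congr pair.
by apply/rowP => j; rewrite !mxE liftK.
Qed.

Lemma measurable_rV_cons n : measurable_fun setT (@rV_cons n).
Proof.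
apply/measurable_rVP => i; case: (unliftP ord0 i) => [j|] ->.
- rewrite (_ : (fun _ => _) = (fun v : 'rV[R]_n => v ord0 j) \o snd).
    exact: measurableT_comp (measurable_coord j) measurable_snd.
  by apply/funext => x; rewrite mxE liftK.
- rewrite (_ : (fun _ => _) = fst); first exact: measurable_fst.
  by apply/funext => x; rewrite mxE unlift_none.
Qed.

Lemma measurable_rV_uncons n : measurable_fun setT (@rV_uncons n).
Proof.
apply: measurable_fun_pair; first exact: measurable_coord.
by apply/measurable_rVP => i; under eq_fun do rewrite mxE; exact: measurable_coord.
Qed.

Section succ.
Variables (n : nat) (m : {sigma_finite_measure set 'rV[R]_n -> \bar R}).

Definition leb_succ : set 'rV[R]_n.+1 -> \bar R :=
  pushforward (lebesgue_measure \x m)%E (@rV_cons n).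

Let measurable_cons_preimage (A : set 'rV[R]_n.+1) :
  measurable A -> measurable (@rV_cons n @^-1` A).
Proof. by rewrite -[X in _ -> measurable X]setTI; exact: measurable_rV_cons. Qed.

Let leb_succ0 : leb_succ set0 = 0%E.
Proof. by rewrite /leb_succ /pushforward preimage_set0 measure0. Qed.

Let leb_succ_ge0 A : (0 <= leb_succ A)%E.
Proof. exact: (measure_ge0 (lebesgue_measure \x m)%E). Qed.

Let leb_succ_sigma_additive : semi_sigma_additive leb_succ.
Proof.
move=> F mF tF mUF; rewrite /leb_succ /pushforward preimage_bigcup.
apply: measure_semi_sigma_additive.
- by move=> k; exact: measurable_cons_preimage.
- apply/trivIsetP => /= i j _ _ ij; rewrite -preimage_setI.
  by move/trivIsetP : tF => /(_ _ _ _ _ ij) ->//; rewrite preimage_set0.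
- by rewrite -preimage_bigcup; exact: measurable_cons_preimage.
Qed.

HB.instance Definition _ := isMeasure.Build _ _ _ leb_succ
  leb_succ0 leb_succ_ge0 leb_succ_sigma_additive.

Let leb_succ_sigma_finite : sigma_finite setT leb_succ.
Proof.
have /sigma_finiteP[F [TF ndF Foo]] := sigma_finiteT (@lebesgue_measure R).
have /sigma_finiteP[G [TG ndG Goo]] := sigma_finiteT m.
exists (fun k => @rV_uncons n @^-1` (F k `*` G k)).
  rewrite -preimage_bigcup (_ : \bigcup_i _ = setT) ?preimage_setT//.
  rewrite -subTset => -[x y] _.
  have [i _ Fx] : (\bigcup_i F i) x by rewrite -TF.
  have [j _ Gy] : (\bigcup_i G i) y by rewrite -TG.
  exists (maxn i j) => //; split => /=.
  - by move: x Fx; exact/subsetPset/ndF/leq_maxl.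
  - by move: y Gy; exact/subsetPset/ndG/leq_maxr.
move=> k; have [mF Fkoo] := Foo k; have [mG Gkoo] := Goo k; split.
  rewrite -[X in measurable X]setTI; apply: measurable_rV_uncons => //.
  exact: measurableX.
rewrite /leb_succ /pushforward -comp_preimage.
rewrite (_ : _ \o _ = id); last by apply/funext => x; exact: rV_consK.
rewrite preimage_id [ltLHS]product_measure1E//.
by rewrite lte_mul_pinfty// ge0_fin_numE.
Qed.

HB.instance Definition _ := Measure_isSigmaFinite.Build _ _ _ leb_succ
  leb_succ_sigma_finite.

End succ.

Fixpoint leb (n : nat) : {sigma_finite_measure set 'rV[R]_n -> \bar R} :=
  match n with
  | 0 => \d_(0 : 'rV[R]_0)
  | n'.+1 => leb_succ (leb n')
  end.

End lebesgue_rV.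

Section lebesgue_space_topology.
Context {d} {T : measurableType d} {R : realType}.
Variables (mu : {measure set T -> \bar R}) (q : \bar R) (q1 : (1 <= q)%E).
Local Notation L := (LfunType mu q1).

(* Elements of LfunType are functions, not classes of functions that agree
   almost everywhere, so the topology of the L^q seminorm does not separate
   a.e. equal functions. *)
Definition Lq_ball (f : L) (r : R) (g : L) : Prop :=
  fine ('N[mu]_q[EFin \o (f - g : L)%R])%E < r.

Let Lq_ball_center (f : L) (r : R) : 0 < r -> Lq_ball f r f.
Proof.
move=> r0; rewrite /Lq_ball subrr (_ : EFin \o _ = cst 0%E); last first.
  exact/funext.
by rewrite Lnorm0 ?fine0// gt_eqF// (lt_le_trans _ q1).
Qed.

Let Lq_ball_sym (f g : L) (r : R) : Lq_ball f r g -> Lq_ball g r f.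
Proof. by rewrite /Lq_ball -(opprB f g) LnormrN. Qed.

Let Lq_ball_triangle (f g h : L) (r s : R) :
  Lq_ball f r g -> Lq_ball g s h -> Lq_ball f (r + s) h.
Proof.
rewrite /Lq_ball => fg gh; rewrite -(subrK g f) -(addrA (f - g)).
by apply: le_lt_trans (ler_LnormD _ _) _; exact: ltrD.
Qed.

HB.instance Definition _ := hasNbhs.Build L (nbhs_ (entourage_ Lq_ball)).
HB.instance Definition _ := Nbhs_isPseudoMetric.Build R L
  erefl Lq_ball_center Lq_ball_sym Lq_ball_triangle erefl.

End lebesgue_space_topology.

Section euclidean.
Context {R : realType} {N : nat}.
Implicit Types u v : 'rV[R]_N.

Definition dotv u v : R := \sum_i u ord0 i * v ord0 i.

(* The norm `|v| of the library on 'rV[R]_N is the sup norm. *)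
Definition enorm v : R := Num.sqrt (dotv v v).

Definition unit_vec (i : 'I_N) : 'rV[R]_N := delta_mx ord0 i.

Definition unit_cube : set 'rV[R]_N :=
  [set y | forall i, 0 <= y ord0 i <= 1].

End euclidean.

Section calculus.
Context {R : realType} {N : nat}.
Implicit Types (phi : 'rV[R]_N -> R) (O : set 'rV[R]_N).

Definition partial (i : 'I_N) phi : 'rV[R]_N -> R :=
  fun x => 'D_(unit_vec i) phi x.

Definition iter_partial (s : seq 'I_N) phi : 'rV[R]_N -> R :=
  foldr partial phi s.

Definition smooth phi : Prop := forall s : seq 'I_N,
  continuous (iter_partial s phi) /\
  forall i x, derivable (iter_partial s phi) x (unit_vec i).

(* C_c^oo(O) *)
Definition test_function O phi : Prop :=
  [/\ smooth phi,
      compact (closure [set x | phi x != 0]) &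
      closure [set x | phi x != 0] `<=` O].

(* Lebesgue measurability on O, the sigma-algebra on 'rV[R]_N being the Borel
   one *)
Definition lebesgue_measurable O phi : Prop :=
  exists2 g : 'rV[R]_N -> R,
    measurable_fun setT g & phi = g %[ae (leb R N) in O].

End calculus.

Section sobolev.
Context {R : realType} (N : nat) (p : R) (p_gt1 : 1 < p).
Local Notation mu := (leb R N).

Lemma lee1_of_gt1 : (1 <= p%:E)%E.
Proof. by rewrite lee_fin ltW. Qed.

Local Notation Lp := (LfunType mu lee1_of_gt1).

(* L^p(R^N) x L^p(R^N)^N with its product topology; a pair w stands for the
   function w.1 together with its gradient w.2, so that on W1p this topology is
   that of the W^{1,p} norm. *)
Definition Lp_pairs : Type := (Lp * 'rV[Lp]_N)%type.

HB.instance Definition _ := PseudoMetric.on Lp_pairs.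
HB.instance Definition _ := GRing.Zmodule.on Lp_pairs.

Definition sob_fun (w : Lp_pairs) : 'rV[R]_N -> R := w.1.

Definition sob_grad (w : Lp_pairs) (x : 'rV[R]_N) : 'rV[R]_N :=
  \row_i (w.2 ord0 i : Lp) x.

Definition weak_gradient (u : 'rV[R]_N -> R) (G : 'rV[R]_N -> 'rV[R]_N) : Prop :=
  forall phi, test_function setT phi -> forall i,
    \int[mu]_x (u x * partial i phi x) = - \int[mu]_x (G x ord0 i * phi x).

(* W^{1,p}(R^N) *)
Definition W1p : set Lp_pairs :=
  [set w | weak_gradient (sob_fun w) (sob_grad w)].

Definition test_pairs (O : set 'rV[R]_N) : set Lp_pairs :=
  [set w | exists2 phi, test_function O phi &
     sob_fun w =1 phi /\
     forall x i, sob_grad w x ord0 i = partial i phi x].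

(* W_0^{1,p}(O), the closure of C_c^oo(O); its elements are extended by zero
   outside O. *)
Definition W01p (O : set 'rV[R]_N) : set Lp_pairs :=
  W1p `&` closure (test_pairs O).

End sobolev.

Section structure_conditions.
Context {R : realType} {N : nat}.
Local Notation mu := (leb R N).
Local Notation "u ''*' v" := (dotv u v) (at level 40).

Record structure_conditions (O : set 'rV[R]_N) (p alpha beta c : R)
    (a : 'rV[R]_N -> 'rV[R]_N -> 'rV[R]_N) : Prop := {
  sc_measurable : forall xi i, lebesgue_measurable O (fun x => a x xi ord0 i);
  sc_continuous : \forall x \ae mu, O x -> continuous (a x);
  sc_monotone : \forall x \ae mu, O x -> forall xi1 xi2,
    0 <= (a x xi1 - a x xi2) '* (xi1 - xi2);
  sc_coercive : \forall x \ae mu, O x -> forall xi,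
    alpha * enorm xi `^ p <= a x xi '* xi;
  sc_bounded : \forall x \ae mu, O x -> forall xi,
    enorm (a x xi) <= beta * enorm xi `^ (p - 1);
  sc_homogeneous : \forall x \ae mu, O x -> forall (t : R) xi, 0 < t ->
    a x (t *: xi) = t `^ (p - 1) *: a x xi;
  sc_odd : \forall x \ae mu, O x -> forall xi, a x (- xi) = - a x xi;
  sc_equicontinuous : \forall x \ae mu, O x -> forall xi1 xi2,
    let Psi := a x xi1 '* xi1 + a x xi2 '* xi2 in
    let delta := Num.min (p / 2) (p - 1) in
    enorm (a x xi1 - a x xi2) <=
    c * Psi `^ ((p - 1 - delta) / p) *
      ((a x xi1 - a x xi2) '* (xi1 - xi2)) `^ (delta / p);
  sc_cyclically_monotone : \forall x \ae mu, O x ->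
    forall (k : nat) (xi : nat -> 'rV[R]_N), (0 < k)%N -> xi k = xi 0 ->
    \sum_(i < k) a x (xi i) '* (xi i.+1 - xi i) <= 0;
  sc_strictly_monotone : \forall x \ae mu, O x -> forall xi1 xi2,
    let Psi := a x xi1 '* xi1 + a x xi2 '* xi2 in
    let gamma := Num.max 2 p in
    alpha * enorm (xi1 - xi2) `^ gamma * Psi `^ (1 - gamma / p) <=
    (a x xi1 - a x xi2) '* (xi1 - xi2)
}.

Record is_potential (O : set 'rV[R]_N) (p : R)
    (a : 'rV[R]_N -> 'rV[R]_N -> 'rV[R]_N)
    (Phi : 'rV[R]_N -> 'rV[R]_N -> R) : Prop := {
  pot_measurable : forall xi, lebesgue_measurable O (Phi ^~ xi);
  pot_continuous : \forall x \ae mu, O x -> continuous (Phi x);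
  pot_even : \forall x \ae mu, O x -> forall xi, Phi x (- xi) = Phi x xi;
  pot_homogeneous : \forall x \ae mu, O x -> forall (t : R) xi, 0 < t ->
    Phi x (t *: xi) = t `^ p * Phi x xi;
  pot_strictly_convex : \forall x \ae mu, O x -> forall (t : R) xi1 xi2,
    0 < t < 1 -> xi1 <> xi2 ->
    Phi x (t *: xi1 + (1 - t) *: xi2) < t * Phi x xi1 + (1 - t) * Phi x xi2;
  pot_gradient : \forall x \ae mu, O x -> forall xi,
    differentiable (Phi x) xi /\
    forall v, 'd (Phi x) xi v = p * (a x xi '* v);
  pot_at0 : \forall x \ae mu, O x -> Phi x 0 = 0
}.

End structure_conditions.

Section eigenvalues.
Context {R : realType} {N : nat} (p : R) (p_gt1 : 1 < p).
Local Notation mu := (leb R N).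
Local Notation Lp_pairs := (Lp_pairs N p_gt1).

(* The infimum is a minimum of natural numbers, and +oo over the empty set. *)
Definition genus (A : set Lp_pairs) : \bar R :=
  ereal_inf [set (k%:R)%:E | k in [set k : nat |
    exists f : Lp_pairs -> 'rV[R]_k,
      [/\ {within A, continuous f},
          forall w, A w -> f (- w) = - f w &
          forall w, A w -> f w != 0]]].

Definition weighted_mass (O : set 'rV[R]_N) (rho : 'rV[R]_N -> R)
    (w : Lp_pairs) : R :=
  \int[mu]_(x in O) (rho x * `|sob_fun w x| `^ p).

Definition energy (O : set 'rV[R]_N) (Phi : 'rV[R]_N -> 'rV[R]_N -> R)
    (w : Lp_pairs) : R :=
  \int[mu]_(x in O) Phi x (sob_grad w x).

Definition Mpos (O : set 'rV[R]_N) (rho : 'rV[R]_N -> R) : set Lp_pairs :=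
  [set w | W01p O w /\ 0 < weighted_mass O rho w].

Definition Mneg (O : set 'rV[R]_N) (rho : 'rV[R]_N -> R) : set Lp_pairs :=
  [set w | W01p O w /\ weighted_mass O rho w < 0].

Definition genus_family (M : set Lp_pairs) (k : nat) : set (set Lp_pairs) :=
  [set C | [/\ compact C, -%R @` C = C, C `<=` M &
               ((k%:R)%:E <= genus C)%E]].

Definition rayleigh_quotient (O : set 'rV[R]_N) (Phi : 'rV[R]_N -> 'rV[R]_N -> R)
    (rho : 'rV[R]_N -> R) (w : Lp_pairs) : \bar R :=
  (energy O Phi w / weighted_mass O rho w)%:E.

(* The eigenvalues are +oo, resp. -oo, when no admissible set exists. *)
Definition eigenvalue_pos (O : set 'rV[R]_N)
    (Phi : 'rV[R]_N -> 'rV[R]_N -> R) (rho : 'rV[R]_N -> R) (k : nat) : \bar R :=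
  ereal_inf [set ereal_sup (rayleigh_quotient O Phi rho @` C) |
             C in genus_family (Mpos O rho) k].

Definition eigenvalue_neg (O : set 'rV[R]_N)
    (Phi : 'rV[R]_N -> 'rV[R]_N -> R) (rho : 'rV[R]_N -> R) (k : nat) : \bar R :=
  ereal_sup [set ereal_inf (rayleigh_quotient O Phi rho @` C) |
             C in genus_family (Mneg O rho) k].

End eigenvalues.

Section periodicity.
Context {R : realType} {N : nat} {S : Type}.

(* periodicity with respect to the unit cube, almost everywhere *)
Definition cube_periodic (f : 'rV[R]_N -> S) : Prop :=
  \forall y \ae leb R N, forall i, f (y + unit_vec i) = f y.

Definition dilate (e : R) (f : 'rV[R]_N -> S) : 'rV[R]_N -> S :=
  fun x => f (e^-1 *: x).

End periodicity.

(* Main.v *)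
(* After replacing rho by -rho only positive eigenvalues matter. The function
   Phi(x, xi) = a(x, xi) . xi (Euler's identity) lies between alpha |xi|^p and
   beta |xi|^p, so everything reduces to comparing integrals of rho(x/e) |u|^p and
   of |grad u|^p.

   The link is an averaging identity: for g periodic and f integrable, the mean
   over y in the unit cube of the integral of g(x/e) f(x - e y) dx is the mean of g
   times the integral of f.

   If the mean of rho is nonpositive, then with g = rho and f = |u|^p some translate
   of f has nonpositive mass, and the difference |u|^p - |u(. - e y)|^p is O(e) in
   L^1 by Poincare's inequality. Hence the integral of rho(x/e) |u|^p is at most
   C e times that of |grad u|^p, which bounds the first eigenvalue below by m / e.

   For upper bounds take a smooth periodic psi with values in [0, 1] for which
   rho psi has positive mean, and the functions b(x - z_j - e y_j) h(x/e), j < k, with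
   bumps b(. - z_j) of disjoint supports, h^p = d + c psi, and y_j chosen by averaging
   so that the mass is at least half its mean. The image of the l^1 sphere of R^k under
   their linear combinations has genus at least k by the Borsuk-Ulam theorem, proved
   here by Ky Fan's combinatorial argument. When rho has mean 0 take d = 1 and c = e:
   the mass is of order e and the gradients are bounded. When the mean is negative
   take d small and c = 1: the mass is bounded below and the gradients are O(1/e). *)
Require Import Defs.
From HB Require Import structures.
From mathcomp Require Import all_boot all_order all_algebra.
From mathcomp Require Import all_classical all_reals all_analysis.
From mathcomp Require Import measurable_realfun ess_sup_inf ring lra.

Set Implicit Arguments.
Unset Strict Implicit.
Unset Printing Implicit Defensive.

Import Order.TTheory GRing.Theory Num.Theory.
Import numFieldNormedType.Exports.

Local Open Scope classical_set_scope.
Local Open Scope ring_scope.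

(** * The Borsuk-Ulam theorem *)

(** The scales come from one quotient. A factor of amplitude [c] and period [e] has gradients of
    order [c / e], so the upper bound is [(1 + c / e)^p] over the mean of [rho * (d + c * psi)].
    When [rho] has mean zero this mean is [c] times a positive number, and [c = e] minimises the
    order of [(1 + c / e)^p / c]. When the mean is negative, [c] has to dominate [d], so the
    gradients keep their order [1 / e]. The constant [d] stays positive because the p-th root is
    singular at 0. Averaging over translations takes the place of a cell problem or a count of
    cells: [rho] needs no regularity, and since each translation moves a coordinate by at most [e],
    no boundary layer appears. In the lower bound a gradient controlled only in L^p has to yield an
    error linear in [e]. A convexity inequality with weight [t = e] splits that error into [e] times
    p-th powers and [e^(1 - p)] times the p-th power of a difference, which is itself of order
    [e^p]. The l1 sphere is used for the genus because it is a polytope: its subdivisions remain on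
    it without any projection. *)

Section mod2_chains.
Variable T : Type.
Implicit Types (s : seq T) (c : seq (seq T)) (A : seq T -> bool).

(* A chain mod 2 is a sequence of simplices, a simplex being the sequence of its
   vertices; [evalc A c] evaluates on c the cochain A with values in Z/2. *)
Definition evalc A c : bool := \big[addb/false]_(s <- c) A s.

Lemma evalc_cat A c c' : evalc A (c ++ c') = evalc A c (+) evalc A c'.
Proof. by rewrite /evalc big_cat. Qed.

Lemma evalc_flatten A (F : seq T -> seq (seq T)) c :
  evalc A (flatten (map F c)) = evalc (fun s => evalc A (F s)) c.
Proof. by rewrite /evalc big_flatten big_map. Qed.

Lemma eq_evalc A B c : A =1 B -> evalc A c = evalc B c.
Proof. by move=> AB; apply: eq_bigr => s _. Qed.

Lemma evalc_add A B c : evalc (fun s => A s (+) B s) c = evalc A c (+) evalc B c.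
Proof. by rewrite /evalc big_split. Qed.

Lemma evalc_const0 c : evalc (fun=> false) c = false.
Proof. by rewrite /evalc big1. Qed.

End mod2_chains.

Lemma evalc_map (T U : Type) (A : seq T -> bool) (f : seq U -> seq T) c :
  evalc A (map f c) = evalc (A \o f) c.
Proof. by rewrite /evalc big_map. Qed.

Section mod2_boundary.
Variable T : Type.
Implicit Types (s : seq T) (c : seq (seq T)) (A : seq T -> bool).

Fixpoint faces s : seq (seq T) :=
  if s is x :: s' then s' :: map (cons x) (faces s') else [::].

Definition bdry c := flatten (map faces c).

Lemma evalc_bdry A c : evalc A (bdry c) = evalc (fun s => evalc A (faces s)) c.
Proof. exact: evalc_flatten. Qed.

Lemma evalc_faces_cons A x s :
  evalc A (faces (x :: s)) = A s (+) evalc (A \o cons x) (faces s).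
Proof. by rewrite /= /evalc big_cons big_map. Qed.

(** Since repeated simplices cancel only under evaluation, identities between chains are stated for
    every cochain [A]. Here, for a cone, the faces of the base occur twice and the rest is the
    induction hypothesis for [A \o cons x]. *)
Lemma bdry_faces A s : evalc A (bdry (faces s)) = false.
Proof.
elim: s A => [|x s IH] A; first by rewrite /evalc big_nil.
rewrite evalc_bdry evalc_faces_cons.
rewrite [X in _ (+) X](_ : _ = evalc (fun t => A t (+) evalc (A \o cons x) (faces t)) (faces
  s)); last first.
  by apply: eq_evalc => t /=; rewrite -evalc_faces_cons.
by rewrite evalc_add -evalc_bdry IH addbF addbb.
Qed.

Lemma bdry_cone A x c :
  evalc A (bdry (map (cons x) c)) = evalc A c (+) evalc (A \o cons x) (bdry c).
Proof.
rewrite !evalc_bdry evalc_map -evalc_add; apply: eq_bigr => s _.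
exact: evalc_faces_cons.
Qed.

Lemma all_size_faces s : all (fun t => size t == (size s).-1) (faces s).
Proof.
elim: s => //= x s IH; rewrite eqxx all_map /=.
by case: s IH => // y s IH; apply: sub_all IH => t /= /eqP ->.
Qed.

End mod2_boundary.

Lemma eq_in_evalc (T : eqType) (A B : seq T -> bool) c :
  {in c, A =1 B} -> evalc A c = evalc B c.
Proof. by move=> AB; apply: eq_big_seq. Qed.

Lemma map_faces (T U : Type) (f : T -> U) s : map (map f) (faces s) = faces (map f s).
Proof.
elim: s => //= x s IH; congr cons; rewrite -IH -!map_comp.
by apply: eq_map => t.
Qed.

(** * Alternating sign words and signed labels *)

Section alternation.

Fixpoint alternates (b : bool) (s : seq bool) : bool :=
  if s is x :: s' then (x == b) && alternates (~~ b) s' else true.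

Lemma alternates_negb b s : alternates b (map negb s) = alternates (~~ b) s.
Proof. by elim: s b => //= x s IH b; rewrite IH; case: x b => [] []. Qed.

(** Deleting the last letter of an alternating word keeps its first sign, deleting the first letter
    changes it, and any other deletion destroys alternation. A word that does not alternate has no
    alternating face, or exactly two equal ones, obtained from its only pair of equal neighbours. *)
Lemma alternates_faces b s :
  evalc (alternates b) (faces s) = alternates b s (+) alternates (~~ b) s.
Proof.
elim: s b => [|x s IH] b; first by rewrite /evalc big_nil.
rewrite evalc_faces_cons.
have [->|xb] := eqVneq x b.
  rewrite (eq_evalc (B := alternates (~~ b))); last by move=> t /=; rewrite eqxx.
  rewrite IH /= eqxx negbK; case: b {IH}; case: (alternates _ s) => //=;
  by case: (alternates _ s).
rewrite (eq_evalc (B := fun=> false)); last by move=> t /=; rewrite (negPf xb).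
rewrite evalc_const0 /= (negPf xb) addbF negbK.
by case: x b xb {IH} => [] [].
Qed.

(* Ky Fan's signed labels are encoded as natural numbers: c has absolute value
   [c./2] and is negative when odd. A simplex is alternating when the signs of its
   labels, sorted by absolute value, alternate; b says whether the first one is
   negative. *)
Definition fan_alt (b : bool) (l : seq nat) := alternates b (map odd (sort leq l)).

Lemma fan_alt_perm b l l' : perm_eq l l' -> fan_alt b l = fan_alt b l'.
Proof.
move=> ll'; rewrite /fan_alt; congr (alternates _ (map _ _)).
by apply/perm_sortP => //; [exact: leq_total|exact: leq_trans|exact: anti_leq].
Qed.

(** [faces] deletes a position and [rem] the first occurrence of a value; a symmetric [G] cannot
    tell them apart. The right-hand side allows the labels to be reordered. *)
Lemma evalc_faces_rem (G : seq nat -> bool) l :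
  (forall l1 l2, perm_eq l1 l2 -> G l1 = G l2) ->
  evalc G (faces l) = \big[addb/false]_(x <- l) G (rem x l).
Proof.
elim: l G => [|y l IH] G HG; first by rewrite /evalc !big_nil.
rewrite evalc_faces_cons IH; last first.
  by move=> l1 l2 l12; apply: HG; rewrite perm_cons.
rewrite big_cons /= eqxx; congr addb; rewrite big_seq [RHS]big_seq.
apply: eq_bigr => x xl; case: eqVneq => // ->.
by apply: HG; rewrite perm_sym perm_to_rem.
Qed.

Lemma faces_subseq (T : eqType) (s t : seq T) : t \in faces s -> subseq t s.
Proof.
elim: s t => //= x s IH t; rewrite inE => /predU1P[->|]; first exact: subseq_cons.
by move=> /mapP[u us ->]; rewrite /= eqxx; exact: IH.
Qed.

Lemma perm_eq_rem (T : eqType) (x : T) s t :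
  perm_eq s t -> perm_eq (rem x s) (rem x t).
Proof.
move=> st; have [xs|xs] := boolP (x \in s); last first.
  by rewrite !rem_id// -(perm_mem st).
have xt : x \in t by rewrite -(perm_mem st).
by rewrite -(perm_cons x) -(permPl (perm_to_rem xs)) -(permPr (perm_to_rem xt)).
Qed.

(** Both sides depend only on the multiset of labels, so [l] may be sorted; the faces of a sorted
    sequence are sorted, and [alternates_faces] applies. *)
Lemma fan_alt_faces b l :
  evalc (fan_alt b) (faces l) = fan_alt b l (+) fan_alt (~~ b) l.
Proof.
rewrite evalc_faces_rem; last exact: fan_alt_perm.
have pl : perm_eq l (sort leq l) by rewrite perm_sym perm_sort.
rewrite (perm_big _ pl) /=.
rewrite (eq_bigr (fun x => fan_alt b (rem x (sort leq l)))); last first.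
  by move=> x _; apply: fan_alt_perm; exact: perm_eq_rem.
rewrite -evalc_faces_rem; last exact: fan_alt_perm.
rewrite /fan_alt -alternates_faces -map_faces evalc_map.
rewrite /evalc big_seq [RHS]big_seq; apply: eq_bigr => t /faces_subseq tl /=.
rewrite sorted_sort//; first exact: leq_trans.
apply: (subseq_sorted leq_trans tl); apply: sort_sorted; exact: leq_total.
Qed.

(** Negation of a signed label in this encoding: [2 i] and [2 i + 1] are exchanged. *)
Definition flip (c : nat) := if odd c then c.-1 else c.+1.

Definition no_complement (l : seq nat) :=
  forall x y, x \in l -> y \in l -> x./2 = y./2 -> x = y.

Lemma odd_flip c : odd (flip c) = ~~ odd c.
Proof.
by rewrite /flip; case: ifPn => [|/negPf /= ->//]; case: c => //= n /negPf ->.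
Qed.

Lemma half_flip c : (flip c)./2 = c./2.
Proof.
rewrite /flip; case: ifPn => oc; last by rewrite /= uphalf_half (negPf oc).
by case: c oc => //= n; rewrite uphalf_half => /negPf ->.
Qed.

Lemma leq_flip l x y : no_complement l -> x \in l -> y \in l -> (x <= y)%N ->
  (flip x <= flip y)%N.
Proof.
move=> nc xl yl xy; have [e|ne] := eqVneq x./2 y./2.
  by rewrite (nc _ _ xl yl e).
have lt : ((flip x)./2 < (flip y)./2)%N.
  by rewrite !half_flip ltn_neqAle ne half_leq.
rewrite leqNgt; apply/negP => /ltnW /half_leq; rewrite leqNgt lt //.
Qed.

(** In the absence of complementary labels [flip] preserves the order, so the sorted word keeps its
    arrangement and only its signs change. *)
Lemma fan_alt_flip b l : no_complement l -> fan_alt b (map flip l) = fan_alt (~~ b) l.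
Proof.
move=> nc; rewrite /fan_alt -alternates_negb -map_comp.
have -> : sort leq (map flip l) = map flip (sort leq l).
  have p : perm_eq (map flip (sort leq l)) (map flip l).
    by apply: perm_map; rewrite perm_sort.
  rewrite -(sorted_sort leq_trans (s := map flip (sort leq l))).
    apply/perm_sortP; [exact: leq_total|exact: leq_trans|exact: anti_leq|].
    by rewrite perm_sym.
  rewrite sorted_map.
  have so : sorted leq (sort leq l) by apply: sort_sorted; exact: leq_total.
  apply: (sub_in_sorted (P := mem l) _ _ so).
    by move=> x y xl yl /= xy; exact: (leq_flip nc).
  by apply/allP => x; rewrite mem_sort.
rewrite -map_comp; congr alternates; apply: eq_map => x /=; exact: odd_flip.
Qed.

(** Neighbours in the sorted word have opposite signs, hence different absolute values since no
    labels are complementary. The absolute values therefore increase strictly, and they stay below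
    [m]. *)
Lemma fan_alt_size b l m : no_complement l -> fan_alt b l ->
  all (fun c => c./2 < m)%N l -> (size l <= m)%N.
Proof.
move=> nc; rewrite -(size_sort leq) /fan_alt.
have so : sorted leq (sort leq l) by apply: sort_sorted; exact: leq_total.
have : {subset sort leq l <= l} by move=> x; rewrite mem_sort.
rewrite -[all _ l](eq_all_r (s1 := sort leq l)); last exact: mem_sort.
elim: (sort leq l) b so => [//|x s IH] b so sub alt am.
(* Strengthened for the induction: the absolute value of the first label counts as well. *)
suff : forall s x b, sorted leq (x :: s) -> {subset x :: s <= l} ->
   alternates b (map odd (x :: s)) -> all (fun c => c./2 < m)%N (x :: s) ->
   (x./2 + size s < m)%N.
  move=> /(_ _ _ _ so sub alt am); apply: leq_ltn_trans.
  by rewrite leq_addl.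
clear -nc => s; elim: s => [|y s IH] x b so sub alt /=.
  by rewrite addn0 andbT.
move=> /and3P[xm ym am].
move: so => /= /andP[xy so].
move: alt => /= /andP[xb alt].
have suby : {subset y :: s <= l} by move=> z zs; apply: sub; rewrite inE zs orbT.
have := IH y (~~ b) so suby alt; rewrite /= ym am => /(_ isT).
apply: leq_ltn_trans; rewrite addnS -addSn leq_add2r.
rewrite ltn_neqAle half_leq// andbT; apply/eqP => e.
have /= exy := nc x y (sub _ (mem_head _ _)) (suby _ (mem_head _ _)) e.
by move: alt xb; rewrite exy => /andP[/eqP -> _]; case: b.
Qed.

End alternation.

(** * Barycentric subdivision *)

Section subdivision.
Variables (R : realType) (V : normedModType R).
Implicit Types (s t : seq V) (c : seq (seq V)) (A : seq V -> bool).

Definition barycenter s : V := (size s)%:R^-1 *: \sum_(x <- s) x.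

(** The cone from the barycenter over the subdivided boundary. The argument [n], meant to be the
    number of vertices, makes the recursion structural. *)
Fixpoint subdiv n s : seq (seq V) :=
  if n is n'.+1
  then map (cons (barycenter s)) (flatten (map (subdiv n') (faces s)))
  else [:: s].

Definition subdivc n c := flatten (map (subdiv n) c).

Lemma subdivSE n s : subdiv n.+1 s = map (cons (barycenter s)) (subdivc n (faces s)).
Proof. by []. Qed.

Lemma size_subdiv n s : size s = n -> all (fun t => size t == n) (subdiv n s).
Proof.
elim: n s => [|n IH] s sn; first by rewrite /= sn.
rewrite subdivSE all_map; apply/allP => t /flatten_mapP[u us tu] /=; rewrite eqSS.
have /eqP su := allP (all_size_faces s) _ us.
by apply: (allP (IH u _)) => //; rewrite su sn.
Qed.

Lemma size_subdivc n c : all (fun t => size t == n) c ->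
  all (fun t => size t == n) (subdivc n c).
Proof.
move=> /allP cn; apply/allP => t /flatten_mapP[u /cn/eqP us tu].
exact: (allP (size_subdiv us)).
Qed.

(** Subdivision is a chain map: the boundary of the cone is the subdivided boundary plus the cone
    over its boundary, and the latter vanishes by induction and [bdry_faces]. *)
Lemma bdry_subdiv A n s : size s = n.+1 ->
  evalc A (bdry (subdiv n.+1 s)) = evalc A (subdivc n (faces s)).
Proof.
elim: n A s => [|n IH] A s sn.
  case: s sn => [|x []]//= _.
rewrite subdivSE bdry_cone; set A' := A \o _.
suff -> : evalc A' (bdry (subdivc n.+1 (faces s))) = false by rewrite addbF.
rewrite evalc_bdry evalc_flatten.
transitivity (evalc (fun u => evalc A' (subdivc n (faces u))) (faces s)).
  apply: eq_in_evalc => u us; rewrite -evalc_bdry IH//.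
  by have /eqP -> := allP (all_size_faces s) _ us; rewrite sn.
rewrite -[RHS](bdry_faces (fun t => evalc A' (subdiv n t)) s) evalc_bdry.
by apply: eq_evalc => u; rewrite evalc_flatten.
Qed.

Lemma bdry_subdivc A n c : all (fun t => size t == n.+1) c ->
  evalc A (bdry (subdivc n.+1 c)) = evalc A (subdivc n (bdry c)).
Proof.
move=> /allP cn; rewrite evalc_bdry !evalc_flatten.
apply: eq_in_evalc => u /cn/eqP un.
by rewrite -evalc_bdry bdry_subdiv// evalc_flatten.
Qed.

Lemma barycenterN s : barycenter (map -%R s) = - barycenter s.
Proof. by rewrite /barycenter size_map big_map sumrN scalerN. Qed.

Lemma subdivN n s : subdiv n (map -%R s) = map (map -%R) (subdiv n s).
Proof.
elim: n s => //= n IH s; rewrite -map_faces barycenterN -!map_comp.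
rewrite map_flatten -!map_comp.
rewrite !map_flatten -!map_comp.
congr flatten; apply: eq_map => u /=.
by rewrite IH -!map_comp.
Qed.

Lemma subdivcN n c : subdivc n (map (map -%R) c) = map (map -%R) (subdivc n c).
Proof.
rewrite /subdivc map_flatten -!map_comp; congr flatten; apply: eq_map => u /=.
exact: subdivN.
Qed.

(** The part of convexity that barycenters require: only equal weights occur. *)
Definition avg_closed (K : set V) :=
  forall s, s != [::] -> (forall x, x \in s -> K x) -> K (barycenter s).

Lemma avg_closed_sublevel (q : V -> R) (r : R) :
  (forall x y, q (x + y) <= q x + q y) ->
  (forall (k : R) x, 0 <= k -> q (k *: x) <= k * q x) ->
  avg_closed [set x | q x <= r].
Proof.
move=> qD qZ s s0 sr /=.
have sz : 0 < (size s)%:R :> R by rewrite ltr0n lt0n size_eq0.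
have szV : 0 <= (size s)%:R^-1 :> R by rewrite invr_ge0 ltW.
apply: le_trans (qZ _ _ szV) _.
rewrite ler_pdivrMl// mulr_natl.
have q0 : q 0 <= 0 by have := qZ 0 0 (lexx _); rewrite scale0r mul0r.
elim: s s0 sr {sz szV} => // x s IH _ sr.
rewrite big_cons (le_trans (qD _ _))//= mulrS lerD//.
  by apply: sr; rewrite mem_head.
case: s IH sr => [|y s] IH sr; first by rewrite big_nil mulr0n.
by apply: IH => // z zs; apply: sr; rewrite inE zs orbT.
Qed.

Lemma avg_closed_ball (y : V) (r : R) : avg_closed [set x | `|y - x| <= r].
Proof.
move=> s s0 sr /=.
have sz : (size s)%:R != 0 :> R by rewrite pnatr_eq0 size_eq0.
have -> : y - barycenter s = barycenter [seq y - x | x <- s].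
  rewrite /barycenter size_map big_map sumrB scalerBr; congr (_ - _).
  rewrite big_const_seq count_predT iter_addr_0.
  by rewrite -(scaler_nat (size s) y) scalerA mulVf// scale1r.
apply: (@avg_closed_sublevel (fun v => `|v|)).
- exact: ler_normD.
- by move=> k x k0; rewrite normrZ ger0_norm.
- by case: (s) s0.
- by move=> x /mapP[z zs ->]; exact: sr.
Qed.

Lemma avg_closedI (K L : set V) : avg_closed K -> avg_closed L -> avg_closed (K `&` L).
Proof.
by move=> aK aL s s0 sKL; split; [apply: aK|apply: aL] => // x /sKL[].
Qed.

Lemma avg_closed_subdiv (K : set V) n s : avg_closed K -> size s = n ->
  (forall x, x \in s -> K x) ->
  forall t x, t \in subdiv n s -> x \in t -> K x.
Proof.
move=> aK; elim: n s => [|n IH] s sn sK t x.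
  by rewrite inE => /eqP ->; exact: sK.
rewrite subdivSE => /mapP[u /flatten_mapP[v vs uv] ->].
rewrite inE => /predU1P[->|xu]; first by apply: aK => //; case: (s) sn.
apply: (IH v) xu => //; first by have /eqP -> := allP (all_size_faces s) _ vs; rewrite sn.
by move=> z zv; apply: sK; apply: mem_subseq zv; exact: faces_subseq.
Qed.

(** [x - barycenter s] is the mean of the differences [x - y], one of which is zero; this saves one
    term out of [size s <= N]. *)
Lemma barycenter_dist s (D : R) N : (size s <= N)%N ->
  0 <= D -> {in s &, forall x y, `|x - y| <= D} ->
  forall x, x \in s -> `|x - barycenter s| <= (1 - N%:R^-1) * D.
Proof.
move=> sN D0 sD x xs.
have sz : 0 < (size s)%:R :> R by rewrite ltr0n; case: (s) xs.
have -> : x - barycenter s = (size s)%:R^-1 *: \sum_(y <- s) (x - y).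
  rewrite sumrB scalerBr; congr (_ - _).
  rewrite big_const_seq count_predT iter_addr_0.
  by rewrite -(scaler_nat (size s) x) scalerA mulVf ?gt_eqF// scale1r.
have := perm_big _ (perm_to_rem xs) => /= -> /=.
rewrite big_cons subrr add0r normrZ gtr0_norm ?invr_gt0// ler_pdivrMl//.
apply: (@le_trans _ _ ((size s).-1%:R * D)).
  rewrite (le_trans (ler_norm_sum _ _ _))//.
  apply: (@le_trans _ _ (\sum_(y <- rem x s) D)).
    by rewrite big_seq [leRHS]big_seq ler_sum// => y /mem_rem ys; exact: sD.
  by rewrite big_const_seq count_predT iter_addr_0 size_rem// mulr_natl.
rewrite mulrA ler_wpM2r// mulrBr mulr1.
rewrite -subn1 natrB; last by case: (s) xs.
rewrite lerD2l lerN2 ler_pdivrMr ?mul1r ?ler_nat//.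
by rewrite ltr0n (leq_trans _ sN)//; case: (s) xs.
Qed.

(** [N] is only an upper bound for the number of vertices, so that the contraction ratio is the same
    in all dimensions. *)
Lemma mesh_subdiv n N s (D : R) : size s = n -> (n <= N)%N -> 0 <= D ->
  {in s &, forall x y, `|x - y| <= D} ->
  forall t, t \in subdiv n s ->
  {in t &, forall x y, `|x - y| <= (1 - N%:R^-1) * D}.
Proof.
elim: n s => [|n IH] s sn nN D0 sD t.
  by rewrite inE => /eqP ->; case: (s) sn.
have N0 : (0 < N)%N by exact: leq_trans nN.
have k0 : 0 <= (1 - N%:R^-1) * D.
  by rewrite mulr_ge0// subr_ge0 invf_le1 ?ler1n// ltr0n.
rewrite subdivSE => /mapP[u /flatten_mapP[v vs uv] ->].
have sv : size v = n by have /eqP -> := allP (all_size_faces s) _ vs; rewrite sn.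
have vsub := mem_subseq (faces_subseq vs).
have bu : forall x, x \in u -> `|barycenter s - x| <= (1 - N%:R^-1) * D.
  move=> x xu; apply: (avg_closed_subdiv (@avg_closed_ball (barycenter s) _) sv _ uv xu).
  move=> z /vsub zs; rewrite /= distrC; apply: barycenter_dist => //.
  by rewrite sn.
move=> x y; rewrite !inE => /predU1P[->|xu] /predU1P[->|yu].
- by rewrite subrr normr0.
- exact: bu.
- by rewrite distrC; exact: bu.
- apply: (IH v) uv x y xu yu => //; first exact: ltnW.
  by move=> a b /vsub av /vsub; exact: sD.
Qed.

End subdivision.

(** * Ky Fan's parity argument on subdivided hemispheres *)

Section fan.
Variables (R : realType) (V : normedModType R) (e : nat -> V).

(** The facets of the cross-polytope with vertices [e i] and [- e i], [i < d], one for each choice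
    of signs: a triangulated sphere of dimension [d - 1]. *)
Fixpoint octant d : seq (seq V) :=
  if d is d'.+1 then map (cons (e d')) (octant d') ++ map (cons (- e d')) (octant d')
  else [:: [::]].

(* The boundary of the d-dimensional hemisphere is the sum of the
   (d-1)-dimensional one and of its antipode. *)
Definition hemisphere d := map (cons (e d)) (octant d).

Lemma bdry_octant A d : evalc A (bdry (octant d)) = false.
Proof.
elim: d A => [|d IH] A; first by rewrite /bdry /= /evalc big_nil.
rewrite evalc_bdry evalc_cat -!evalc_bdry !bdry_cone !IH !addbF.
by rewrite addbb.
Qed.

Lemma octantN A d : evalc A (map (map -%R) (octant d)) = evalc A (octant d).
Proof.
elim: d A => //= d IH A; rewrite map_cat !evalc_cat -!map_comp.
rewrite addbC; congr addb.
  rewrite !evalc_map -(IH (A \o cons (e d))) evalc_map; apply: eq_bigr => s _ /=.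
  by rewrite opprK.
rewrite !evalc_map -(IH (A \o cons (- e d))) evalc_map; exact: eq_bigr.
Qed.

Lemma bdry_hemisphere A d : evalc A (bdry (hemisphere d.+1)) =
  evalc A (hemisphere d) (+) evalc A (map (map -%R) (hemisphere d)).
Proof.
rewrite bdry_cone bdry_octant addbF /= evalc_cat; congr addb.
rewrite -map_comp !evalc_map -(octantN (A \o cons (- e d))) evalc_map.
exact: eq_bigr.
Qed.

Lemma size_octant d : all (fun s => size s == d) (octant d).
Proof.
elim: d => //= d IH; rewrite all_cat !all_map.
by apply/andP; split; apply: sub_all IH => s.
Qed.

Lemma size_hemisphere d : all (fun s => size s == d.+1) (hemisphere d).
Proof. by rewrite all_map; apply: sub_all (size_octant d) => s. Qed.

Definition signed_vertex (sg : nat -> bool) i : V := if sg i then - e i else e i.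

Lemma octant_vertices d s : s \in octant d ->
  exists sg, forall x, x \in s -> exists2 i, (i < d)%N & x = signed_vertex sg i.
Proof.
elim: d s => [|d IH] s /=; first by rewrite inE => /eqP ->; exists (fun=> false).
have key b s' : s' \in octant d ->
   exists sg, forall x, x \in (if b then - e d else e d) :: s' ->
     exists2 i, (i < d.+1)%N & x = signed_vertex sg i.
  move=> /IH[sg Hsg]; exists (fun i => if i == d then b else sg i) => x.
  rewrite inE => /predU1P[->|/Hsg[i id ->]].
    by exists d => //; rewrite /signed_vertex eqxx.
  by exists i; [exact: ltnW|rewrite /signed_vertex (ltn_eqF id)].
by rewrite mem_cat => /orP[] /mapP[s' /[swap] ->]; [apply: (key false)|apply: (key true)].
Qed.

Lemma hemisphere_vertices d s : s \in hemisphere d ->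
  exists sg, forall x, x \in s -> exists2 i, (i <= d)%N & x = signed_vertex sg i.
Proof.
move=> sh; have : s \in octant d.+1 by rewrite /= mem_cat sh.
exact: octant_vertices.
Qed.

Variables (k m : nat) (P : set V) (lab : V -> nat) (delta : R).
Hypothesis delta_gt0 : 0 < delta.
(** Keeps subdivision inside [P]: the vertices of an octant lie in a subset of [P] closed under
    averages. The octants of the l1 sphere are flat simplices, so they satisfy this as they
    stand. *)
Hypothesis octant_hull : forall sg, exists2 K : set V, avg_closed K &
  K `<=` P /\ forall i, (i <= k)%N -> K (signed_vertex sg i).
Hypothesis vertex_bounded : exists D : R, forall sg i j, (i <= k)%N -> (j <= k)%N ->
  `|signed_vertex sg i - signed_vertex sg j| <= D.
Hypothesis labN : forall v, P v -> lab (- v) = flip (lab v).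
Hypothesis lab_bound : forall v, P v -> ((lab v)./2 < m)%N.
Hypothesis lab_close : forall u v, P u -> P v -> `|u - v| < delta ->
  (lab u)./2 = (lab v)./2 -> lab u = lab v.

Definition fine_hemisphere j d := iter j (subdivc d.+1) (hemisphere d).

Lemma size_fine_hemisphere j d : all (fun s => size s == d.+1) (fine_hemisphere j d).
Proof. by elim: j => [|j IH]; [exact: size_hemisphere|exact: size_subdivc]. Qed.

(** Subdivision commutes with the boundary and with the antipodal map, so the formula for the coarse
    hemisphere persists. *)
Lemma bdry_fine_hemisphere A j d : evalc A (bdry (fine_hemisphere j d.+1)) =
  evalc A (fine_hemisphere j d) (+) evalc A (map (map -%R) (fine_hemisphere j d)).
Proof.
elim: j A => [|j IH] A; first exact: bdry_hemisphere.
rewrite /= bdry_subdivc; last exact: size_fine_hemisphere.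
rewrite evalc_flatten IH !evalc_flatten; congr addb.
rewrite -subdivcN evalc_flatten.
by rewrite !evalc_map.
Qed.

Lemma fine_hemisphere_in j d s : (d <= k)%N -> s \in fine_hemisphere j d ->
  forall x, x \in s -> P x.
Proof.
move=> dk sj; suff : exists2 K : set V, avg_closed K & K `<=` P /\ forall x, x \in s -> K x.
  by move=> [K _ [KP sK]] x /sK; exact: KP.
elim: j s sj => [|j IH] s.
  move=> /hemisphere_vertices[sg Hsg]; have [K aK [KP eK]] := octant_hull sg.
  exists K => //; split => // x /Hsg[i id ->]; apply: eK; exact: leq_trans dk.
rewrite /= => /flatten_mapP[u uj us]; have [K aK [KP uK]] := IH _ uj.
exists K => //; split => // x; apply: (avg_closed_subdiv aK _ uK) us.
by have /eqP -> := allP (size_fine_hemisphere j d) _ uj.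
Qed.

(** A single [j] has to serve every dimension up to [k], because the parity induction climbs through
    all of them with the same labelling. *)
Lemma fine_hemisphere_mesh : exists j, forall d s, (d <= k)%N ->
  s \in fine_hemisphere j d -> {in s &, forall x y, `|x - y| < delta}.
Proof.
have [D0 HD0] := vertex_bounded.
pose D := Num.max D0 0.
pose r : R := 1 - k.+1%:R^-1.
have D_ge0 : 0 <= D by rewrite /D le_max lexx orbT.
have r0 : 0 <= r by rewrite subr_ge0 invf_le1 ?ler1n// ltr0n.
have r1 : `|r| < 1 by rewrite ger0_norm// ltrBlDr ltrDl invr_gt0 ltr0n.
have mesh j d s : (d <= k)%N -> s \in fine_hemisphere j d ->
    {in s &, forall x y, `|x - y| <= r ^+ j * D}.
  move=> dk; elim: j s => [|j IH] s.
    move=> /hemisphere_vertices[sg Hsg] x y /Hsg[i id ->] /Hsg[i' id' ->].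
    rewrite expr0 mul1r (le_trans (HD0 _ _ _ _ _))//.
    - exact: leq_trans dk.
    - exact: leq_trans dk.
    - by rewrite le_max lexx.
  rewrite /= => /flatten_mapP[u uj us].
  have su : size u = d.+1 by have /eqP -> := allP (size_fine_hemisphere j d) _ uj.
  move=> x y xs ys; rewrite exprS -mulrA.
  apply: (mesh_subdiv su _ _ (IH _ uj) us) => //.
  by rewrite mulr_ge0// exprn_ge0.
have := @cvg_geometric _ D r r1 => /cvgrPdist_lt /(_ _ delta_gt0)[j _ /(_ j (leqnn _))] /=.
rewrite sub0r normrN => Dj; exists j => d s dk sj x y xs ys.
rewrite (le_lt_trans (mesh _ _ _ dk sj x y xs ys))// mulrC.
exact: le_lt_trans (ler_norm _) Dj.
Qed.

(* By induction on d, the numbers of alternating simplices of the subdivided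
   d-hemisphere starting with either sign have an odd sum: a simplex is alternating
   iff the number of its faces that alternate with a given first sign is odd. *)
Lemma fan_theorem : (k < m)%N.
Proof.
have [j mesh] := fine_hemisphere_mesh.
have nc d s : (d <= k)%N -> s \in fine_hemisphere j d -> no_complement (map lab s).
  move=> dk sj _ _ /mapP[u us ->] /mapP[v vs ->].
  by apply: lab_close; [exact: fine_hemisphere_in sj _ us|exact: fine_hemisphere_in sj _ vs|
    exact: mesh sj _ _ us vs].
pose A b s := fan_alt b (map lab s).
have AN d : (d <= k)%N -> evalc (A true) (map (map -%R) (fine_hemisphere j d)) =
    evalc (A false) (fine_hemisphere j d).
  move=> dk; rewrite evalc_map; apply: eq_in_evalc => s sj.
  rewrite /A -[false]/(~~ true) -fan_alt_flip; last exact: nc sj.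
  rewrite /= -!map_comp; congr fan_alt; apply/eq_in_map => v vs /=.
  by apply: labN; exact: fine_hemisphere_in sj _ vs.
have main d : (d <= k)%N ->
    evalc (A true) (fine_hemisphere j d) (+) evalc (A false) (fine_hemisphere j d) = true.
  elim: d => [|d IH] dk.
    (* In dimension 0 the hemisphere is one point, fixed by subdivision, and its label has exactly
       one sign. *)
    have -> : fine_hemisphere j 0 = [:: [:: e 0]].
      rewrite /fine_hemisphere; elim: j {mesh nc AN} => //= i ->.
      by rewrite /subdivc /= /barycenter /= big_seq1 invr1 scale1r.
    by rewrite /evalc !big_seq1 /A /fan_alt /= eqb_id; case: odd.
  rewrite -evalc_add.
  transitivity (evalc (fun s => evalc (A true) (faces s)) (fine_hemisphere j d.+1)).
    apply: eq_evalc => s; rewrite /A -[false]/(~~ true) -fan_alt_faces.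
    by rewrite -map_faces evalc_map.
  by rewrite -evalc_bdry bdry_fine_hemisphere AN ?IH// ltnW.
have [b [s [sj As]]] : exists b s, s \in fine_hemisphere j k /\ A b s.
  apply: contrapT => nA; have := main k (leqnn k).
  have z b : evalc (A b) (fine_hemisphere j k) = false.
    rewrite /evalc big_seq big1// => s sj; apply/negbTE/negP => As.
    by apply: nA; exists b, s.
  by rewrite !z.
have := fan_alt_size (nc _ _ (leqnn k) sj) As.
move=> /(_ m); rewrite size_map.
have /eqP -> := allP (size_fine_hemisphere j k) _ sj; apply.
by apply/allP => _ /mapP[v vs ->]; apply: lab_bound; exact: fine_hemisphere_in sj _ vs.
Qed.

End fan.

(** * The Borsuk-Ulam theorem on the l1 sphere *)

Section borsuk_ulam.
Variable R : realType.

Definition l1norm n (v : 'rV[R]_n) : R := \sum_i `|v ord0 i|.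

Definition l1sphere n : set 'rV[R]_n := [set v | l1norm v = 1].

Lemma l1norm_continuous n : continuous (@l1norm n).
Proof.
apply: (@continuous_big _ _ _ _ _ _ _ _ (fun i (v : 'rV[R]_n) => `|v ord0 i|)).
  exact: add_continuous.
move=> i _ v; apply: (@continuous_comp _ _ _ (fun v : 'rV[R]_n => v ord0 i) Num.norm).
  exact: coord_continuous.
exact: norm_continuous.
Qed.

Lemma l1norm_ge_norm n (v : 'rV[R]_n) : `|v| <= l1norm v.
Proof.
have l0 : 0 <= l1norm v by exact: sumr_ge0.
rewrite [leLHS]mx_normrE; apply: bigmax_le => // -[i j] _ /=.
by rewrite (ord1 i) /l1norm (bigD1 j)//= lerDl sumr_ge0.
Qed.

Lemma compact_l1sphere n : compact (@l1sphere n).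
Proof.
apply: bounded_closed_compact.
  exists 1; split => // x x1 v /= v1.
  by rewrite (le_trans (l1norm_ge_norm v))// v1 ltW.
rewrite (_ : @l1sphere n = @l1norm n @^-1` [set 1]).
  apply: preimage_closed; last exact: (@closed_eq R).
  by move=> v _; exact: l1norm_continuous.
by [].
Qed.

Lemma l1sphereN n (v : 'rV[R]_n) : l1sphere v -> l1sphere (- v).
Proof.
by rewrite /l1sphere/= /l1norm => <-; apply: eq_bigr => i _; rewrite mxE normrN.
Qed.

Section label.
Variable m : nat.
Implicit Type w : 'rV[R]_m.+1.

Definition max_coord w : 'I_m.+1 := [arg max_(j > ord0) `|w ord0 j|]%O.

(** The position of a coordinate of largest absolute value, with the sign of that coordinate, in the
    encoding of [fan_alt]. *)
Definition label w : nat := (((w ord0 (max_coord w) < 0)%R : bool) + (max_coord w).*2)%N.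

Lemma half_label w : (label w)./2 = max_coord w.
Proof. by rewrite /label half_bit_double. Qed.

Lemma odd_label w : odd (label w) = (w ord0 (max_coord w) < 0).
Proof. by rewrite /label oddD odd_double addbF; case: (_ < _). Qed.

Lemma norm_max_coord w : `|w| = `|w ord0 (max_coord w)|.
Proof.
rewrite /max_coord; case: arg_maxP => //= j _ jmax.
apply/eqP; rewrite eq_le; apply/andP; split.
  by rewrite [leLHS]mx_normrE; apply: bigmax_le => // -[i k] _ /=; rewrite (ord1 i) jmax.
rewrite [leRHS]mx_normrE.
by apply: (le_bigmax _ (fun i : 'I_1 * 'I_m.+1 => `|w i.1 i.2|) (ord0, j)).
Qed.

Lemma label_opp w : w != 0 -> label (- w) = flip (label w).
Proof.
move=> w0.
have e : max_coord (- w) = max_coord w.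
  by rewrite /max_coord; congr Order.arg_max; apply/funext => j; rewrite mxE normrN.
have nz : w ord0 (max_coord w) != 0 by rewrite -normr_eq0 -norm_max_coord normr_eq0.
rewrite /flip odd_label /label e mxE oppr_lt0.
by case: ltgtP nz.
Qed.

(** Near [w] the dominant coordinates of [u] and [v] exceed [|w| / 2] in absolute value. If they
    share their position they differ by less than [|w|], so their signs agree. *)
Lemma label_close w u v : `|u - w| < `|w| / 2 -> `|v - w| < `|w| / 2 ->
  (label u)./2 = (label v)./2 -> label u = label v.
Proof.
move=> uw vw; rewrite !half_label => /val_inj e.
have far z : `|z - w| < `|w| / 2 -> `|w| / 2 < `|z ord0 (max_coord z)|.
  by rewrite -norm_max_coord => zw; have := lerB_dist w (w - z);
     rewrite opprB addrCA subrr addr0 distrC; lra.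
have close : `|u ord0 (max_coord u) - v ord0 (max_coord u)| < `|w|.
  rewrite (@le_lt_trans _ _ `|u - v|)//.
    rewrite [leRHS]mx_normrE.
    have := le_bigmax 0 (fun i : 'I_1 * 'I_m.+1 => `|(u - v) i.1 i.2|) (ord0, max_coord u).
    by rewrite /= !mxE.
  have -> : u - v = (u - w) - (v - w) by rewrite opprB addrA subrK.
  by rewrite (le_lt_trans (ler_normB _ _))//; move: uw vw; lra.
have fu := far _ uw; have fv := far _ vw; rewrite -e in fv.
rewrite /label -e; congr (_ + _)%N; congr nat_of_bool.
move: fu fv close; rewrite ltr_norml.
set x := u _ _; set y := v _ _; move=> + + /andP[].
case: (ltP x 0) => x0; case: (ltP y 0) => y0 //.
  by rewrite (ltr0_norm x0) (ger0_norm y0); lra.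
by rewrite (ltr0_norm y0) (ger0_norm x0); lra.
Qed.

End label.

(** [label (f v)] is a Fan labelling: oddness of [f] gives antipodal labels, and continuity with
    [f v != 0] excludes complementary labels at nearby points. The target dimension bounds the
    number of absolute values. *)
Lemma borsuk_ulam (n m : nat) (f : 'rV[R]_n -> 'rV[R]_m) :
  {within @l1sphere n, continuous f} ->
  (forall v, l1sphere v -> f (- v) = - f v) ->
  (forall v, l1sphere v -> f v != 0) -> (n <= m)%N.
Proof.
case: n f => // k f fc fN f0.
pose e (i : nat) : 'rV[R]_k.+1 := \row_j (nat_of_ord j == i)%:R.
have l1e i : (i <= k)%N -> l1norm (e i) = 1.
  move=> ik; rewrite /l1norm (bigD1 (Ordinal (ik : (i < k.+1)%N)))//= mxE eqxx normr1.
  rewrite big1 ?addr0// => j /negPf ji; rewrite mxE.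
  by rewrite (_ : (_ == _) = false) ?normr0//.
case: m f fc fN f0 => [|m] f fc fN f0.
  by have := f0 (e 0%N) (l1e _ (leq0n _)); rewrite [f _]thinmx0 eqxx.
(* [label_close] with centre [f x] gives a radius around each [x]; compactness of the sphere makes
   it uniform. *)
have [d d0 Hd] : exists2 d : R, 0 < d & forall u v, l1sphere u -> l1sphere v ->
    `|u - v| < d -> (label (f u))./2 = (label (f v))./2 -> label (f u) = label (f v).
  have /compact_near_coveringP := @compact_l1sphere k.+1.
  move=> /(_ R (0^'+) (fun d x => forall u v, l1sphere u -> l1sphere v ->
    `|x - u| < d -> `|x - v| < d ->
    (label (f u))./2 = (label (f v))./2 -> label (f u) = label (f v)) _).
  case.
    move=> x Kx; move/subspace_continuousP : fc => /(_ x Kx).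
    have h : 0 < `|f x| / 2 by rewrite divr_gt0// normr_gt0 f0.
    move=> /cvgrPdist_lt/(_ _ h); rewrite /prop_near1 /within /= => /nbhs_ballP[r /= r0 Hr].
    have r2 : 0 < r / 2 by rewrite divr_gt0.
    have nx : \forall y \near x, `|x - y| < r / 2.
      by apply/nbhs_ballP; exists (r / 2) => // y; rewrite -ball_normE.
    near=> y d => u v Ku Kv yu yv.
    have near_x z : `|y - z| < d -> `|x - z| < r.
      move=> yz; have xy : `|x - y| < r / 2 by near: y; exact: nx.
      have dr : d <= r / 2 by near: d; exact: nbhs_right_le.
      rewrite -(subrKA y) (le_lt_trans (ler_normD _ _))//.
      by move: xy yz dr; lra.
    apply: (@label_close _ (f x)).
      by rewrite distrC; apply: Hr => //; rewrite -ball_normE /=; exact: near_x.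
    by rewrite distrC; apply: Hr => //; rewrite -ball_normE /=; exact: near_x.
  move=> d /= d0 Hd; exists (d / 2); first by rewrite divr_gt0.
  move=> u v Ku Kv uv; apply: (Hd (d / 2) _ _ u Ku u v Ku Kv) => //.
  - by rewrite /ball /= sub0r normrN gtr0_norm ?divr_gt0// ltr_pdivrMr// ltr_pMr// ltr1n.
  - by rewrite divr_gt0.
  - by rewrite subrr normr0 divr_gt0.
apply: (@fan_theorem R 'rV[R]_k.+1 e k m.+1 (@l1sphere k.+1) (fun v => label (f v)) d d0).
- move=> sg.
  (* The linear form with the signs [sg]. As [L <= l1norm], the convex set where [l1norm <= 1] and
     [L >= 1] lies on the sphere; it is the face spanned by the signed vertices. *)
  pose L (v : 'rV[R]_k.+1) : R := \sum_i (if sg (nat_of_ord i) then - v ord0 i else v ord0 i).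
  have LD u v : L (u + v) = L u + L v.
    by rewrite /L -big_split; apply: eq_bigr => i _; rewrite mxE; case: ifP => // _; rewrite
      opprD.
  have LZ c v : L (c *: v) = c * L v.
    by rewrite /L mulr_sumr; apply: eq_bigr => i _; rewrite mxE; case: ifP => // _; rewrite mulrN.
  have Ll v : L v <= l1norm v.
    apply: ler_sum => i _; case: ifP => _; last exact: ler_norm.
    by rewrite -normrN ler_norm.
  exists ([set v | l1norm v <= 1] `&` [set v | - L v <= -1]).
    apply: avg_closedI; apply: avg_closed_sublevel.
    - move=> x y; rewrite /l1norm -big_split; apply: ler_sum => i _ /=.
      by rewrite mxE ler_normD.
    - move=> c x c0; rewrite /l1norm mulr_sumr; apply: ler_sum => i _.
      by rewrite mxE normrM ger0_norm.
    - by move=> x y; rewrite LD opprD.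
    - by move=> c x c0; rewrite LZ mulrN.
  split.
    move=> v [/= v1 Lv]; apply/eqP; rewrite eq_le v1/=.
    by rewrite (le_trans _ (Ll v))// -lerN2.
  move=> i ik; split => /=.
    have : l1sphere (signed_vertex e sg i).
      by rewrite /signed_vertex; case: ifP => _; [apply: l1sphereN|]; exact: l1e.
    by move=> ->.
  rewrite lerN2 /L (bigD1 (Ordinal (ik : (i < k.+1)%N)))//= /signed_vertex.
  rewrite big1 ?addr0.
    by case: (sg i); rewrite !mxE ?eqxx ?opprK.
  move=> j /negPf ji; have {}ji : (nat_of_ord j == i) = false by [].
  by case: (sg i); rewrite !mxE ji ?oppr0; case: ifP => //; rewrite ?oppr0.
- exists 2 => sg i j ik jk; rewrite (le_trans (ler_normB _ _))//.
  have b i' : (i' <= k)%N -> `|signed_vertex e sg i'| <= 1.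
    move=> ik'; rewrite -(l1e i' ik') /signed_vertex.
    by case: ifP => _; rewrite ?normrN l1norm_ge_norm.
  by rewrite -[2]/(1 + 1) lerD// b.
- by move=> v Kv; rewrite fN// label_opp// f0.
- by move=> v Kv; rewrite half_label.
- exact: Hd.
Unshelve. all: end_near. Qed.

End borsuk_ulam.

(** * Smooth functions on R^N *)

Section smooth_calculus.
Context {R : realType} {N : nat}.
Implicit Types (f g u v : 'rV[R]_N -> R).

(** Avoids any formula for iterated partial derivatives: to prove smoothness it is enough to exhibit
    a class that contains the function and is stable under [partial]. *)
Lemma smooth_coind (F : set ('rV[R]_N -> R)) :
  (forall g, F g -> continuous g /\ forall i,
    (forall x, derivable g x (unit_vec i)) /\ F (partial i g)) ->
  forall g, F g -> smooth g.
Proof.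
move=> HF g Fg s.
have Fs : F (iter_partial s g).
  by elim: s => //= i s /HF[_ /(_ i)[]].
by have [cs ds] := HF _ Fs; split => // i x; have [+ _] := ds i; exact.
Qed.

Lemma smooth_continuous f : smooth f -> continuous f.
Proof. by move=> /(_ [::])[]. Qed.

Lemma smooth_derivable f i x : smooth f -> derivable f x (unit_vec i).
Proof. by move=> /(_ [::])[_]; exact. Qed.

Lemma smooth_is_derive f i x : smooth f -> is_derive x (unit_vec i) f (partial i f x).
Proof. by move=> sf; apply/derivableP; exact: smooth_derivable. Qed.

Lemma smooth_partial f i : smooth f -> smooth (partial i f).
Proof.
move=> sf s; have := sf (rcons s i); rewrite /iter_partial foldr_rcons.
by [].
Qed.

Lemma is_derive_partial (f : 'rV[R]_N -> R) i df :
  (forall x, is_derive x (unit_vec i) f (df x)) -> partial i f = df.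
Proof. by move=> fdf; apply/funext => x; have [_] := fdf x. Qed.

(** Reduces directional derivatives to derivatives on the line, where the chain rule is
    available. *)
Lemma is_derive_line f x w (df : R) :
  is_derive x w f df <-> is_derive (0 : R) 1 (fun t : R => f (t *: w + x)) df.
Proof.
have E : 'D_w f x = 'D_1 (fun t : R => f (t *: w + x)) 0.
  rewrite /derive; set g1 := fun h => h^-1 *: _; set g2 := fun h => h^-1 *: _.
  suff -> : g1 = g2 by [].
  by rewrite funeqE /g1 /g2 => t /=; rewrite addr0 scale0r add0r [_%:A]mulr1.
split=> -[dk1 dk2]; constructor.
- exact: (iffLR (derivable1P _ _ _) dk1).
- by rewrite -E.
- exact: (iffRL (derivable1P _ _ _) dk1).
- by rewrite E.
Qed.

Lemma is_derive_comp1 (h : R -> R) f x w (df dh : R) :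
  is_derive x w f df -> is_derive (f x) 1 h dh ->
  is_derive x w (h \o f) (dh * df).
Proof.
move=> fdf hdh; apply: (iffRL (is_derive_line _ _ _ _)).
have fdf' := iffLR (is_derive_line _ _ _ _) fdf.
have hdh' : is_derive (f (0 *: w + x)) 1 h dh by rewrite scale0r add0r.
exact: (is_derive1_comp hdh' fdf').
Qed.

Lemma smooth_cst (c : R) : smooth (fun _ : 'rV[R]_N => c).
Proof.
apply: (@smooth_coind [set f | exists c, f = fun=> c]); last by exists c.
move=> _ [k ->]; split; first exact: cst_continuous.
move=> i; split; first by move=> x; exact: derivable_cst.
by exists 0; apply: is_derive_partial => x; exact: is_derive_cst.
Qed.

Lemma smoothD f g : smooth f -> smooth g -> smooth (fun x => f x + g x).
Proof.
move=> sf sg.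
apply: (@smooth_coind [set h | exists f g, [/\ smooth f, smooth g & h = fun x => f x + g x]]);
  last by exists f, g.
move=> _ [{sf}f [{sg}g [sf sg ->]]]; split.
  move=> x; apply: (@continuousD R _ _ f g); exact: smooth_continuous.
move=> i.
have d x : is_derive x (unit_vec i) (fun x => f x + g x) (partial i f x + partial i g x).
  by apply: is_deriveD; exact: smooth_is_derive.
split; first by move=> x; have [] := d x.
by exists (partial i f), (partial i g); split; [exact: smooth_partial..|exact: is_derive_partial].
Qed.

(** Products are not stable under differentiation, but by the Leibniz rule sums of products are;
    this is the class for [smooth_coind]. *)
Inductive product_span : ('rV[R]_N -> R) -> Prop :=
| product_spanM f g : smooth f -> smooth g -> product_span (fun x => f x * g x)
| product_spanD f g : product_span f -> product_span g ->
    product_span (fun x => f x + g x).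

Lemma smoothM f g : smooth f -> smooth g -> smooth (fun x => f x * g x).
Proof.
move=> sf sg; apply: (smooth_coind (F := product_span)); last exact: product_spanM.
move=> h; elim=> {sf sg f g h} [f g sf sg|f g _ [cf df] _ [cg dg]].
  split.
    by move=> x; apply: (@continuousM R _ f g); exact: smooth_continuous.
  move=> i.
  have d x : is_derive x (unit_vec i) (fun x => f x * g x)
      (f x * partial i g x + partial i f x * g x).
    apply: is_derive_eq; first by apply: is_deriveM; exact: smooth_is_derive.
    by rewrite [X in _ + X]mulrC.
  split; first by move=> x; have [] := d x.
  rewrite (is_derive_partial d); apply: product_spanD; apply: product_spanM.
  - exact: sf.
  - exact: (smooth_partial i sg).
  - exact: (smooth_partial i sf).
  - exact: sg.
split; first by move=> x; apply: (@continuousD R _ _ f g); [exact: cf|exact: cg].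
move=> i; have [df1 df2] := df i; have [dg1 dg2] := dg i.
have d x : is_derive x (unit_vec i) (fun x => f x + g x) (partial i f x + partial i g x).
  by apply: is_deriveD; exact: derivableP.
split; first by move=> x; have [] := d x.
by rewrite (is_derive_partial d); exact: product_spanD.
Qed.

Inductive comp_span (h : nat -> R -> R) f : ('rV[R]_N -> R) -> Prop :=
| comp_spanM n v : smooth v -> comp_span h f (fun x => h n (f x) * v x)
| comp_spanD g1 g2 : comp_span h f g1 -> comp_span h f g2 ->
    comp_span h f (fun x => g1 x + g2 x).

(** [h n] has to be the n-th derivative of [h 0] only at the values of [f], so [h 0] may be singular
    elsewhere, like a real power at 0. *)
Lemma smooth_comp (h : nat -> R -> R) f : smooth f ->
  (forall n x, is_derive (f x) 1 (h n) (h n.+1 (f x))) ->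
  smooth (fun x => h 0%N (f x)).
Proof.
move=> sf dh; apply: (smooth_coind (F := comp_span h f)); last first.
  have := comp_spanM h f 0 (smooth_cst 1).
  by congr comp_span; apply/funext => x; rewrite mulr1.
have cf : continuous f by exact: smooth_continuous.
have ch n : continuous (fun x => h n (f x)).
  move=> x; apply: (@continuous_comp _ _ _ f (h n)); first exact: cf.
  by have [/derivable1_diffP/differentiable_continuous] := dh n x.
have dhf n x i : is_derive x (unit_vec i) (fun x => h n (f x)) (h n.+1 (f x) * partial i f x).
  exact: (is_derive_comp1 (smooth_is_derive i x sf) (dh n x)).
move=> g; elim=> {g} [n v sv|g1 g2 _ [c1 d1] _ [c2 d2]].
  split.
    move=> x; apply: (@continuousM R _ (fun x => h n (f x)) v); first exact: ch.
    exact: smooth_continuous.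
  move=> i.
  have d x : is_derive x (unit_vec i) (fun x => h n (f x) * v x)
      (h n (f x) * partial i v x + h n.+1 (f x) * (partial i f x * v x)).
    apply: (is_derive_eq (is_deriveM (dhf n x i) (smooth_is_derive i x sv))).
    by rewrite [X in _ + X]mulrC mulrA.
  split; first by move=> x; have [] := d x.
  rewrite (is_derive_partial d); apply: comp_spanD; apply: comp_spanM.
    exact: (smooth_partial i sv).
  apply: smoothM; [exact: (smooth_partial i sf)|exact: sv].
split; first by move=> x; apply: (@continuousD R _ _ g1 g2); [exact: c1|exact: c2].
move=> i; have [d11 d12] := d1 i; have [d21 d22] := d2 i.
have d x : is_derive x (unit_vec i) (fun x => g1 x + g2 x) (partial i g1 x + partial i g2 x).
  by apply: is_deriveD; exact: derivableP.
split; first by move=> x; have [] := d x.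
by rewrite (is_derive_partial d); exact: comp_spanD.
Qed.

Lemma partialD f g i : smooth f -> smooth g ->
  partial i (fun x => f x + g x) = fun x => partial i f x + partial i g x.
Proof.
by move=> sf sg; apply: is_derive_partial => x; apply: is_deriveD; exact: smooth_is_derive.
Qed.

Lemma partialM f g i : smooth f -> smooth g ->
  partial i (fun x => f x * g x) = fun x => f x * partial i g x + partial i f x * g x.
Proof.
move=> sf sg; apply: is_derive_partial => x; apply: is_derive_eq.
  by apply: is_deriveM; exact: smooth_is_derive.
by rewrite [X in _ + X]mulrC.
Qed.

Lemma partial_cst (c : R) i : partial i (fun _ : 'rV[R]_N => c) = fun=> 0.
Proof. by apply: is_derive_partial => x; exact: is_derive_cst. Qed.

Lemma smoothN f : smooth f -> smooth (fun x => - f x).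
Proof.
move=> sf; have := smoothM (smooth_cst (-1)) sf.
by congr smooth; apply/funext => x; rewrite mulN1r.
Qed.

Lemma smoothB f g : smooth f -> smooth g -> smooth (fun x => f x - g x).
Proof. by move=> sf sg; apply: smoothD; [exact: sf|exact: smoothN]. Qed.

Lemma smooth_coord (i : 'I_N) : smooth (fun x : 'rV[R]_N => x ord0 i).
Proof.
apply: (@smooth_coind [set f : 'rV[R]_N -> R | (exists c, f = fun=> c) \/
  f = (fun x => x ord0 i)]); last by right.
move=> _ [[c ->]|->].
  split; first exact: cst_continuous.
  move=> j; split; first by move=> x; exact: derivable_cst.
  by left; exists 0; rewrite partial_cst.
split; first exact: coord_continuous.
move=> j.
have d x : is_derive x (unit_vec j) (fun x : 'rV[R]_N => x ord0 i) (i == j)%:R.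
  have c : (fun h : R => h^-1 *: (((fun x : 'rV[R]_N => x ord0 i) \o shift x) (h *: unit_vec j) -
      x ord0 i)) @ 0^' --> ((i == j)%:R : R).
    apply: cvg_near_cst; near=> h; apply/eqP.
    rewrite /= !mxE eqxx/= addrK eq_sym.
    rewrite /GRing.scale /= mulrA mulVf ?mul1r//.
    by near: h; exact: nbhs_dnbhs_neq.
  by constructor; [apply/cvg_ex; eexists; exact: c|exact: cvg_lim c].
split; first by move=> x; have [] := d x.
by left; exists (i == j)%:R; exact: is_derive_partial.
Unshelve. all: by end_near. Qed.

Lemma smooth_sum n (F : 'I_n -> 'rV[R]_N -> R) : (forall j, smooth (F j)) ->
  smooth (fun x => \sum_(j < n) F j x).
Proof.
elim: n F => [|n IH] F sF.
  have := smooth_cst 0; congr smooth; apply/funext => x; by rewrite big_ord0.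
have := smoothD (IH _ (fun j => sF (widen_ord (leqnSn n) j))) (sF ord_max).
by congr smooth; apply/funext => x; rewrite big_ord_recr.
Qed.

Lemma is_derive_affine f (c : R) (z x w : 'rV[R]_N) df :
  is_derive (c *: x + z) w f df -> is_derive x w (fun y => f (c *: y + z)) (c * df).
Proof.
have [->|c0] := eqVneq c 0.
  move=> _; rewrite mul0r (_ : (fun y => _) = fun=> f z); first exact: is_derive_cst.
  by apply/funext => y; rewrite scale0r add0r.
move=> [df1 df2]; move: df1; rewrite /derivable => /cvg_ex [/= l fl].
have {df2} ldf : l = df by rewrite -df2; apply/esym; exact: cvg_lim fl.
subst l.
have cv : (fun h : R => h^-1 *: (((fun y => f (c *: y + z)) \o shift x) (h *: w) -
      f (c *: x + z))) @ 0^' --> (c * df : R).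
  rewrite (_ : (fun h => _) = (fun h : R => c * ((fun h => h^-1 *:
     ((f \o shift (c *: x + z)) (h *: w) - f (c *: x + z))) (c * h)))); last first.
    apply/funext => h; rewrite /comp /shift (scalerDr c) scalerA addrA.
    by rewrite /GRing.scale /= invfM mulrA mulrA mulfV// mul1r.
  apply: cvgM; first exact: cvg_cst.
  apply: (cvg_comp _ _ _ fl).
  have cc : (c * h @[h --> (0 : R)] --> c * 0)%R by apply: cvgM; [exact: cvg_cst|exact: cvg_id].
  rewrite mulr0 in cc.
  move=> A /= A0; have := cc _ A0; rewrite /nbhs/= /dnbhs /within /= => H.
  near=> h => h0; have : h \in [set h | c * h != 0 -> A (c * h)] by rewrite inE; near: h; exact:
    H.
  by rewrite inE; apply; rewrite mulf_neq0.
by constructor; [apply/cvg_ex; eexists; exact: cv|exact: cvg_lim cv].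
Unshelve. all: by end_near. Qed.

Lemma smooth_affine f (c : R) (z : 'rV[R]_N) :
  smooth f -> smooth (fun x => f (c *: x + z)).
Proof.
move=> sf; apply: (@smooth_coind [set g : 'rV[R]_N -> R | exists k h, smooth h /\
    g = fun x => k * h (c *: x + z)]); last first.
  by exists 1, f; split => //; apply/funext => x; rewrite mul1r.
move=> _ [k [h [sh ->]]]; split.
  have cz : continuous (fun x : 'rV[R]_N => h (c *: x + z)).
    move=> x; apply: (@continuous_comp _ _ _ (fun x : 'rV[R]_N => c *: x + z) h).
      apply: (@continuousD R 'rV[R]_N _ (fun y : 'rV[R]_N => c *: y) (cst z)).
        exact: scaler_continuous.
      exact: cst_continuous.
    exact: (smooth_continuous sh).
  move=> x; exact: (@continuousM R _ (cst k) _ x (@cst_continuous _ _ k x) (cz x)).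
move=> i.
have d x : is_derive x (unit_vec i) (fun x => k * h (c *: x + z))
    ((k * c) * partial i h (c *: x + z)).
  apply: is_derive_eq.
    apply: (@is_deriveZ _ _ _ (fun x => h (c *: x + z)) k).
    by apply: is_derive_affine; exact: smooth_is_derive.
  by rewrite /GRing.scale /= mulrA.
split; first by move=> x; have [] := d x.
by exists (k * c), (partial i h); split; [exact: (smooth_partial i sh)|exact: is_derive_partial].
Qed.

Lemma partial_affine f (c : R) (z : 'rV[R]_N) i : smooth f ->
  partial i (fun x => f (c *: x + z)) = fun x => c * partial i f (c *: x + z).
Proof.
move=> sf; apply: is_derive_partial => x.
by apply: is_derive_affine; exact: smooth_is_derive.
Qed.

End smooth_calculus.

(** * The flat function exp(-1/t) *)

Section bump.
Context {R : realType}.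
Implicit Types (p : {poly R}) (t : R).

(** The n-th power of [s / n <= expR (s / n)]. *)
Lemma exprn_le_expR (n : nat) (s : R) : 0 <= s -> s ^+ n <= n%:R ^+ n * expR s.
Proof.
case: n => [|n] s0; first by rewrite !expr0 mul1r -expR0 ler_expR.
have n0 : 0 < n.+1%:R :> R by rewrite ltr0n.
have -> : expR s = expR (s / n.+1%:R) ^+ n.+1.
  by rewrite -expRM_natl mulrC divfK// gt_eqF.
rewrite -exprMn lerXn2r ?nnegrE//.
rewrite -ler_pdivrMl// mulrC.
by rewrite (le_trans _ (expR_ge1Dx _))// lerDr.
Qed.

Lemma horner_le_expR p : exists C : R, 0 <= C /\ forall s, 0 <= s -> `|p.[s]| <= C * expR s.
Proof.
exists (\sum_(i < size p) `|p`_i| * i%:R ^+ i); split.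
  by apply: sumr_ge0 => i _; rewrite mulr_ge0// exprn_ge0.
move=> s s0; rewrite horner_coef (le_trans (ler_norm_sum _ _ _))// mulr_suml.
apply: ler_sum => i _; rewrite normrM -mulrA ler_wpM2l//.
by rewrite ger0_norm ?exprn_ge0// exprn_le_expR.
Qed.

Definition bump_fun p t : R := if 0 < t then p.[t^-1] * expR (- t^-1) else 0.

(** For [t > 0] the derivative of [p(1/t) exp(-1/t)] is [t^-2 (p(1/t) - p'(1/t)) exp(-1/t)], again a
    function of this form. *)
Definition bump_step p : {poly R} := 'X^2 * (p - p^`()).

Lemma is_derive_bump_fun p t : is_derive t 1 (bump_fun p) (bump_fun (bump_step p) t).
Proof.
have [t0|t0|<-] := ltgtP 0 t.
- have tn0 : t != 0 by rewrite gt_eqF.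
  have d : is_derive t 1 (fun t => p.[t^-1] * expR (- t^-1)) (bump_fun (bump_step p) t).
    have dV : is_derive t 1 (fun t : R => t^-1) (- t ^- 2).
      constructor; first exact: (@derivableV _ _ id).
      by rewrite (@deriveV _ _ id)// derive_id [_ *: _]mulr1.
    have d1 := is_derive1_comp (is_derive_poly p t^-1) dV.
    have d2 := @is_derive1_comp R expR (fun t => - t^-1) t _ _
      (is_derive_expR _) (is_deriveN dV).
    apply: (is_derive_eq (is_deriveM d1 d2)).
    rewrite /bump_fun /bump_step t0 !hornerE /= /GRing.scale /=.
    rewrite -exprVn; ring.
  apply: near_eq_is_derive d; near=> s; rewrite /bump_fun ifT//.
  by near: s; exact: lt_nbhsr.
- have -> : bump_fun (bump_step p) t = 0 by rewrite /bump_fun ltNge ltW.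
  apply: (near_eq_is_derive _ (is_derive_cst (0 : R) t 1)); near=> s.
  rewrite /bump_fun ifF//; apply/negbTE; rewrite -leNgt ltW//.
  by near: s; exact: lt_nbhsl.
(* One factor [X] accounts for the division by [h] in the difference quotient; the other leaves the
   bound [C * |h|], which tends to 0. *)
- have [C [C0 HC]] := horner_le_expR ('X^2 * p).
  have -> : bump_fun (bump_step p) 0 = 0 by rewrite /bump_fun ltxx.
  have cv : (fun h : R => h^-1 *: ((bump_fun p \o shift 0) (h *: (1 : R)) - bump_fun p 0))
      @ 0^' --> (0 : R).
    apply/cvgrPdist_le => e e0; near=> h.
    rewrite sub0r normrN /= addr0 [h *: 1]mulr1.
    have -> : bump_fun p 0 = 0 by rewrite /bump_fun ltxx.
    rewrite subr0 /GRing.scale /=.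
    have he : `|h| <= e / (C + 1).
      near: h; apply: dnbhs0_le; rewrite divr_gt0//; lra.
    apply: (@le_trans _ _ (C * `|h|)); last first.
      rewrite (le_trans (ler_wpM2l C0 he))// mulrCA ger_pMr//.
      by rewrite ler_pdivrMr; lra.
    rewrite /bump_fun; case: ifPn => h0; last by rewrite mulr0 normr0 mulr_ge0.
    have := HC h^-1; rewrite invr_ge0 => /(_ (ltW h0)).
    rewrite !hornerE normrM => H.
    rewrite !normrM (gtr0_norm (expR_gt0 _)) expRN.
    have {}H : `|h^-1| * `|p.[h^-1]| <= C * expR h^-1 * `|h|.
      rewrite -ler_pdivrMr ?normr_gt0 ?gt_eqF// (le_trans _ H)//.
      by rewrite normrX normfV expr2 mulrAC.
    by rewrite ler_pdivrMr ?expR_gt0// mulrAC.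
  by constructor; [apply/cvg_ex; eexists; exact: cv|exact: cvg_lim cv].
Unshelve. all: by end_near. Qed.

Definition bump_poly n : {poly R} := iter n bump_step 1.

Definition flat_exp : R -> R := bump_fun 1.

Lemma flat_exp_gt0 t : 0 < t -> 0 < flat_exp t.
Proof. by move=> t0; rewrite /flat_exp /bump_fun t0 hornerC mul1r expR_gt0. Qed.

Lemma flat_exp_le0 t : t <= 0 -> flat_exp t = 0.
Proof. by move=> t0; rewrite /flat_exp /bump_fun ltNge t0. Qed.

Lemma flat_exp_ge0 t : 0 <= flat_exp t.
Proof. by have [/flat_exp_le0->//|/flat_exp_gt0/ltW] := leP t 0. Qed.

Lemma flat_exp_le1 t : flat_exp t <= 1.
Proof.
have [/flat_exp_le0->//|t0] := leP t 0.
rewrite /flat_exp /bump_fun t0 hornerC mul1r -expR0 ler_expR.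
by rewrite oppr_le0 invr_ge0 ltW.
Qed.

Lemma flat_expE t : 0 < t -> flat_exp t = expR (- t^-1).
Proof. by move=> t0; rewrite /flat_exp /bump_fun t0 hornerC mul1r. Qed.

End bump.

Section smooth_compositions.
Context {R : realType} {N : nat}.
Implicit Types (f : 'rV[R]_N -> R).

Lemma smooth_flat_exp f : smooth f -> smooth (fun x => flat_exp (f x)).
Proof.
move=> sf; apply: (smooth_comp (h := fun n => bump_fun (bump_poly n))) => //.
by move=> n x; exact: is_derive_bump_fun.
Qed.

(** Each derivative of the cosine is a shift by a quarter period, so [cos (t + n pi / 2)] describes
    all of them at once. *)
Lemma smooth_cos f : smooth f -> smooth (fun x => cos (f x)).
Proof.
move=> sf; have := @smooth_comp _ _ (fun n t => cos (t + pi / 2 *+ n)) f sf.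
rewrite (_ : (fun x => cos (f x + pi / 2 *+ 0)) = (fun x => cos (f x))); last first.
  by apply/funext => x; rewrite mulr0n addr0.
apply => n x.
have d : is_derive (f x) 1 (fun t : R => t + pi / 2 *+ n) 1.
  by rewrite -[X in is_derive _ _ _ X]addr0; apply: is_deriveD.
have := is_derive1_comp (is_derive_cos _) d.
rewrite mulr1 => dd; apply: (is_derive_eq dd).
by rewrite [in RHS](mulrSr (pi / 2)) addrA cosDpihalf.
Qed.

Lemma smooth_powR f (q : R) : smooth f -> (forall x, 0 < f x) ->
  smooth (fun x => f x `^ q).
Proof.
move=> sf f0.
(* Falling factorials of [q]: the n-th derivative of [t^q] is [c n * t^(q - n)]. *)
pose c := fix c (n : nat) : R := if n is n'.+1 then c n' * (q - n'%:R) else 1.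
have := @smooth_comp _ _ (fun n t => c n * t `^ (q - n%:R)) f sf.
rewrite (_ : (fun x => c 0%N * f x `^ (q - 0%:R)) = (fun x => f x `^ q)); last first.
  by apply/funext => x; rewrite mul1r subr0.
apply => n x.
have := is_deriveZ (c n) (is_derive1_powR (q - n%:R) (f0 x)).
move=> dd; apply: (is_derive_eq dd).
by rewrite /GRing.scale /= mulrA -addn1 natrD opprD addrA.
Qed.

End smooth_compositions.

(** * Lebesgue measure on R^N *)

Section lebesgue_line.
Context {R : realType}.
Local Notation mu := (@lebesgue_measure R).

Lemma measurable_shiftR (h : R) : measurable_fun [set: R] (fun x : R => x + h).
Proof. by apply: measurable_funD => //; exact: measurable_cst. Qed.

Lemma lebesgue_measure_shift (h : R) (A : set R) : measurable A ->
  mu ((fun x => x + h) @^-1` A) = mu A.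
Proof.
move=> mA; apply/esym.
have mf : @measurable_fun _ _ (measurableTypeR R) (measurableTypeR R) setT (fun x : R => x + h).
  exact: measurable_shiftR.
pose m' : {measure set (measurableTypeR R) -> \bar R} :=
  measure_function_pushforward__canonical__measure_function_Measure mu mf.
apply: (@lebesgue_measure_unique R m') => // X [[a b]] _ <-.
rewrite /= /pushforward.
have -> : (fun x => x + h) @^-1` `]a, b]%classic = `]a - h, b - h]%classic.
  apply/seteqP; split=> x /=; rewrite !in_itv/=; lra.
by rewrite !lebesgue_measure_itv /= !lte_fin ltrD2r -!EFinB opprB addrA subrK.
Qed.

End lebesgue_line.

Section lebesgue_space.
Context {R : realType}.

Lemma measurable_shift_rV N (h : 'rV[R]_N) :
  measurable_fun setT (fun v : 'rV[R]_N => v + h).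
Proof.
apply/measurable_rVP => i; under eq_fun do rewrite mxE.
by apply: measurable_funD; [exact: measurable_coord|exact: measurable_cst].
Qed.

(** Induction on the dimension: the translated product measure agrees with the product measure on
    rectangles, hence everywhere by uniqueness. *)
Lemma leb_shift N (h : 'rV[R]_N) (A : set 'rV[R]_N) : measurable A ->
  leb R N ((fun v => v + h) @^-1` A) = leb R N A.
Proof.
elim: N h A => [|N IH] h A mA.
  by congr (leb R 0 _); apply/seteqP; split=> v /=; rewrite (thinmx0 (v + h)) (thinmx0 v).
pose h0 := h ord0 ord0; pose h' : 'rV[R]_N := \row_j h ord0 (lift ord0 j).
pose T (x : R * 'rV[R]_N) := (x.1 + h0, x.2 + h').
have mT : measurable_fun setT T.
  apply: measurable_fun_pair.
    by apply: (measurableT_comp (measurable_shiftR h0)); exact: measurable_fst.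
  by apply: (measurableT_comp (measurable_shift_rV h')); exact: measurable_snd.
have mT' : @measurable_fun _ _ (measurableTypeR R * 'rV[R]_N)%type
  (measurableTypeR R * 'rV[R]_N)%type setT T by exact: mT.
pose m' : {measure set (measurableTypeR R * 'rV[R]_N) -> \bar R} :=
  measure_function_pushforward__canonical__measure_function_Measure
  (lebesgue_measure \x leb R N)%E mT'.
have mC : measurable ((@rV_cons R N) @^-1` A).
  by rewrite -[X in measurable X]setTI; exact: measurable_rV_cons.
transitivity (m' ((@rV_cons R N) @^-1` A)).
  rewrite /= /leb_succ /pushforward; congr ((lebesgue_measure \x leb R N)%E _).
  have E x : rV_cons x + h = rV_cons (T x).
    apply/rowP => i; rewrite /T !mxE.
    by case: unliftP => [j ->|->]; rewrite ?mxE.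
  by apply: funext => x; exact: (congr1 A (E x)).
suff H : forall (B : set (measurableTypeR R)) C, measurable B -> measurable C -> m' (B `*` C) =
  (lebesgue_measure B * leb R N C)%E.
  have -> : leb R N.+1 A = (lebesgue_measure \x leb R N)%E ((@rV_cons R N) @^-1` A) by [].
  have K := @product_measure_unique _ _ _ _ _ lebesgue_measure (leb R N) m' H _ mC.
  by rewrite -[LHS]K.
move=> B C mB mC' /=; rewrite /pushforward.
have -> : T @^-1` (B `*` C) = ((fun x => x + h0) @^-1` B) `*` ((fun v => v + h') @^-1` C) by [].
rewrite product_measure1E.
- by rewrite IH//; congr (_ * _)%E; exact: lebesgue_measure_shift.
- by rewrite -[X in measurable X]setTI; exact: measurable_shiftR.
- by rewrite -[X in measurable X]setTI; exact: measurable_shift_rV.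
Qed.

Lemma ge0_integral_shift N (h : 'rV[R]_N) (f : 'rV[R]_N -> \bar R) :
  measurable_fun [set: 'rV[R]_N] f -> (forall x, 0 <= f x)%E ->
  (\int[leb R N]_x f ((x : 'rV[R]_N) + h)%R = \int[leb R N]_x f x)%E.
Proof.
move=> mf f0.
rewrite -[LHS](@ge0_integral_pushforward _ _ _ _ _ _ (measurable_shift_rV h) _ setT f)//.
apply: eq_measure_integral; first exact: measurable_shift_rV.
  by move=> ? A mA _; exact: (leb_shift h mA).
Qed.

Lemma integrable_shift N (h : 'rV[R]_N) (f : 'rV[R]_N -> \bar R) :
  (leb R N).-integrable setT f -> (leb R N).-integrable setT (fun x : 'rV[R]_N => f (x + h)).
Proof.
move=> /integrableP[mf fi]; apply/integrableP; split.
  by apply: (measurableT_comp mf); exact: measurable_shift_rV.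
rewrite (@ge0_integral_shift _ _ (fun x => `|f x|%E))//.
exact: measurableT_comp.
Qed.

Lemma integral_shift N (h : 'rV[R]_N) (f : 'rV[R]_N -> \bar R) :
  (leb R N).-integrable setT f ->
  (\int[leb R N]_x f ((x : 'rV[R]_N) + h)%R = \int[leb R N]_x f x)%E.
Proof.
move=> fi; have mf := measurable_int _ fi.
rewrite -[LHS](@integral_pushforward _ _ _ _ _ _ (measurable_shift_rV h) _ setT f)//.
  apply: eq_measure_integral; first exact: measurable_shift_rV.
  by move=> ? A mA _; exact: (leb_shift h mA).
exact: (integrable_shift h fi).
Qed.

Lemma measurable_forall_coord N (B : 'I_N -> set R) :
  (forall i, measurable (B i)) -> measurable [set v : 'rV[R]_N | forall i, B i (v ord0 i)].
Proof.
move=> mB; rewrite (_ : [set v | _] = \bigcap_(i in [set: 'I_N])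
    ((fun v : 'rV[R]_N => v ord0 i) @^-1` B i)).
  apply: fin_bigcap_measurable => [|i _]; first exact: finite_finset.
  by rewrite -[X in measurable X]setTI; exact: measurable_coord.
by apply/seteqP; split=> v H i; [move=> _; exact: H|exact: H].
Qed.

(** The sigma-algebra is generated by coordinates, so openness enters through countably many boxes
    with rational centres and radii [1 / (n + 1)]: an open set is the union of those it contains. *)
Lemma measurable_open_rV N (A : set 'rV[R]_N) : open A -> measurable A.
Proof.
move=> oA.
pose box (p : 'rV[rat]_N * nat) : set 'rV[R]_N :=
  [set v | forall i, `|ratr (p.1 ord0 i) - v ord0 i| < p.2.+1%:R^-1].
have mbox p : measurable (box p).
  apply: (@measurable_forall_coord N (fun i => [set t | `|ratr (p.1 ord0 i) - t| <
    p.2.+1%:R^-1])) => i.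
  rewrite (_ : [set t | _] = ball (ratr (p.1 ord0 i) : R) p.2.+1%:R^-1).
    exact: measurable_ball.
  by apply/seteqP; split=> t; rewrite /ball.
pose F n : set 'rV[R]_N := if unpickle n is Some p then
  if pselect (box p `<=` A) then box p else set0 else set0.
rewrite (_ : A = \bigcup_n F n).
  apply: bigcupT_measurable => n; rewrite /F; case: unpickle => // p.
  case: ifP => _; [exact: mbox|exact: measurable0].
apply/seteqP; split=> v; last first.
  by move=> [n _]; rewrite /F; case: unpickle => // p; case: pselect => // pA; exact: pA.
move=> Av; have /nbhs_ballP[e /= e0 eA] : nbhs v A by exact: open_nbhs_nbhs.
have [k ke] : exists k : nat, k.+1%:R^-1 < e / 2.
  have e2 : 0 < e / 2 by rewrite divr_gt0.
  have [k /= _ Hk] := near_infty_natSinv_lt (PosNum e2).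
  by exists k; exact: (Hk k (leqnn k)).
have H (i : 'I_N) : exists q : rat, `|ratr q - v ord0 i| < k.+1%:R^-1.
  have vv : v ord0 i - k.+1%:R^-1 < v ord0 i + k.+1%:R^-1.
    by rewrite ltrBlDr -addrA ltrDl addr_gt0// invr_gt0.
  have [q] := rat_in_itvoo vv.
  by rewrite in_itv/= => qv; exists q; rewrite ltr_distl.
have [q Hq] := choice H.
pose p : 'rV[rat]_N * nat := (\row_i q i, k).
exists (pickle p) => //; rewrite /F pickleK; case: pselect => [pA|].
  by move=> i; rewrite /p /= mxE; exact: Hq.
case=> w pw; apply: eA; split => // i j; rewrite (ord1 i) -ball_normE /=.
have := pw j; rewrite /= mxE => pj; have := Hq j => vj.
rewrite -(subrKA (ratr (q j))) (le_lt_trans (ler_normD _ _))//.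
rewrite distrC (splitr e) ltrD//; exact: lt_trans ke.
Qed.

Lemma measurable_continuous_rV N (f : 'rV[R]_N -> R) : continuous f ->
  measurable_fun setT f.
Proof.
move=> /continuousP cf; apply: (measurability _ (RGenOpens.measurableE R)).
move=> _ [_ [a [b ->]] <-]; rewrite setTI; apply: measurable_open_rV.
by apply: cf; exact: interval_open.
Qed.

End lebesgue_space.

Lemma eq_indic (R : pzRingType) (T U : Type) (A : set T) (B : set U) x y :
  (A x <-> B y) -> \1_A x = \1_B y :> R.
Proof.
move=> AB; rewrite !indicE (_ : (x \in A) = (y \in B))//.
by apply/idP/idP; rewrite !inE => /AB.
Qed.

(** * Cubes, null sets, dilations and translations *)

Section lebesgue_boxes.
Context {R : realType}.

(** Half-open, so that the integer translates of the unit cube partition the space. *)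
Definition hobox N (a b : R) : set 'rV[R]_N := [set v | forall i, a <= v ord0 i < b].

Lemma measurable_hobox N (a b : R) : measurable (@hobox N a b).
Proof.
rewrite (_ : hobox _ _ = [set v | forall i, [set t | a <= t < b] (v ord0 i)])//.
apply: (@measurable_forall_coord R N (fun=> [set t | a <= t < b])) => _.
by rewrite (_ : [set t | _] = `[a, b[%classic).
Qed.

Lemma leb_hobox N (a b : R) : a <= b -> leb R N (@hobox N a b) = ((b - a) ^+ N)%:E.
Proof.
move=> ab; elim: N => [|N IH].
  rewrite /= diracE expr0 mem_set//=.
  by case.
have -> : leb R N.+1 (@hobox N.+1 a b) =
    (lebesgue_measure \x leb R N)%E (`[a, b[%classic `*` @hobox N a b).
  transitivity ((lebesgue_measure \x leb R N)%E ((@rV_cons R N) @^-1` (@hobox N.+1 a b))) => //.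
  congr ((lebesgue_measure \x leb R N)%E _).
  apply/seteqP; split=> -[x v] /=.
    move=> H; split; first by have := H ord0; rewrite /= mxE unlift_none in_itv.
    by move=> i; have := H (lift ord0 i); rewrite /= mxE liftK.
  move=> [xab vab] i; rewrite mxE; case: unliftP => [j _|_]/=; first exact: vab.
  by move: xab; rewrite in_itv.
rewrite [LHS]product_measure1E//; last exact: measurable_hobox.
have L : @lebesgue_measure R `[a, b[%classic = (b - a)%:E.
  by rewrite lebesgue_measure_itv/= lte_fin; case: ltgtP ab => //= ->; rewrite subrr.
by rewrite IH exprS EFinM; congr (_ * _)%E.
Qed.

Lemma leb_bounded_lty N (A : set 'rV[R]_N) : measurable A -> bounded_set A ->
  (leb R N A < +oo)%E.
Proof.
move=> mA [M0 [_ /(_ (M0 + 1))]]; rewrite ltrDl ltr01 => /(_ isT); set M := M0 + 1 => MA.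
have A_box : A `<=` @hobox N (- (`|M| + 1)) (`|M| + 1).
  move=> v /MA vM i.
  have : `|v ord0 i| <= `|v|.
    rewrite [leRHS]mx_normrE.
    exact: (le_bigmax _ (fun i : 'I_1 * 'I_N => `|v i.1 i.2|) (ord0, i)).
  by have := ler_norm M; rewrite ler_norml; move: vM => /=; lra.
apply: (@le_lt_trans _ _ (leb R N (@hobox N (- (`|M| + 1)) (`|M| + 1)))).
  by apply: le_measure => //; rewrite inE//; exact: measurable_hobox.
rewrite leb_hobox ?ltry//.
by have := normr_ge0 M; lra.
Qed.

Lemma rV_shift_measurable2 N (w : 'rV[R]_N) :
  measurable_fun setT (fun x : R * 'rV[R]_N => x.2 + x.1 *: w).
Proof.
apply/measurable_rVP => i; under eq_fun do rewrite !mxE.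
apply: measurable_funD.
  by apply: (measurableT_comp (measurable_coord i)); exact: measurable_snd.
by apply: measurable_funM => //; exact: measurable_cst.
Qed.

Lemma rV_affine_measurable N (c : R) (h : 'rV[R]_N) :
  measurable_fun setT (fun x : 'rV[R]_N => c *: x + h).
Proof.
apply/measurable_rVP => i; under eq_fun do rewrite !mxE.
apply: measurable_funD; last exact: measurable_cst.
by apply: measurable_funM; [exact: measurable_cst|exact: measurable_coord].
Qed.

Lemma rV_comb_measurable2 N (c d : R) :
  measurable_fun setT (fun x : 'rV[R]_N * 'rV[R]_N => c *: x.1 + d *: x.2).
Proof.
apply/measurable_rVP => i; under eq_fun do rewrite !mxE.
apply: measurable_funD; apply: measurable_funM; try exact: measurable_cst.
  by apply: (measurableT_comp (measurable_coord i)); exact: measurable_fst.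
by apply: (measurableT_comp (measurable_coord i)); exact: measurable_snd.
Qed.

(* Fubini for the indicator of A at x / e + y: for each x it vanishes for a.e. y,
   and its x-sections are translates of each other. *)
Lemma leb_dilate0 N (e : R) (A : set 'rV[R]_N) : e != 0 -> measurable A ->
  leb R N A = 0 -> leb R N ((fun x => e^-1 *: x) @^-1` A) = 0.
Proof.
move=> e0 mA A0.
pose F (x : 'rV[R]_N * 'rV[R]_N) : \bar R :=
  ((\1_A (e^-1 *: x.1 + 1 *: x.2))%:E * (\1_(@hobox N 0 1) x.2)%:E)%E.
have mF : measurable_fun setT F.
  apply: emeasurable_funM.
    apply/measurable_EFinP.
    apply: (@measurableT_comp _ _ _ _ _ _ (\1_A : 'rV[R]_N -> R)).
      exact: measurable_indic.
    exact: rV_comb_measurable2.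
  apply/measurable_EFinP.
  apply: (@measurableT_comp _ _ _ _ _ _ (\1_(@hobox N 0 1) : 'rV[R]_N -> R)).
    by apply: measurable_indic; exact: measurable_hobox.
  exact: measurable_snd.
have F0 x : (0 <= F x)%E by rewrite /F -EFinM lee_fin mulr_ge0.
have := fubini_tonelli (m1 := leb R N) (m2 := leb R N) F mF F0.
have -> : (\int[leb R N]_x \int[leb R N]_y F (x, y) = 0)%E.
  apply: integral0_eq => x _.
  pose S := (fun v : 'rV[R]_N => v + e^-1 *: x) @^-1` A.
  have mS : measurable S by rewrite -[X in measurable X]setTI; exact: measurable_shift_rV.
  have S0 : leb R N S = 0%E by rewrite -[RHS]A0; exact: leb_shift.
  rewrite (eq_integral (fun y => (\1_(S `&` @hobox N 0 1) y)%:E)); last first.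
    by move=> y _; rewrite /F /= indicI -EFinM /= scale1r addrC.
  have mSB : measurable (S `&` @hobox N 0 1) by apply: measurableI => //; exact: measurable_hobox.
  rewrite integral_indic// setIT; apply/eqP; rewrite eq_le measure_ge0 andbT -S0.
  by apply: le_measure; rewrite ?inE.
pose D := (fun x : 'rV[R]_N => e^-1 *: x) @^-1` A.
have mD : measurable D.
  rewrite (_ : D = (fun x : 'rV[R]_N => e^-1 *: x + 0) @^-1` A).
    by rewrite -[X in measurable X]setTI; exact: rV_affine_measurable.
  by apply/seteqP; split => x; rewrite /D /= addr0.
rewrite (eq_integral (fun y => (leb R N D * (\1_(@hobox N 0 1) y)%:E)%E)); last first.
  move=> y _; rewrite /F /=.
  pose S := (fun x : 'rV[R]_N => x + e *: y) @^-1` D.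
  have mS : measurable S by rewrite -[X in measurable X]setTI; exact: measurable_shift_rV.
  have SD : leb R N S = leb R N D by exact: leb_shift.
  rewrite (eq_integral (fun x => ((\1_(@hobox N 0 1) y)%:E * (\1_S x)%:E)%E)); last first.
    move=> x _; rewrite muleC; congr (_ * _%:E)%E.
    by apply: eq_indic; rewrite /S /D /= scalerDr scalerA mulVf// scale1r.
  rewrite ge0_integralZl//; last first.
    by apply/measurable_EFinP; exact: measurable_indic.
  by rewrite integral_indic// setIT muleC; congr (_ * _)%E; exact: SD.
rewrite ge0_integralZl//; last first.
  by apply/measurable_EFinP; apply: measurable_indic; exact: measurable_hobox.
rewrite integral_indic//; last exact: measurable_hobox.
have B1 : leb R N (@hobox N 0 1) = 1%E by rewrite leb_hobox// subr0 expr1n.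
by rewrite setIT [X in (_ * X)%E](_ : _ = 1%E) ?mule1.
Qed.

Lemma ae_dilate N (e : R) (P : set 'rV[R]_N) : e != 0 ->
  (\forall x \ae leb R N, P x) -> \forall x \ae leb R N, P (e^-1 *: x).
Proof.
move=> e0 [A [mA A0 PA]]; exists ((fun x => e^-1 *: x) @^-1` A); split.
- rewrite (_ : _ @^-1` A = (fun x : 'rV[R]_N => e^-1 *: x + 0) @^-1` A).
    by rewrite -[X in measurable X]setTI; exact: rV_affine_measurable.
  by apply/seteqP; split => x /=; rewrite addr0.
- exact: leb_dilate0.
- by move=> x /= nP; apply: PA.
Qed.

Lemma ae_shift N (h : 'rV[R]_N) (P : set 'rV[R]_N) :
  (\forall x \ae leb R N, P x) -> \forall x \ae leb R N, P (x + h).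
Proof.
move=> [A [mA A0 PA]]; exists ((fun x => x + h) @^-1` A); split.
- by rewrite -[X in measurable X]setTI; exact: measurable_shift_rV.
- by rewrite -[RHS]A0; exact: leb_shift.
- by move=> x /= nP; apply: PA.
Qed.

(** Fubini for the indicator of the hyperplane at [v + s e_i], [s] in [0,1]: for fixed [v] at most
    one [s] contributes, while for fixed [s] the integral is the measure of the hyperplane. *)
Lemma leb_slab0 N (i : 'I_N) (c : R) : leb R N [set v : 'rV[R]_N | v ord0 i = c] = 0.
Proof.
set A := [set v | _].
have mA : measurable A.
  rewrite (_ : A = (fun v : 'rV[R]_N => v ord0 i) @^-1` [set c])//.
  by rewrite -[X in measurable X]setTI; exact: measurable_coord.
pose F (x : R * 'rV[R]_N) : \bar R :=
  ((\1_A (x.2 + x.1 *: unit_vec i))%:E * (\1_(`[0%R, 1%R]%classic : set R) x.1)%:E)%E.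
have mF : measurable_fun setT F.
  apply: emeasurable_funM.
    apply/measurable_EFinP.
    apply: (@measurableT_comp _ _ _ _ _ _ (\1_A : 'rV[R]_N -> R)).
      exact: measurable_indic.
    exact: rV_shift_measurable2.
  apply/measurable_EFinP.
  apply: (@measurableT_comp _ _ _ _ _ _ (\1_(`[0%R, 1%R]%classic : set R) : R -> R)).
    exact: measurable_indic.
  exact: measurable_fst.
have F0 x : (0 <= F x)%E by rewrite /F -EFinM lee_fin mulr_ge0.
have /esym := fubini_tonelli (m1 := @lebesgue_measure R) (m2 := leb R N) F mF F0.
have -> : (\int[leb R N]_y \int[@lebesgue_measure R]_x F (x, y) = 0)%E.
  apply: integral0_eq => v _.
  rewrite (eq_integral (fun s : measurableTypeR R => (\1_([set c - v ord0 i] `&` (`[0%R,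
    1%R]%classic : set R)) s)%:E)); last first.
    move=> s _; rewrite /F /= indicI -EFinM /=; congr ((_ * _)%:E).
    apply: eq_indic; rewrite /A /= !mxE !eqxx/= mulr1; split=> [<-|->].
      by rewrite addrAC subrr add0r.
    by rewrite addrCA subrr addr0.
  rewrite integral_indic//; last exact: measurableI.
  rewrite setIT; apply/eqP; rewrite eq_le measure_ge0 andbT.
  rewrite -(@lebesgue_measure_set1 R (c - v ord0 i)).
  by apply: le_measure; rewrite ?inE//; exact: measurableI.
rewrite (eq_integral (fun s : measurableTypeR R => (leb R N A * (\1_(`[0%R, 1%R]%classic : set
  R) s)%:E)%E)); last first.
  move=> s _; rewrite /F /=.
  pose S := (fun v : 'rV[R]_N => v + s *: unit_vec i) @^-1` A.
  have mS : measurable S by rewrite -[X in measurable X]setTI; exact: measurable_shift_rV.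
  have SA : leb R N S = leb R N A by exact: leb_shift.
  rewrite (eq_integral (fun v => ((\1_(`[0%R, 1%R]%classic : set R) s)%:E * (\1_S v)%:E)%E));
    last first.
    by move=> v _; rewrite muleC.
  rewrite ge0_integralZl//; last first.
    by apply/measurable_EFinP; exact: measurable_indic.
  by rewrite integral_indic// setIT muleC; congr (_ * _)%E; exact: SA.
rewrite ge0_integralZl//; last first.
  by apply/measurable_EFinP; apply: measurable_indic.
rewrite integral_indic// setIT [X in (_ * X)%E](_ : _ = 1%E) ?mule1 => [->//|].
have L : @lebesgue_measure R `[0%R, 1%R]%classic = 1%E.
  by rewrite lebesgue_measure_itv/= lte_fin ltr01 -EFinD subr0.
exact: L.
Qed.

End lebesgue_boxes.

(** * Integrals of difference quotients *)

Section powers.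
Context {R : realType}.
Implicit Types (a b p : R).

Lemma powR_norm_add_le a b p : 0 <= p ->
  `|a + b| `^ p <= 2 `^ p * (`|a| `^ p + `|b| `^ p).
Proof.
move=> p0; set m := Num.max `|a| `|b|.
have m0 : 0 <= m by rewrite le_max normr_ge0.
have ab : `|a + b| <= 2 * m.
  rewrite (le_trans (ler_normD _ _))// mulr_natl mulr2n lerD// le_max lexx ?orbT//.
rewrite (le_trans (ge0_ler_powR p0 _ _ ab)) ?nnegrE ?mulr_ge0// powRM//.
rewrite ler_wpM2l ?powR_ge0// /m /Num.max; case: ifP => _.
  by rewrite lerDr powR_ge0.
by rewrite lerDl powR_ge0.
Qed.

Lemma continuous_powR_norm p : 0 < p -> continuous (fun x : R => `|x| `^ p).
Proof.
move=> p0 x; have [->|x0] := eqVneq x 0.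
  rewrite /continuous_at normr0 powR0 ?gt_eqF//.
  apply/cvgrPdist_le => e e0; near=> y.
  rewrite sub0r normrN ger0_norm ?powR_ge0//.
  have -> : e = (e `^ p^-1) `^ p by rewrite -powRrM mulVf ?gt_eqF// powRr1// ltW.
  rewrite ge0_ler_powR ?nnegrE ?powR_ge0//; first exact: ltW.
  near: y; exists (e `^ p^-1); first exact: powR_gt0.
  by move=> y /=; rewrite sub0r normrN => /ltW.
apply: (@continuous_comp R R R (fun y : R => `|y|) (fun y : R => y `^ p)).
  exact: norm_continuous.
have nx : 0 < `|x| by rewrite normr_gt0.
have [d _] := is_derive1_powR p nx.
by move/derivable1_diffP/differentiable_continuous : d.
Unshelve. all: by end_near. Qed.

(* Hoelder's inequality for the pairs (|a| (1-t)^(-1/q), |b| t^(-1/q)) and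
   ((1-t)^(1/q), t^(1/q)), where 1/p + 1/q = 1 *)
Lemma powR_norm_add_weighted a b p (t : R) : 1 < p -> 0 < t < 1 ->
  `|a + b| `^ p <= (1 - t) `^ (1 - p) * `|a| `^ p + t `^ (1 - p) * `|b| `^ p.
Proof.
move=> p1 /andP[t0 t1].
have p0 : 0 < p by lra.
have s0 : 0 < 1 - t by lra.
pose q := p / (p - 1).
have q0 : 0 < q by rewrite divr_gt0//; lra.
have pq : p^-1 + q^-1 = 1 by rewrite /q; field; apply/andP; split; lra.
have key (u x : R) : 0 < u -> 0 <= x -> (x * u `^ (- q^-1)) `^ p = u `^ (1 - p) * x `^ p.
  move=> u0 x0; rewrite powRM ?powR_ge0// -powRrM mulrC; congr (_ `^ _ * _).
  by rewrite /q; field; apply/andP; split; lra.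
have cancel (u x : R) : 0 < u -> x * u `^ (- q^-1) * u `^ (q^-1) = x.
  move=> u0; rewrite -mulrA -powRD; first by rewrite addNr powRr0 mulr1.
  by rewrite (gt_eqF u0) implybT.
have one (u : R) : 0 < u -> (u `^ q^-1) `^ q = u.
  by move=> u0; rewrite -powRrM mulVf ?gt_eqF// powRr1// ltW.
have := @hoelder2 R (`|a| * (1 - t) `^ (- q^-1)) (`|b| * t `^ (- q^-1))
  ((1 - t) `^ q^-1) (t `^ q^-1) p q.
rewrite !mulr_ge0 ?powR_ge0// !cancel// !key// !one// subrK powR1 mulr1.
move=> /(_ isT isT isT isT p0 q0 pq) ab.
set K := (1 - t) `^ (1 - p) * _ + _ in ab *.
have K0 : 0 <= K by rewrite addr_ge0// mulr_ge0// powR_ge0.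
rewrite (@le_trans _ _ ((K `^ p^-1) `^ p))//.
  rewrite ge0_ler_powR ?nnegrE ?powR_ge0//; first exact: ltW.
  by rewrite (le_trans (ler_normD _ _)).
by rewrite -powRrM mulVf ?gt_eqF// powRr1.
Qed.

(** [s^p] lies above its tangent at [m]; this is Young's inequality for [s] and [m^(p - 1)]. *)
Lemma young_tangent (p s m : R) : 1 < p -> 0 <= s -> 0 <= m ->
  p * (m `^ (p - 1) * s) <= s `^ p + (p - 1) * m `^ p.
Proof.
move=> p1 s0 m0; have p0 : 0 < p by lra.
pose q := p / (p - 1).
have q0 : 0 < q by rewrite divr_gt0//; lra.
have pq : p^-1 + q^-1 = 1 by rewrite /q; field; apply/andP; split; lra.
have := conjugate_powR s0 (powR_ge0 m (p - 1)) p0 q0 pq.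
rewrite -powRrM (_ : (p - 1) * q = p); last by rewrite /q; field; lra.
move=> /(ler_wpM2l (ltW p0)); rewrite [s * _]mulrC => /le_trans; apply.
rewrite mulrDr mulrCA mulfV ?gt_eqF// mulr1 lerD2l.
rewrite (_ : p * (m `^ p / q) = (p - 1) * m `^ p)// /q; field.
by apply/andP; split; lra.
Qed.

End powers.

Section jensen.
Context {R : realType}.
Local Notation mu := (@lebesgue_measure R).
Local Notation I01 := (`[0%R, 1%R]%classic : set R).

Lemma integrable_unit_itv (f : R -> R) : continuous f -> mu.-integrable I01 (EFin \o f).
Proof.
move=> cf; apply: continuous_compact_integrable; first exact: segment_compact.
exact: continuous_subspaceT.
Qed.

Lemma integral_unit_itv_indic (g : R -> \bar R) :
  (\int[mu]_s (g s * (\1_I01 s)%:E) = \int[mu]_(s in I01) g s)%E.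
Proof. by rewrite [RHS]integral_mkcond epatch_indic. Qed.

Lemma integral_unit_itv_cst (c : \bar R) : (\int[mu]_(t in I01) c = c)%E.
Proof.
have L : mu I01 = 1%E by rewrite lebesgue_measure_itv/= lte_fin ltr01 -EFinD subr0.
by rewrite integral_cst// [X in (_ * X)%E](_ : _ = 1%E) ?mule1.
Qed.

Lemma EFin_Rintegral_unit_itv (f : R -> R) : continuous f ->
  ((\int[mu]_(t in I01) f t)%:E = \int[mu]_(t in I01) (f t)%:E)%E.
Proof.
move=> cf; rewrite /Rintegral fineK//; apply: integrable_fin_num => //.
exact: integrable_unit_itv.
Qed.

Lemma Rintegral_unit_itv_cst (c : R) : \int[mu]_(t in I01) c = c.
Proof.
rewrite Rintegral_cst//= lebesgue_measure_itv/= lte_fin ltr01 -EFinD subr0.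
by rewrite /= mulr1.
Qed.

(** The tangent inequality at the mean [m] of [f], integrated over the unit interval. *)
Lemma jensen_powR (f : R -> R) (p : R) : 1 < p -> continuous f -> (forall t, 0 <= f t) ->
  (\int[mu]_(t in I01) f t) `^ p <= \int[mu]_(t in I01) (f t `^ p).
Proof.
move=> p1 cf f0; set m := \int[mu]_(t in I01) f t.
have m0 : 0 <= m by exact: Rintegral_ge0.
have p0 : 0 < p by lra.
have cfp : continuous (fun t => f t `^ p).
  rewrite (_ : (fun t => _) = (fun t => `|f t| `^ p)); last first.
    by apply/funext => t; rewrite ger0_norm.
  move=> t; apply: (@continuous_comp _ _ _ f (fun x => `|x| `^ p)); first exact: cf.
  exact: continuous_powR_norm.
have int1 := integrable_unit_itv cf.
have int2 := integrable_unit_itv cfp.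
have : \int[mu]_(t in I01) (p * m `^ (p - 1) * f t) <=
       \int[mu]_(t in I01) (f t `^ p + (p - 1) * m `^ p).
  apply: le_Rintegral => //.
  - apply: integrable_unit_itv => t; apply: cvgM; [exact: cvg_cst|exact: cf].
  - apply: integrable_unit_itv => t; apply: cvgD; [exact: cfp|exact: cvg_cst].
  - by move=> t _; rewrite -mulrA young_tangent.
rewrite RintegralZl// RintegralD//; last first.
  by apply: integrable_unit_itv => t; exact: cvg_cst.
rewrite Rintegral_unit_itv_cst -/m -mulrA.
have -> : m `^ (p - 1) * m = m `^ p.
  have [->|mn0] := eqVneq m 0; first by rewrite mulr0 powR0// gt_eqF.
  by rewrite -{2}(powRr1 m0) -powRD ?subrK// mn0 implybT.
by rewrite mulrBl mul1r; lra.
Qed.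

End jensen.

Section directional_FTC.
Context {R : realType} {N : nat}.
Local Notation mu := (@lebesgue_measure R).
Local Notation I01 := (`[0%R, 1%R]%classic : set R).
Implicit Types (f : 'rV[R]_N -> R) (x w : 'rV[R]_N).

Lemma continuous_line f x w (s : R) : continuous f ->
  continuous (fun t : R => f (x + (t * s) *: w)).
Proof.
move=> cf t; apply: (@continuous_comp _ _ _ (fun t : R => x + (t * s) *: w) f).
  apply: (@continuousD R 'rV[R]_N _ (cst x) (fun t : R => (t * s) *: w)).
    exact: cst_continuous.
  apply: (@continuous_comp _ _ _ (fun t : R => t * s) (fun u : R => u *: w)).
    by apply: cvgM; [exact: cvg_id|exact: cvg_cst].
  exact: scalel_continuous.
exact: cf.
Qed.

Lemma smooth_line f x i (s t : R) : smooth f ->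
  is_derive t 1 (fun t : R => f (x + (t * s) *: unit_vec i))
    (s * partial i f (x + (t * s) *: unit_vec i)).
Proof.
move=> sf; set y := x + _.
have d1 := iffLR (is_derive_line _ _ _ _) (smooth_is_derive i y sf).
pose g (u : R) := f (u *: unit_vec i + y).
have d2 : is_derive t 1 (fun u : R => (u - t) * s) s.
  apply: (is_derive_eq (is_deriveM (is_deriveB (is_derive_id t 1) (is_derive_cst t t 1))
    (is_derive_cst s t 1))).
  by rewrite scaler0 add0r subr0 [_ *: _]mulr1.
have d1' : is_derive ((t - t) * s) 1 g (partial i f y) by rewrite subrr mul0r.
have := @is_derive1_comp R g (fun u => (u - t) * s) t _ _ d1' d2; rewrite mulrC.
rewrite (_ : g \o _ = (fun t : R => f (x + (t * s) *: unit_vec i)))//.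
apply/funext => u; rewrite /g /y /=; congr f.
by rewrite addrCA -scalerDl mulrBl subrK.
Qed.

Lemma smooth_FTC f x i (s : R) : smooth f ->
  f (x + s *: unit_vec i) - f x =
  \int[mu]_(t in I01) (s * partial i f (x + (t * s) *: unit_vec i)).
Proof.
move=> sf.
pose G (t : R) := f (x + (t * s) *: unit_vec i).
have cG : continuous G by apply: continuous_line; exact: smooth_continuous.
have cg : continuous (fun t : R => s * partial i f (x + (t * s) *: unit_vec i)).
  move=> t; apply: cvgM; first exact: cvg_cst.
  by apply: continuous_line; apply: smooth_continuous; exact: smooth_partial.
rewrite /Rintegral (@continuous_FTC2 _ _ G)//=.
- by rewrite /G mul1r mul0r scale0r addr0.
- exact: continuous_subspaceT.
- split.
  + by move=> t _; have [] := smooth_line x i s t sf.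
  + by apply: cvg_at_right_filter; exact: cG.
  + by apply: cvg_at_left_filter; exact: cG.
- by move=> t _; rewrite derive1E; have [_] := smooth_line x i s t sf.
Qed.

Lemma smooth_diff_powR f x i (s p : R) : 1 < p -> smooth f ->
  `|f (x + s *: unit_vec i) - f x| `^ p <=
  `|s| `^ p * \int[mu]_(t in I01) (`|partial i f (x + (t * s) *: unit_vec i)| `^ p).
Proof.
move=> p1 sf; rewrite smooth_FTC//.
have p0 : 0 < p by lra.
have cp : continuous (fun t : R => partial i f (x + (t * s) *: unit_vec i)).
  by apply: continuous_line; apply: smooth_continuous; exact: smooth_partial.
have cn : continuous (fun t : R => `|partial i f (x + (t * s) *: unit_vec i)|).
  by move=> t; apply: cvg_norm; exact: cp.
rewrite RintegralZl//; last exact: integrable_unit_itv.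
rewrite normrM powRM// ler_wpM2l ?powR_ge0//.
apply: le_trans (jensen_powR p1 cn _) => //.
rewrite ge0_ler_powR ?nnegrE//; first exact: ltW.
  exact: Rintegral_ge0.
by apply: le_normr_Rintegral => //; exact: integrable_unit_itv.
Qed.

End directional_FTC.

Section compact_support.
Context {R : realType} {N : nat}.
Local Notation mu := (leb R N).
Implicit Types (f g phi : 'rV[R]_N -> R).

Definition vanishes_off (L : R) f := forall x : 'rV[R]_N, L < `|x| -> f x = 0.

Definition cball (L : R) : set 'rV[R]_N := [set x | `|x| <= L].

Lemma compact_cball L : compact (cball L).
Proof.
apply: bounded_closed_compact; first by exists L; split; [exact: num_real|move=> M LM x /=
  /le_lt_trans/(_ LM)/ltW].
apply: (@preimage_closed _ _ (fun x : 'rV[R]_N => `|x|) [set t | t <= L]).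
  by move=> x _; exact: norm_continuous.
exact: closed_le.
Qed.

Lemma measurable_cball L : measurable (cball L).
Proof.
rewrite -[cball L]setCK; apply: measurableC; apply: measurable_open_rV.
rewrite openC; apply: compact_closed; first exact: norm_hausdorff.
exact: compact_cball.
Qed.

Lemma leb_cball_lty L : (mu (cball L) < +oo)%E.
Proof.
apply: leb_bounded_lty; first exact: measurable_cball.
by apply: compact_bounded; exact: compact_cball.
Qed.

Lemma vanishes_off_bounded L f : continuous f -> vanishes_off L f ->
  exists M : R, 0 <= M /\ forall x, `|f x| <= M.
Proof.
move=> cf f0; have [L0|L0] := ltP L 0.
  exists 0; split => // x; rewrite f0 ?normr0//; exact: lt_le_trans L0 _.
have [||c _ Hc] := @EVT_max_rV R N (fun x => `|f x|) (cball L) _ (@compact_cball L).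
- by exists 0; rewrite /cball/= normr0.
- apply: continuous_subspaceT => x; apply: (@continuous_comp _ _ _ f Num.norm); first exact: cf.
  exact: norm_continuous.
exists `|f c|; split => // x; have [xL|Lx] := leP `|x| L; last by rewrite f0// normr0.
by apply: Hc; rewrite inE.
Qed.

Lemma integrable_vanishes_off L f M : measurable_fun [set: 'rV[R]_N] f ->
  vanishes_off L f -> (forall x, `|f x| <= M) -> mu.-integrable setT (EFin \o f).
Proof.
move=> mf f0 fM; apply/integrableP; split; first exact/measurable_EFinP.
apply: (@le_lt_trans _ _ (\int[mu]_x (M%:E * (\1_(cball L) x)%:E))%E).
  apply: ge0_le_integral => //.
  - by apply: measurableT_comp => //; exact/measurable_EFinP.
  - apply: emeasurable_funM; first exact: measurable_cst.
    apply/measurable_EFinP; apply: measurable_indic; exact: measurable_cball.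
  move=> x _ /=; rewrite -EFinM lee_fin indicE.
  have [xL|Lx] := leP `|x| L; first by rewrite mem_set ?mulr1.
  by rewrite f0// normr0 mulr_ge0// (le_trans _ (fM x)).
have M0 : 0 <= M by exact: le_trans (fM 0).
rewrite ge0_integralZl//; last first.
  by apply/measurable_EFinP; apply: measurable_indic; exact: measurable_cball.
rewrite integral_indic ?setIT//; last exact: measurable_cball.
by rewrite lte_mul_pinfty//; exact: leb_cball_lty.
Qed.

Lemma integrable_cvanishes_off L f : continuous f -> vanishes_off L f ->
  mu.-integrable setT (EFin \o f).
Proof.
move=> cf f0; have [M [_ fM]] := vanishes_off_bounded cf f0.
exact: (integrable_vanishes_off (measurable_continuous_rV cf) f0 fM).
Qed.

Lemma vanishes_off_partial L f i : vanishes_off L f -> vanishes_off L (partial i f).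
Proof.
move=> f0 x Lx; rewrite /partial.
rewrite -(@near_eq_derive _ _ _ (cst 0) f x (unit_vec i)); first exact: derive_cst.
near=> y; rewrite /cst f0//.
near: y; have := @norm_continuous R 'rV[R]_N x.
by move=> /(_ _ (lt_nbhsr Lx)).
Unshelve. all: by end_near. Qed.

Lemma vanishes_off_powR_norm L f p : p != 0 -> vanishes_off L f ->
  vanishes_off L (fun x => `|f x| `^ p).
Proof. by move=> p0 f0 x Lx; rewrite f0// normr0 powR0. Qed.

Lemma continuous_powR_norm_fun f p : 0 < p -> continuous f ->
  continuous (fun x => `|f x| `^ p).
Proof.
move=> p0 cf x; apply: (@continuous_comp _ _ _ f (fun x => `|x| `^ p)); first exact: cf.
exact: continuous_powR_norm.
Qed.

Lemma measurable_powR_norm_fun d (T : measurableType d) (f : T -> R) p :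
  measurable_fun setT f -> measurable_fun setT (fun x => `|f x| `^ p).
Proof.
move=> mf; apply: (@measurableT_comp _ _ _ _ _ _ (@powR R ^~ p)).
  exact: measurable_powR.
exact: measurableT_comp.
Qed.

Lemma test_function_vanishes_off O phi : test_function O phi ->
  exists L, vanishes_off L phi.
Proof.
move=> [_ /compact_bounded[M [_ HM]] _]; exists (M + 1) => x Mx.
apply/eqP; apply: contraPT Mx => px; apply/negP; rewrite -leNgt.
by apply: HM; [rewrite ltrDl|exact: subset_closure].
Qed.

Definition segment_integrand (g : 'rV[R]_N -> \bar R) (w : 'rV[R]_N) (z : R * 'rV[R]_N) : \bar R
  :=
  (g (z.2 + z.1 *: w)%R * (\1_(`[0%R, 1%R]%classic : set R) z.1)%:E)%E.

Lemma measurable_segment_integrand (g : 'rV[R]_N -> \bar R) w : measurable_fun [set: 'rV[R]_N] g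
  -> measurable_fun setT (segment_integrand g w).
Proof.
move=> mg; apply: emeasurable_funM.
  by apply: (measurableT_comp mg); exact: rV_shift_measurable2.
apply/measurable_EFinP.
apply: (@measurableT_comp _ _ _ _ _ _ (\1_(`[0%R, 1%R]%classic : set R) : R -> R)).
  exact: measurable_indic.
exact: measurable_fst.
Qed.

(** After exchanging the integrals, every [s] contributes the integral of a translate of [g], and
    [s] runs over an interval of length 1. *)
Lemma tonelli_segment (g : 'rV[R]_N -> \bar R) (w : 'rV[R]_N) :
  measurable_fun [set: 'rV[R]_N] g -> (forall x, 0 <= g x)%E ->
  (\int[mu]_x \int[@lebesgue_measure R]_(s in `[0%R, 1%R]%classic)
     g ((x : 'rV[R]_N) + s *: w)%R = \int[mu]_x g x)%E.
Proof.
move=> mg g0.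
have F0 z : (0 <= segment_integrand g w z)%E by rewrite /segment_integrand mule_ge0.
rewrite (eq_integral (fun x => \int[@lebesgue_measure R]_s segment_integrand g w (s, x))%E);
  last first.
  by move=> x _; rewrite -(integral_unit_itv_indic (fun s => g (x + s *: w))).
rewrite -(fubini_tonelli (m1 := @lebesgue_measure R) (m2 := mu) (segment_integrand g w)
  (measurable_segment_integrand w mg) F0).
rewrite (eq_integral (fun s : measurableTypeR R => (\int[mu]_x g x) *
    (\1_(`[0%R, 1%R]%classic : set R) s)%:E)%E).
  by rewrite (integral_unit_itv_indic (fun=> _)) integral_unit_itv_cst.
move=> s _; rewrite -(ge0_integral_shift (s *: w) mg g0) -ge0_integralZr//.
by apply: (measurableT_comp mg); exact: measurable_shift_rV.
Qed.

Lemma fubini_segment (g : 'rV[R]_N -> \bar R) (w : 'rV[R]_N) :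
  mu.-integrable setT g ->
  (\int[mu]_x \int[@lebesgue_measure R]_(s in `[0%R, 1%R]%classic)
     g ((x : 'rV[R]_N) + s *: w)%R = \int[mu]_x g x)%E.
Proof.
move=> ig; have mg := measurable_int _ ig.
rewrite (eq_integral (fun x => \int[@lebesgue_measure R]_s segment_integrand g w (s, x))%E);
  last first.
  by move=> x _; rewrite -(integral_unit_itv_indic (fun s => g (x + s *: w))).
have intF : (@lebesgue_measure R \x mu)%E.-integrable setT (segment_integrand g w).
  apply/integrable12ltyP; first exact: measurable_segment_integrand.
  rewrite (eq_integral (fun s : measurableTypeR R => (\int[mu]_x `|g x|) *
    (\1_(`[0%R, 1%R]%classic : set R) s)%:E)%E); last first.
    move=> s _; have ia := integrable_abse ig.
    rewrite -(integral_shift (s *: w) ia) -ge0_integralZr//; last 2 first.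
    - by apply: (measurableT_comp (measurable_int _ ia)); exact: measurable_shift_rV.
    - by move=> x _; exact: abse_ge0.
    apply: eq_integral => x _; rewrite /segment_integrand abseM; congr (_ * _)%E.
    by rewrite abse_EFin ger0_norm.
  rewrite (integral_unit_itv_indic (fun=> _)) integral_unit_itv_cst.
  by have /integrableP[] := ig.
rewrite -(@Fubini _ _ _ _ _ (@lebesgue_measure R) mu (segment_integrand g w) intF).
rewrite (eq_integral (fun s : measurableTypeR R => (\int[mu]_x g x) *
    (\1_(`[0%R, 1%R]%classic : set R) s)%:E)%E).
  by rewrite (integral_unit_itv_indic (fun=> _)) integral_unit_itv_cst.
move=> s _; rewrite -(integral_shift (s *: w) ig) -integralZr//.
exact: (integrable_shift (s *: w) ig).
Qed.

(* The integral of f (x + e_i) - f x vanishes by translation invariance; by the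
   fundamental theorem of calculus and Fubini it is that of the partial
   derivative. *)
Lemma integral_partial0 L f i : smooth f -> vanishes_off L f ->
  (\int[mu]_x (partial i f x)%:E = 0)%E.
Proof.
move=> sf f0.
have sp := smooth_partial i sf.
have ip := integrable_cvanishes_off (smooth_continuous sp) (vanishes_off_partial i f0).
rewrite -(fubini_segment (unit_vec i) ip).
rewrite (eq_integral (fun x : 'rV[R]_N => (f (x + unit_vec i))%:E - (f x)%:E)%E); last first.
  move=> x _; rewrite -EFinB -[unit_vec i in RHS]scale1r smooth_FTC// EFin_Rintegral_unit_itv//.
    by apply: eq_integral => s _; rewrite mul1r mulr1.
  move=> t; apply: cvgM; first exact: cvg_cst.
  exact: (continuous_line (smooth_continuous sp)).
have fi := integrable_cvanishes_off (smooth_continuous sf) f0.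
rewrite integralB//; last exact: (integrable_shift (unit_vec i) fi).
rewrite (integral_shift (unit_vec i) fi) subee//.
exact: integrable_fin_num.
Qed.

Lemma integration_by_parts_rV L f g i : smooth f -> smooth g -> vanishes_off L f ->
  (\int[mu]_x (f x * partial i g x) = - \int[mu]_x (partial i f x * g x))%R.
Proof.
move=> sf sg f0.
have sfg := smoothM sf sg.
have fg0 : vanishes_off L (fun x => f x * g x) by move=> x Lx; rewrite f0// mul0r.
have := integral_partial0 i sfg fg0; rewrite partialM//.
have c1 : continuous (fun x => f x * partial i g x).
  exact: smooth_continuous (smoothM sf (smooth_partial i sg)).
have c2 : continuous (fun x => partial i f x * g x).
  exact: smooth_continuous (smoothM (smooth_partial i sf) sg).
have i1 : mu.-integrable setT (EFin \o (fun x => f x * partial i g x)).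
  by apply: (@integrable_cvanishes_off L _ c1) => x Lx; rewrite f0// mul0r.
have i2 : mu.-integrable setT (EFin \o (fun x => partial i f x * g x)).
  by apply: (@integrable_cvanishes_off L _ c2) => x Lx; rewrite (vanishes_off_partial i f0)//
    mul0r.
move=> H; apply/eqP; rewrite -subr_eq0 opprK -RintegralD//.
by rewrite /Rintegral H.
Qed.

Lemma ge0_integral_diff_coord_powR f i (s p : R) : 1 < p -> smooth f ->
  (\int[mu]_x (`|f ((x : 'rV[R]_N) + s *: unit_vec i) - f x| `^ p)%:E <=
   (`|s| `^ p)%:E * \int[mu]_x (`|partial i f x| `^ p)%:E)%E.
Proof.
move=> p1 sf; have p0 : 0 < p by lra.
have sp := smooth_partial i sf.
have cp := continuous_powR_norm_fun p0 (smooth_continuous sp).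
have mf := measurable_continuous_rV (smooth_continuous sf).
have mp : measurable_fun [set: 'rV[R]_N] (fun x => (`|partial i f x| `^ p)%:E).
  by apply/measurable_EFinP; exact: measurable_continuous_rV.
rewrite -(tonelli_segment (s *: unit_vec i) mp); last first.
  by move=> x; rewrite lee_fin powR_ge0.
have E (x : 'rV[R]_N) : (\int[@lebesgue_measure R]_(t in `[0%R, 1%R]%classic)
    (`|partial i f (x + t *: (s *: unit_vec i))| `^ p)%:E =
    (\int[@lebesgue_measure R]_(t in `[0%R, 1%R]%classic)
      (`|partial i f (x + (t * s) *: unit_vec i)| `^ p))%R%:E)%E.
  rewrite EFin_Rintegral_unit_itv; first by apply: eq_integral => t _; rewrite scalerA.
  exact: (@continuous_line _ _ (fun x => `|partial i f x| `^ p)).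
have mE : measurable_fun [set: 'rV[R]_N] (fun x => \int[@lebesgue_measure R]_(t in `[0%R,
  1%R]%classic)
    (`|partial i f (x + t *: (s *: unit_vec i))| `^ p)%:E)%E.
  rewrite (_ : (fun x => _) = (fun x => \int[@lebesgue_measure R]_t
      segment_integrand (fun x => (`|partial i f x| `^ p)%:E) (s *: unit_vec i) (t, x))%E); last
        first.
    by apply/funext => x; rewrite -integral_unit_itv_indic.
  apply: (@measurable_fun_fubini_tonelli_G _ _ _ _ _ (@lebesgue_measure R)
    (segment_integrand _ _)); first exact: measurable_segment_integrand.
  by move=> z; rewrite /segment_integrand mule_ge0// lee_fin powR_ge0.
rewrite -ge0_integralZl//; last first.
  by move=> x _; apply: integral_ge0 => t _; rewrite lee_fin powR_ge0.
apply: ge0_le_integral => //.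
- apply/measurable_EFinP; apply: measurable_powR_norm_fun; apply: measurable_funB => //.
  by apply: (measurableT_comp mf); exact: measurable_shift_rV.
- by apply: emeasurable_funM => //; exact: measurable_cst.
by move=> x _; rewrite E -EFinM lee_fin; exact: smooth_diff_powR.
Qed.

(** The translation is made one coordinate at a time. Each of the [N] steps costs a factor [2^p],
    from [powR_norm_add_le]. *)
Lemma ge0_integral_diff_powR f (h : 'rV[R]_N) (r p : R) : 1 < p -> smooth f ->
  (forall i, `|h ord0 i| <= r) ->
  (\int[mu]_x (`|f ((x : 'rV[R]_N) + h) - f x| `^ p)%:E <=
   (((2 `^ p) ^+ N) * r `^ p)%:E *
     \sum_(i < N) \int[mu]_x (`|partial i f x| `^ p)%:E)%E.
Proof.
move=> p1 sf hr; have p0 : 0 < p by lra.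
have mf := measurable_continuous_rV (smooth_continuous sf).
pose A i := (\int[mu]_x (`|partial i f x| `^ p)%:E)%E.
have A0 i : (0 <= A i)%E by apply: integral_ge0 => x _; rewrite lee_fin powR_ge0.
have mshift (g : 'rV[R]_N) : measurable_fun [set: 'rV[R]_N] (fun x : 'rV[R]_N => f (x + g)).
  by apply: (measurableT_comp mf); exact: measurable_shift_rV.
have mdiff (g g' : 'rV[R]_N) : measurable_fun [set: 'rV[R]_N]
    (fun x : 'rV[R]_N => (`|f (x + g) - f (x + g')| `^ p)%:E).
  by apply/measurable_EFinP; apply: measurable_powR_norm_fun; exact: measurable_funB.
have c1 : 1 <= 2 `^ p :> R by rewrite -[leLHS](powRr0 (2 : R)) ler_powR ?ler1n// ltW.
have H (s : seq 'I_N) : (\int[mu]_x (`|f ((x : 'rV[R]_N) + \sum_(i <- s) h ord0 i *: unit_vec i)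
  - f x| `^ p)%:E <=
    ((2 `^ p) ^+ size s * r `^ p)%:E * \sum_(i <- s) A i)%E.
  elim: s => [|i s IH].
    rewrite !big_nil mule0 integral0_eq// => x _.
    by rewrite addr0 subrr normr0 powR0// gt_eqF.
  set hs := \sum_(j <- s) h ord0 j *: unit_vec j.
  rewrite big_cons -/hs.
  apply: (@le_trans _ _ (\int[mu]_x ((2 `^ p)%:E *
     ((`|f (((x : 'rV[R]_N) + hs) + h ord0 i *: unit_vec i) - f (x + hs)| `^ p)%:E +
      (`|f (x + hs) - f x| `^ p)%:E)))%E).
    apply: ge0_le_integral => //.
    - have := mdiff (h ord0 i *: unit_vec i + hs) 0.
      by under eq_fun do rewrite addr0.
    - apply: emeasurable_funM; first exact: measurable_cst.
      apply: emeasurable_funD.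
        have := mdiff (hs + h ord0 i *: unit_vec i) hs.
        by under eq_fun do rewrite addrA.
      by have := mdiff hs 0; under eq_fun do rewrite addr0.
    move=> x _; rewrite -EFinD -EFinM lee_fin.
    rewrite -[f _ - f x](subrKA (f (x + hs))).
    rewrite (_ : x + (h ord0 i *: unit_vec i + hs) = x + hs + h ord0 i *: unit_vec i); last by
      rewrite addrA addrAC.
    by apply: powR_norm_add_le; exact: ltW.
  rewrite ge0_integralZl//; last 2 first.
  - apply: emeasurable_funD.
      have := mdiff (hs + h ord0 i *: unit_vec i) hs.
      by under eq_fun do rewrite addrA.
    by have := mdiff hs 0; under eq_fun do rewrite addr0.
  - by move=> x _; rewrite -EFinD lee_fin addr_ge0 ?powR_ge0.
  rewrite ge0_integralD//; last 2 first.
  - have := mdiff (hs + h ord0 i *: unit_vec i) hs.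
    by under eq_fun do rewrite addrA.
  - by have := mdiff hs 0; under eq_fun do rewrite addr0.
  rewrite (ge0_integral_shift hs (f := fun x => (`|f (x + h ord0 i *: unit_vec i) - f x| `^
    p)%:E)); last 2 first.
  - by have := mdiff (h ord0 i *: unit_vec i) 0; under eq_fun do rewrite addr0.
  - by move=> x; rewrite lee_fin powR_ge0.
  have Hi : (\int[mu]_x (`|f ((x : 'rV[R]_N) + h ord0 i *: unit_vec i) - f x| `^ p)%:E <=
      ((2 `^ p) ^+ size s * r `^ p)%:E * A i)%E.
    apply: le_trans (ge0_integral_diff_coord_powR i (h ord0 i) p1 sf) _.
    apply: lee_wpmul2r; first exact: A0.
    rewrite lee_fin.
    have hp : `|h ord0 i| `^ p <= r `^ p.
      by rewrite ge0_ler_powR ?nnegrE ?(ltW p0)// (le_trans _ (hr i)).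
    by rewrite (le_trans hp)// ler_peMl ?powR_ge0// exprn_ege1.
  apply: (@le_trans _ _ ((2 `^ p)%:E * (((2 `^ p) ^+ size s * r `^ p)%:E * A i +
      ((2 `^ p) ^+ size s * r `^ p)%:E * \sum_(i <- s) A i))%E).
    by apply: lee_wpmul2l; [rewrite lee_fin powR_ge0|exact: leeD].
  rewrite -ge0_muleDr//; last exact: sume_ge0.
  by rewrite muleA -EFinM mulrA -exprS big_cons.
have := H (index_enum 'I_N).
rewrite (_ : \sum_(i <- index_enum 'I_N) h ord0 i *: unit_vec i = h); last first.
  by rewrite [RHS]row_sum_delta.
by have -> : size (index_enum 'I_N) = N by rewrite /index_enum unlock -enumT size_enum_ord.
Qed.

(** A shift by [2 L + 1] along one axis moves the ball of radius [L] off itself, so the difference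
    of [f] and its translate is [f] up to sign on that ball. *)
Lemma poincare_rV L f (i : 'I_N) (p : R) : 0 <= L -> 1 < p -> smooth f -> vanishes_off L f ->
  (\int[mu]_x (`|f x| `^ p)%:E <=
   ((2 * L + 1) `^ p)%:E * \int[mu]_x (`|partial i f x| `^ p)%:E)%E.
Proof.
move=> L0 p1 sf f0; have p0 : 0 < p by lra.
have mf := measurable_continuous_rV (smooth_continuous sf).
have s0 : 0 <= 2 * L + 1 by lra.
have := ge0_integral_diff_coord_powR i (2 * L + 1) p1 sf.
rewrite (ger0_norm s0); apply: le_trans; apply: ge0_le_integral => //.
- by apply/measurable_EFinP; exact: measurable_powR_norm_fun.
- apply/measurable_EFinP; apply: measurable_powR_norm_fun; apply: measurable_funB => //.
  by apply: (measurableT_comp mf); exact: measurable_shift_rV.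
move=> x _; rewrite lee_fin.
have [xL|Lx] := leP `|x| L; last by rewrite [f x]f0// normr0 powR0 ?powR_ge0// gt_eqF.
rewrite [X in X - _]f0 ?sub0r ?normrN//.
have nx : `|(x : 'rV[R]_N) ord0 i| <= L.
  rewrite (le_trans _ xL)// [leRHS]mx_normrE.
  exact: (le_bigmax _ (fun k : 'I_1 * 'I_N => `|(x : 'rV[R]_N) k.1 k.2|) (ord0, i)).
set y := (x : 'rV[R]_N) + _.
have : `|y ord0 i| <= `|y|.
  rewrite [leRHS]mx_normrE.
  exact: (le_bigmax _ (fun k : 'I_1 * 'I_N => `|y k.1 k.2|) (ord0, i)).
apply: lt_le_trans; rewrite /y !mxE !eqxx mulr1.
by move: nx; rewrite ler_norml => /andP[nx _]; rewrite (lt_le_trans _ (ler_norm _))//; lra.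
Qed.

End compact_support.

(** * Averages of periodic functions *)

Section periodic_mean.
Context {R : realType} {N : nat}.
Local Notation mu := (leb R N).
Local Notation Q := (@hobox R N 0 1).
Implicit Types (f g : 'rV[R]_N -> R) (M : R).

(** The bound holds everywhere but periodicity only almost everywhere, as for a truncated
    representative of an essentially bounded periodic function. *)
Definition bounded_periodic (M : R) g :=
  [/\ measurable_fun [set: 'rV[R]_N] g, forall x, `|g x| <= M & cube_periodic g].

Lemma bounded_periodic_shift M g (v : 'rV[R]_N) :
  bounded_periodic M g -> bounded_periodic M (fun x => g (x + v)).
Proof.
move=> [mg gM pg]; split => //.
- by apply: (measurableT_comp mg); exact: measurable_shift_rV.
- have := ae_shift v pg; apply: filterS => y H i.
  by rewrite -[RHS](H i) addrAC.
Qed.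

Lemma leb_unit_hobox : mu Q = 1%E.
Proof. by rewrite leb_hobox// subr0 expr1n. Qed.

Lemma integrable_bounded_hobox M g : measurable_fun [set: 'rV[R]_N] g ->
  (forall x, `|g x| <= M) -> mu.-integrable Q (EFin \o g).
Proof.
move=> mg gM; apply: measurable_bounded_integrable.
- exact: measurable_hobox.
- by rewrite [X in (X < _)%E]leb_unit_hobox ltry.
- exact: measurable_funTS.
- by exists M; split => // [|K MK x _ /=]; [exact: num_real|rewrite (le_trans (gM x))// ltW].
Qed.

Lemma integrable_mul_indic M g (A : set 'rV[R]_N) : measurable_fun [set: 'rV[R]_N] g ->
  (forall x, `|g x| <= M) -> measurable A -> (mu A < +oo)%E ->
  mu.-integrable setT (fun x => (g x * \1_A x)%:E).
Proof.
move=> mg gM mA Afin.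
have M0 : 0 <= M by rewrite (le_trans _ (gM 0)).
have m1 : measurable_fun [set: 'rV[R]_N] (fun x => (\1_A x : R)%:E).
  by apply/measurable_EFinP; exact: measurable_indic.
apply: (@le_integrable _ _ _ mu setT measurableT _ (fun x => (M * \1_A x)%:E)).
- by apply/measurable_EFinP; apply: measurable_funM => //; exact: measurable_indic.
- move=> x _ /=; rewrite lee_fin !normrM (ger0_norm M0).
  by rewrite ler_wpM2r.
- apply/integrableP; split.
    apply/measurable_EFinP; apply: measurable_funM; first exact: measurable_cst.
    exact: measurable_indic.
  rewrite (eq_integral (fun x => M%:E * (\1_A x)%:E)%E); last first.
    by move=> x _; rewrite -EFinM abse_EFin ger0_norm ?mulr_ge0.
  rewrite ge0_integralZl// integral_indic// setIT.
  by rewrite lte_mul_pinfty.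
Qed.

Lemma integral_hobox_indic (F : 'rV[R]_N -> R) :
  (\int[mu]_(y in Q) (F y)%:E = \int[mu]_y (F y * \1_Q y)%:E)%E.
Proof. by rewrite integral_mkcond epatch_indic. Qed.

(** The shifted cube is cut at the face it crosses: the part still in [Q] is [A], and the part
    beyond it returns to [B] by one period, whence the shift [s - 1]. *)
Lemma periodic_mean_shift_coord_frac M g i (s : R) : bounded_periodic M g -> 0 <= s < 1 ->
  (\int[mu]_(y in Q) (g ((y : 'rV[R]_N) + s *: unit_vec i))%:E = \int[mu]_(y in Q) (g y)%:E)%E.
Proof.
move=> [mg gM pg] /andP[s0 s1].
pose P (x : 'rV[R]_N) := forall j, j != i -> 0 <= x ord0 j < 1.
have QP (x : 'rV[R]_N) : Q x <-> P x /\ 0 <= x ord0 i < 1.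
  split=> [Qx|[Px xi] j]; first by split=> [j _|]; exact: Qx.
  by have [->|ji] := eqVneq j i; [exact: xi|exact: Px].
have Pshift x t : P (x + t *: unit_vec i) <-> P x.
  by split=> H j ji; have := H j ji; rewrite !mxE eqxx (negPf ji) /= mulr0 addr0.
have coordi (x : 'rV[R]_N) t : (x + t *: unit_vec i) ord0 i = x ord0 i + t.
  by rewrite !mxE !eqxx mulr1.
pose A : set 'rV[R]_N := Q `&` [set x | s <= x ord0 i].
pose B : set 'rV[R]_N := Q `&` [set x | x ord0 i < s].
have mA : measurable A.
  apply: measurableI; first exact: measurable_hobox.
  rewrite [X in measurable X](_ : _ = (fun x : 'rV[R]_N => x ord0 i) @^-1` `[s, +oo[%classic).
    by rewrite -[X in measurable X]setTI; apply: measurable_coord.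
  by apply/seteqP; split=> x /=; rewrite in_itv/= andbT.
have mB : measurable B.
  apply: measurableI; first exact: measurable_hobox.
  rewrite [X in measurable X](_ : _ = (fun x : 'rV[R]_N => x ord0 i) @^-1` `]-oo, s[%classic).
    by rewrite -[X in measurable X]setTI; apply: measurable_coord.
  by apply/seteqP; split=> x /=; rewrite in_itv/=.
have fin (C : set 'rV[R]_N) : measurable C -> C `<=` Q -> (mu C < +oo)%E.
  move=> mC CQ; apply: (@le_lt_trans _ _ (mu Q)).
    by apply: le_measure; rewrite ?inE//; exact: measurable_hobox.
  by rewrite leb_unit_hobox ltry.
have iA := integrable_mul_indic mg gM mA (fin _ mA (@subIsetl _ _ _)).
have iB := integrable_mul_indic mg gM mB (fin _ mB (@subIsetl _ _ _)).
have iA' := integrable_shift (s *: unit_vec i) iA.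
have iB' := integrable_shift ((s - 1) *: unit_vec i) iB.
rewrite !integral_hobox_indic.
transitivity (\int[mu]_x ((g (x + s *: unit_vec i) * \1_A ((x : 'rV[R]_N) + s *: unit_vec i))%:E +
   (g (x + (s - 1) *: unit_vec i) * \1_B ((x : 'rV[R]_N) + (s - 1) *: unit_vec i))%:E))%E.
  apply: ae_eq_integral => //.
  - apply/measurable_EFinP; apply: measurable_funM.
      by apply: (measurableT_comp mg); exact: measurable_shift_rV.
    by apply: measurable_indic; exact: measurable_hobox.
  - apply: emeasurable_funD; [exact: measurable_int iA'|exact: measurable_int iB'].
  have := ae_shift ((s - 1) *: unit_vec i) pg; apply: filterS => x /(_ i) gx _.
  rewrite -EFinD; congr EFin.
  have -> : g (x + (s - 1) *: unit_vec i) = g (x + s *: unit_vec i).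
    by rewrite -gx -addrA -[X in _ *: _ + X]scale1r -scalerDl subrK.
  rewrite -mulrDr; congr (_ * _); rewrite !indicE.
  have HA : (x + s *: unit_vec i \in A) = (x \in Q) && (x ord0 i + s < 1).
    apply/idP/idP; rewrite inE.
      move=> [/QP[/Pshift Px]] /=; rewrite coordi => xi1 xi2.
      rewrite (andP xi1).2 andbT inE; apply/QP; split => //; lra.
    move=> /andP[]; rewrite inE => /QP[Px xi] xs; split => /=; last by rewrite coordi; lra.
    by apply/QP; split; [exact/Pshift|rewrite coordi; lra].
  have HB : (x + (s - 1) *: unit_vec i \in B) = (x \in Q) && (1 <= x ord0 i + s).
    apply/idP/idP; rewrite inE.
      move=> [/QP[/Pshift Px]] /=; rewrite coordi => xi1 xi2.
      apply/andP; split; last lra.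
      rewrite inE; apply/QP; split => //; lra.
    move=> /andP[]; rewrite inE => /QP[Px xi] xs; split => /=; last by rewrite coordi; lra.
    by apply/QP; split; [exact/Pshift|rewrite coordi; lra].
  rewrite HA HB leNgt; case: (x \in Q) => /=; last by rewrite addr0.
  by case: (_ < _); rewrite ?addr0 ?add0r.
rewrite integralD// (integral_shift (s *: unit_vec i) iA) (integral_shift ((s - 1) *: unit_vec
  i) iB).
rewrite -integralD//; apply: eq_integral => x _.
rewrite -EFinD -mulrDr; congr (_ * _)%:E.
rewrite !indicE /A /B !in_setI.
case: (x \in Q) => /=; last by rewrite addr0.
have -> : (x \in [set x : 'rV[R]_N | s <= x ord0 i]) = (s <= (x : 'rV[R]_N) ord0 i).
  by apply/idP/idP; rewrite inE.
have -> : (x \in [set x : 'rV[R]_N | x ord0 i < s]) = ((x : 'rV[R]_N) ord0 i < s).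
  by apply/idP/idP; rewrite inE.
by rewrite leNgt; case: (_ < _); rewrite /= ?addr0 ?add0r.
Qed.

Lemma periodic_mean_ae M g i : bounded_periodic M g ->
  (\int[mu]_(y in Q) (g ((y : 'rV[R]_N) + unit_vec i))%:E = \int[mu]_(y in Q) (g y)%:E)%E.
Proof.
move=> gp; have [mg gM pg] := gp; have [mg' _ _] := bounded_periodic_shift (unit_vec i) gp.
apply: ae_eq_integral => //.
- exact: measurable_hobox.
- by apply/measurable_EFinP; exact: measurable_funTS.
- by apply/measurable_EFinP; exact: measurable_funTS.
- by apply: filterS pg => x H _; rewrite H.
Qed.

Lemma periodic_mean_shift_coord M g i (s : R) : bounded_periodic M g ->
  (\int[mu]_(y in Q) (g ((y : 'rV[R]_N) + s *: unit_vec i))%:E = \int[mu]_(y in Q) (g y)%:E)%E.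
Proof.
have pos (t : R) : 0 <= t -> forall g, bounded_periodic M g ->
  (\int[mu]_(y in Q) (g ((y : 'rV[R]_N) + t *: unit_vec i))%:E = \int[mu]_(y in Q) (g y)%:E)%E.
  move=> t0; have /andP[n1 n2] := truncn_itv t0.
  have -> : t = (t - (Num.truncn t)%:R) + (Num.truncn t)%:R by rewrite subrK.
  have r01 : 0 <= t - (Num.truncn t)%:R < 1.
    by rewrite subr_ge0 n1 ltrBlDr -natr1 addrC in n2 *.
  move: (t - _) r01 => r r01; elim: (Num.truncn t) => [|n IH] h hp.
    by rewrite addr0; apply: (@periodic_mean_shift_coord_frac M).
  have := IH _ (bounded_periodic_shift (unit_vec i) hp).
  rewrite (periodic_mean_ae i hp) => <-; apply: eq_integral => y _; congr (h _)%:E.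
  by rewrite -addrA -[X in _ *: _ + X]scale1r -scalerDl -addrA natr1.
move=> gp; have [s0|s0] := leP 0 s; first exact: pos.
have s0' : 0 <= - s by rewrite oppr_ge0 ltW.
rewrite -(pos _ s0' _ (bounded_periodic_shift (s *: unit_vec i) gp)).
by apply: eq_integral => y _; rewrite scaleNr subrK.
Qed.

Lemma periodic_mean_shift M g (z : 'rV[R]_N) : bounded_periodic M g ->
  (\int[mu]_(y in Q) (g ((y : 'rV[R]_N) + z))%:E = \int[mu]_(y in Q) (g y)%:E)%E.
Proof.
have H (s : seq 'I_N) : forall g, bounded_periodic M g ->
  (\int[mu]_(y in Q) (g ((y : 'rV[R]_N) + \sum_(i <- s) z ord0 i *: unit_vec i))%:E =
   \int[mu]_(y in Q) (g y)%:E)%E.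
  elim: s => [|i s IH] h hp.
    by apply: eq_integral => y _; rewrite big_nil addr0.
  rewrite -[RHS](periodic_mean_shift_coord i (z ord0 i) hp).
  rewrite -(IH _ (bounded_periodic_shift (z ord0 i *: unit_vec i) hp)).
  by apply: eq_integral => y _; rewrite big_cons addrA addrAC.
by move=> gp; rewrite -(H (index_enum 'I_N) _ gp) -row_sum_delta.
Qed.

(** The substitution [x -> x + e y] moves [y] into the periodic factor, as [g (x / e + y)]. By
    Fubini the integral over [y] becomes a mean of [g] over a translated cube, and this does not
    depend on [x]. *)
Lemma periodic_averaging M g f (e : R) : bounded_periodic M g -> e != 0 ->
  mu.-integrable setT (EFin \o f) ->
  let F (y : 'rV[R]_N) := (\int[mu]_x (g (e^-1 *: (x : 'rV[R]_N)) * f ((x : 'rV[R]_N) - e *: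
    y))%:E)%E in
  mu.-integrable Q F /\
  (\int[mu]_(y in Q) F y = (\int[mu]_(y in Q) (g y)%:E) * \int[mu]_x (f x)%:E)%E.
Proof.
move=> + + + G; rewrite {}/G.
move=> gp e0 fi; have [mg gM pg] := gp.
have M0 : 0 <= M by rewrite (le_trans _ (gM 0)).
have mf : measurable_fun [set: 'rV[R]_N] f by apply/measurable_EFinP; exact: measurable_int fi.
have inner (y : 'rV[R]_N) : (\int[mu]_x (g (e^-1 *: (x : 'rV[R]_N)) * f ((x : 'rV[R]_N) - e *:
  y))%:E =
   \int[mu]_x (g (e^-1 *: (x : 'rV[R]_N) + y) * f x)%:E)%E.
  rewrite -(@integral_shift _ _ (- (e *: y)) (fun x => (g (e^-1 *: x + y) * f x)%:E)).
    by apply: eq_integral => x _; rewrite scalerBr scalerA mulVf// scale1r subrK.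
  apply: (@le_integrable _ _ _ mu setT measurableT _ (fun x => M%:E * (f x)%:E)%E).
  - apply/measurable_EFinP; apply: measurable_funM => //.
    by apply: (measurableT_comp mg); exact: rV_affine_measurable.
  - by move=> x _; rewrite -EFinM !abse_EFin lee_fin !normrM (ger0_norm M0) ler_wpM2r.
  - exact: integrableZl.
pose F (z : 'rV[R]_N * 'rV[R]_N) : \bar R := (g (e^-1 *: z.2 + 1 *: z.1) * f z.2 * \1_Q z.1)%:E.
have m1 : measurable_fun setT (fun z : 'rV[R]_N * 'rV[R]_N => g (e^-1 *: z.2 + 1 *: z.1)).
  apply: (measurableT_comp mg).
  rewrite (_ : (fun z : 'rV[R]_N * 'rV[R]_N => _) =
      (fun z : 'rV[R]_N * 'rV[R]_N => 1 *: z.1 + e^-1 *: z.2)); last first.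
    by apply/funext => z; rewrite addrC.
  exact: rV_comb_measurable2.
have mF : measurable_fun setT F.
  apply/measurable_EFinP; apply: measurable_funM.
    apply: measurable_funM => //.
    by apply: (measurableT_comp mf); exact: measurable_snd.
  apply: (@measurableT_comp _ _ _ _ _ _ (\1_Q : 'rV[R]_N -> R)).
    by apply: measurable_indic; exact: measurable_hobox.
  exact: measurable_fst.
have iF : (mu \x mu)%E.-integrable setT F.
  have mQ1 : measurable_fun [set: 'rV[R]_N] (fun y => (\1_Q y : R)%:E).
    by apply/measurable_EFinP; apply: measurable_indic; exact: measurable_hobox.
  have J := integrable_abse fi.
  have Jfin : (\int[mu]_x `|(f x)%:E| < +oo)%E by have /integrableP[] := fi.
  apply/integrable12ltyP => //.
  apply: (@le_lt_trans _ _ (\int[mu]_y ((M%:E * \int[mu]_x `|(f x)%:E|) * (\1_Q y)%:E))%E).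
    have mabs : measurable_fun setT (abse \o F) by exact: measurableT_comp.
    apply: ge0_le_integral => //.
    - by move=> y _; exact: integral_ge0.
    - have := @measurable_fun_fubini_tonelli_F _ _ _ _ _ mu (abse \o F) mabs; apply=> z; exact:
      abse_ge0.
    - by apply: emeasurable_funM.
    move=> y _; rewrite -ge0_integralZl//; last first.
      exact: measurable_int J.
    rewrite -ge0_integralZr//; last 2 first.
    - by apply: emeasurable_funM => //; exact: measurable_int J.
    - by move=> x _; rewrite mule_ge0.
    apply: ge0_le_integral => //.
    - by apply: (measurableT_comp mabs); exact: pair1_measurable.
    - by apply: emeasurable_funM => //; apply: emeasurable_funM => //; exact: measurable_int J.
    move=> x _; rewrite /F !abse_EFin -!EFinM lee_fin !normrM.
    by rewrite [X in _ * X <= _]ger0_norm// ler_wpM2r// ler_wpM2r.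
  rewrite ge0_integralZl//; last first.
  - by rewrite mule_ge0// integral_ge0.
  - rewrite integral_indic//; last exact: measurable_hobox.
    rewrite setIT [X in (_ * X)%E](_ : _ = 1%E); last exact: leb_unit_hobox.
    by rewrite mule1 lte_mul_pinfty// integral_ge0.
have patchE : (fun y : 'rV[R]_N => \int[mu]_x (g (e^-1 *: (x : 'rV[R]_N)) * f ((x : 'rV[R]_N) -
  e *: y))%:E)%E \_ Q =
    (fun y => \int[mu]_x F (y, x))%E.
  apply/funext => y; rewrite epatch_indic inner /F /= -integralZr//.
    by apply: eq_integral => x _; rewrite scale1r.
  apply: (@le_integrable _ _ _ mu setT measurableT _ (fun x => M%:E * (f x)%:E)%E).
  - apply/measurable_EFinP; apply: measurable_funM => //.
    by apply: (measurableT_comp mg); exact: rV_affine_measurable.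
  - by move=> x _; rewrite -EFinM !abse_EFin lee_fin !normrM (ger0_norm M0) ler_wpM2r.
  - exact: integrableZl.
split.
  apply/integrable_mkcond; first exact: measurable_hobox.
  by rewrite patchE; exact: (integrable_fubini_F (m2 := mu) (f := F)).
rewrite integral_mkcond patchE (@Fubini _ _ _ _ _ mu mu F iF).
have gfin : (\int[mu]_(y in Q) (g y)%:E \is a fin_num)%E.
  apply: integrable_fin_num; first exact: measurable_hobox.
  exact: integrable_bounded_hobox mg gM.
rewrite -(fineK gfin) -integralZl//; apply: eq_integral => x _.
rewrite (fineK gfin) -(periodic_mean_shift (e^-1 *: x) gp) integral_hobox_indic -integralZr//.
  by apply: eq_integral => y _; rewrite /F /= scale1r [_ + y]addrC -EFinM mulrAC.
have [mg' gM' _] := bounded_periodic_shift (e^-1 *: x) gp.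
apply: (integrable_mul_indic mg' gM'); first exact: measurable_hobox.
by rewrite leb_unit_hobox ltry.
Qed.

Lemma integrable_mul_bounded M g f (c : R) (h : 'rV[R]_N) : measurable_fun [set: 'rV[R]_N] g ->
  (forall x, `|g x| <= M) -> mu.-integrable setT (EFin \o f) ->
  mu.-integrable setT (fun x => (g (c *: x) * f ((x : 'rV[R]_N) + h))%:E).
Proof.
move=> mg gM fi; have M0 : 0 <= M by rewrite (le_trans _ (gM 0)).
have fi' : mu.-integrable setT (fun x => (f ((x : 'rV[R]_N) + h))%:E) by exact:
  (integrable_shift h fi).
apply: (@le_integrable _ _ _ mu setT measurableT _ (fun x => M%:E * (f ((x : 'rV[R]_N) +
  h))%:E)%E).
- apply/measurable_EFinP; apply: measurable_funM.
    apply: (measurableT_comp mg); have := rV_affine_measurable c (0 : 'rV[R]_N).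
    by rewrite (_ : (fun x => c *: x + 0) = (fun x : 'rV[R]_N => c *: x))//; apply/funext => x;
      rewrite addr0.
  by apply/measurable_EFinP; exact: measurable_int fi'.
- by move=> x _; rewrite -EFinM !abse_EFin lee_fin !normrM (ger0_norm M0) ler_wpM2r.
- exact: integrableZl.
Qed.

(** Otherwise every value would be at most the mean minus [d], and integration over [Q], of measure
    1, would contradict [periodic_averaging]. *)
Lemma averaging_point M g f (e d : R) : bounded_periodic M g -> e != 0 ->
  mu.-integrable setT (EFin \o f) -> 0 < d ->
  exists2 y, Q y & (\int[mu]_(y in Q) g y) * (\int[mu]_x f x) - d <
    \int[mu]_x (g (e^-1 *: (x : 'rV[R]_N)) * f ((x : 'rV[R]_N) - e *: y)).
Proof.
move=> gp e0 fi d0; have [mg gM _] := gp.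
have [iF FE] := periodic_averaging gp e0 fi.
pose I (y : 'rV[R]_N) := \int[mu]_x (g (e^-1 *: (x : 'rV[R]_N)) * f ((x : 'rV[R]_N) - e *: y)).
have IE y : (\int[mu]_x (g (e^-1 *: (x : 'rV[R]_N)) * f ((x : 'rV[R]_N) - e *: y))%:E = (I
  y)%:E)%E.
  rewrite /I /Rintegral fineK//; apply: integrable_fin_num => //.
  exact: (integrable_mul_bounded e^-1 (- (e *: y)) mg gM fi).
have iI : mu.-integrable Q (EFin \o I).
  by apply: eq_integrable iF; [exact: measurable_hobox|move=> y _; rewrite IE].
have IEE : \int[mu]_(y in Q) I y = (\int[mu]_(y in Q) g y) * (\int[mu]_x f x).
  rewrite /Rintegral (eq_integral (fun y : 'rV[R]_N => \int[mu]_x (g (e^-1 *: (x : 'rV[R]_N)) *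
    f ((x : 'rV[R]_N) - e *: y))%:E)%E).
    rewrite FE fineM//.
      apply: integrable_fin_num; first exact: measurable_hobox.
      exact: (integrable_bounded_hobox mg gM).
    by apply: integrable_fin_num fi => //; exact: measurableT.
  by move=> y _; rewrite IE.
apply: contrapT => H.
have /le_Rintegral : mu.-integrable Q (EFin \o I) by [].
move=> /(_ (fun=> (\int[mu]_(y in Q) g y) * (\int[mu]_x f x) - d) (@measurable_hobox _ _ _ _)).
have ic (b : R) : mu.-integrable Q (EFin \o (fun=> b)).
  by apply: (@integrable_bounded_hobox `|b|); [exact: measurable_cst|move=> x].
move=> /(_ (ic _)); rewrite IEE Rintegral_cst; last exact: measurable_hobox.
rewrite [X in _ <= _ * X](_ : _ = 1); last exact: (congr1 fine leb_unit_hobox).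
rewrite mulr1 => Hle; suff : (\int[mu]_(y in Q) g y) * (\int[mu]_x f x) <=
  (\int[mu]_(y in Q) g y) * (\int[mu]_x f x) - d by rewrite leNgt gtrBl d0.
by apply: Hle => y Qy; rewrite leNgt; apply/negP => Hy; apply: H; exists y.
Qed.

End periodic_mean.

(** * Approximation of indicators by smooth periodic weights *)

Section smooth_periodic.
Context {R : realType} {N : nat}.
Local Notation mu := (leb R N).
Local Notation Q := (@hobox R N 0 1).
Implicit Types (f g psi : 'rV[R]_N -> R) (A : set 'rV[R]_N).

Definition unit_periodic f := forall x i, f (x + unit_vec i) = f x.

Definition smooth_weight psi :=
  [/\ smooth psi, forall x, 0 <= psi x <= 1 & unit_periodic psi].

(** Approximation in L^1 of the unit cube. The range [0, 1] makes the class stable under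
    complements, products and pointwise limits, as a sigma-algebra argument requires. *)
Definition weight_approximable f :=
  [/\ measurable_fun [set: 'rV[R]_N] f, forall x, 0 <= f x <= 1 &
      forall d : R, 0 < d -> exists2 psi, smooth_weight psi &
        (\int[mu]_(y in Q) `|psi y - f y|%:E < d%:E)%E].

Lemma smooth_weight_measurable psi : smooth_weight psi -> measurable_fun [set: 'rV[R]_N] psi.
Proof. by case=> /smooth_continuous/measurable_continuous_rV. Qed.

Lemma smooth_weight_approximable psi : smooth_weight psi -> weight_approximable psi.
Proof.
move=> wp; have [sp p01 _] := wp; split; [exact: smooth_weight_measurable|exact: p01|].
move=> d d0; exists psi => //.
by rewrite integral0_eq ?lte_fin// => x _; rewrite subrr normr0.
Qed.

Lemma smooth_weight_compl psi : smooth_weight psi -> smooth_weight (fun x => 1 - psi x).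
Proof.
move=> [sp p01 pp]; split; last by move=> x i; rewrite pp.
- by apply: smoothB => //; exact: smooth_cst.
- by move=> x; have /andP[? ?] := p01 x; rewrite subr_ge0 gerBl; apply/andP.
Qed.

Lemma smooth_weight_mul psi1 psi2 : smooth_weight psi1 -> smooth_weight psi2 ->
  smooth_weight (fun x => psi1 x * psi2 x).
Proof.
move=> [sp p01 pp] [sp' p01' pp']; split; last by move=> x i; rewrite pp pp'.
- exact: smoothM.
- move=> x; have /andP[? ?] := p01 x; have /andP[? ?] := p01' x.
  by rewrite mulr_ge0//= mulr_ile1.
Qed.

Lemma measurable_distl f g : measurable_fun [set: 'rV[R]_N] f ->
  measurable_fun [set: 'rV[R]_N] g -> measurable_fun Q (fun y => `|f y - g y|%:E).
Proof.
move=> mf mg; apply/measurable_EFinP; apply: measurable_funTS.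
by apply: measurableT_comp; [exact: normr_measurable|exact: measurable_funB].
Qed.

Lemma weight_approximable_compl f : weight_approximable f ->
  weight_approximable (fun x => 1 - f x).
Proof.
move=> [mf f01 Hf]; split.
- by apply: measurable_funB => //; exact: measurable_cst.
- by move=> x; have /andP[? ?] := f01 x; rewrite subr_ge0 gerBl; apply/andP.
move=> d /Hf[psi wp pd]; exists (fun x => 1 - psi x); first exact: smooth_weight_compl.
apply: le_lt_trans pd; apply: ge0_le_integral => //.
- exact: measurable_hobox.
- apply: (@measurable_distl (fun y => 1 - psi y) (fun y => 1 - f y)).
    by apply: measurable_funB; [exact: measurable_cst|exact: smooth_weight_measurable].
  by apply: measurable_funB => //; exact: measurable_cst.
- by apply: measurable_distl => //; exact: smooth_weight_measurable.
- move=> x _; rewrite lee_fin distrC (_ : 1 - f x - (1 - psi x) = psi x - f x)//.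
  by ring.
Qed.

Lemma weight_approximable_mul f g : weight_approximable f -> weight_approximable g ->
  weight_approximable (fun x => f x * g x).
Proof.
move=> [mf f01 Hf] [mg g01 Hg]; split; first exact: measurable_funM.
  move=> x; have /andP[? ?] := f01 x; have /andP[? ?] := g01 x.
  by rewrite mulr_ge0//= mulr_ile1.
move=> d d0; have d20 : 0 < d / 2 by rewrite divr_gt0.
have [psi wp pd] := Hf _ d20; have [phi wq qd] := Hg _ d20.
exists (fun x => psi x * phi x); first exact: smooth_weight_mul.
have mp := smooth_weight_measurable wp; have mq := smooth_weight_measurable wq.
apply: (@le_lt_trans _ _ (\int[mu]_(y in Q) (`|psi y - f y|%:E + `|phi y - g y|%:E))%E).
  apply: ge0_le_integral => //.
  - exact: measurable_hobox.
  - by apply: (@measurable_distl (fun y => psi y * phi y) (fun y => f y * g y)); exact: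
    measurable_funM.
  - by apply: emeasurable_funD; exact: measurable_distl.
  move=> x _; rewrite -EFinD lee_fin.
  have -> : psi x * phi x - f x * g x = (psi x - f x) * phi x + f x * (phi x - g x) by ring.
  have [_ p01 _] := wp; have [_ q01 _] := wq.
  have /andP[f0 f1] := f01 x; have /andP[q0 q1] := q01 x.
  rewrite (le_trans (ler_normD _ _))// !normrM lerD//.
    by rewrite ler_piMr// ger0_norm.
  by rewrite ler_piMl// ger0_norm.
rewrite ge0_integralD//.
- have -> : d = d / 2 + d / 2 by rewrite -splitr.
  by rewrite EFinD lteD.
- exact: measurable_hobox.
- exact: measurable_distl.
- exact: measurable_distl.
Qed.

Lemma weight_approximable_limit (F : nat -> 'rV[R]_N -> R) f :
  measurable_fun [set: 'rV[R]_N] f -> (forall x, 0 <= f x <= 1) ->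
  (forall n, weight_approximable (F n)) ->
  (forall x, Q x -> F n x @[n --> \oo] --> f x) -> weight_approximable f.
Proof.
move=> mf f01 HF Ff; split => // d d0.
have d20 : 0 < d / 2 by rewrite divr_gt0.
have [//|||||_ + _] := @dominated_convergence _ _ R mu Q (@measurable_hobox R N 0 1)
  (fun n x => (F n x)%:E) (fun x => (f x)%:E) (cst 1%E).
- by move=> n; apply/measurable_EFinP; apply: measurable_funTS; case: (HF n).
- by apply/measurable_EFinP; exact: measurable_funTS.
- by apply: aeW => x Qx; apply: cvg_EFin; [exact: nearW|exact: Ff].
- apply: (@integrable_bounded_hobox _ _ 1 (fun=> 1)) => //.
  by move=> x; rewrite normr1.
- apply: aeW => x n _; have [_ /(_ x)/andP[? ?] _] := HF n.
  by rewrite abse_EFin lee_fin ger0_norm.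
move=> /fine_cvgP[].
move=> [n1 _ Hn1] /cvgrPdist_lt/(_ _ d20)[n2 _ Hn2].
pose n := maxn n1 n2.
have := Hn1 n (leq_maxl _ _); have := Hn2 n (leq_maxr _ _); rewrite /= sub0r normrN => lt2 fin.
have [mF F01 /(_ _ d20)[psi wp pd]] := HF n.
exists psi => //.
have mp := smooth_weight_measurable wp.
apply: (@le_lt_trans _ _ (\int[mu]_(y in Q) (`|psi y - F n y|%:E + `|F n y - f y|%:E))%E).
  apply: ge0_le_integral => //.
  - exact: measurable_hobox.
  - exact: measurable_distl.
  - by apply: emeasurable_funD; exact: measurable_distl.
  by move=> x _; rewrite -EFinD lee_fin ler_distD.
rewrite ge0_integralD//.
- have -> : d = d / 2 + d / 2 by rewrite -splitr.
  rewrite EFinD lteD//.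
  rewrite (eq_integral (fun x => `|(F n x)%:E - (f x)%:E|%E)); last by [].
  by rewrite -(fineK fin) lte_fin (le_lt_trans (ler_norm _)).
- exact: measurable_hobox.
- exact: measurable_distl.
- exact: measurable_distl.
Qed.

(** For [0 <= a < 1] a trigonometric function of [x_i] has on [Q] the sign pattern of the
    half-space, and [flat_exp] of its multiples tends to the indicator of positivity. For other [a]
    the indicator is constant on [Q]. *)
Lemma weight_approximable_halfspace (i : 'I_N) (a : R) :
  weight_approximable \1_[set x : 'rV[R]_N | a < x ord0 i].
Proof.
have mA : measurable [set x : 'rV[R]_N | a < x ord0 i].
  rewrite [X in measurable X](_ : _ = (fun x : 'rV[R]_N => x ord0 i) @^-1` `]a, +oo[%classic).
    by rewrite -[X in measurable X]setTI; apply: measurable_coord.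
  by apply/seteqP; split=> x /=; rewrite in_itv/= andbT.
have m1 : measurable_fun [set: 'rV[R]_N] (\1_[set x : 'rV[R]_N | a < x ord0 i] : _ -> R).
  exact: measurable_indic.
have i01 (x : 'rV[R]_N) : 0 <= (\1_[set x : 'rV[R]_N | a < x ord0 i] x : R) <= 1.
  by rewrite indicE; case: (_ \in _); rewrite /= ?lexx ?ler01.
have const (b : R) : 0 <= b <= 1 -> smooth_weight (fun=> b : R).
  by move=> b01; split => //; exact: smooth_cst.
have [a0|a0] := ltP a 0.
  apply: (@weight_approximable_limit (fun _ _ => 1)) => //.
    by move=> n; apply: smooth_weight_approximable; apply: const; rewrite ler01 lexx.
  move=> x Qx; rewrite indicE mem_set ?cvg_cst//=; first exact: cvg_cst.
  by have /andP[x0 _] := Qx i; exact: lt_le_trans x0.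
have [a1|a1] := leP 1 a.
  apply: (@weight_approximable_limit (fun _ _ => 0)) => //.
    by move=> n; apply: smooth_weight_approximable; apply: const; rewrite ler01 lexx.
  move=> x Qx; rewrite indicE memNset; first exact: cvg_cst.
  by have /andP[_ x1] := Qx i; apply/negP; rewrite -leNgt (le_trans (ltW x1)).
(* g is positive on ]a, 1[ and nonpositive on [0, a], see gE. *)
pose g (t : R) : R := cos (pi * a) - cos (2 * pi * t + - (pi * a)).
have gE t : g t = 2 * sin (pi * t) * sin (pi * (t - a)).
  have -> : g t = cos (pi * t - pi * (t - a)) - cos (pi * t + pi * (t - a)).
    by rewrite /g; congr (cos _ - cos _); ring.
  by rewrite cosB cosD; ring.
pose F (n : nat) (x : 'rV[R]_N) := flat_exp (n.+1%:R * g (x ord0 i)).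
have wF n : smooth_weight (F n).
  split.
  - apply: smooth_flat_exp; apply: smoothM; first exact: smooth_cst.
    apply: smoothB; first exact: smooth_cst.
    apply: smooth_cos; apply: smoothD; last exact: smooth_cst.
    by apply: smoothM; [exact: smooth_cst|exact: smooth_coord].
  - by move=> x; rewrite flat_exp_ge0 flat_exp_le1.
  - move=> x j; rewrite /F /g; congr (flat_exp (_ * (_ - _))).
    have [->|ij] := eqVneq i j; rewrite !mxE !eqxx /=; last by rewrite (negPf ij) addr0.
    by rewrite -[RHS]cosD2pi; congr cos; ring.
apply: (weight_approximable_limit m1 i01 (F := F)).
  by move=> n; exact: smooth_weight_approximable.
move=> x Qx; have /andP[x0 x1] := Qx i.
have [xa|ax] := leP (x ord0 i) a.
  rewrite indicE memNset /=; last by apply/negP; rewrite -leNgt.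
  rewrite (_ : (fun n => F n x) = fun=> 0); first exact: cvg_cst.
  apply/funext => n; rewrite /F flat_exp_le0// mulr_ge0_le0// gE.
  rewrite mulr_ge0_le0//.
    by rewrite mulr_ge0// sin_ge0_pi// mulr_ge0 ?pi_ge0//= ler_piMr ?pi_ge0// ltW.
  rewrite -oppr_ge0 -sinN sin_ge0_pi// -mulrN opprB mulr_ge0 ?pi_ge0 ?subr_ge0//=.
  by rewrite ler_piMr ?pi_ge0//; lra.
have gp : 0 < g (x ord0 i).
  rewrite gE !mulr_gt0//.
    by rewrite sin_gt0_pi// mulr_gt0 ?pi_gt0//= ?gtr_pMr ?pi_gt0//; lra.
  by rewrite sin_gt0_pi// mulr_gt0 ?pi_gt0//= ?subr_gt0// gtr_pMr ?pi_gt0//; lra.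
rewrite indicE mem_set//=.
rewrite (_ : (fun n => F n x) = (fun n => expR (- ((n.+1%:R)^-1 * (g (x ord0 i))^-1)))); last
  first.
  by apply/funext => n; rewrite /F flat_expE ?mulr_gt0// invfM.
rewrite -[X in _ --> X]expR0; apply: continuous_cvg; first exact: continuous_expR.
rewrite -oppr0 -[in X in _ --> - X](mul0r (g (x ord0 i))^-1); apply: cvgN.
by apply: cvgMl; exact: cvg_harmonic.
Qed.

(** The sets with approximable indicator form a sigma-algebra containing the coordinate half-spaces,
    which generate the measurable sets. No convolution is involved. *)
Lemma weight_approximable_indic A : measurable A -> weight_approximable \1_A.
Proof.
have sig (T : Type) (h : 'rV[R]_N -> T) :
  sigma_algebra setT [set B : set T | measurable (h @^-1` B) /\ weight_approximable \1_(h @^-1`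
    B)].
  split.
  - split; first by rewrite preimage_set0; exact: measurable0.
    rewrite preimage_set0; apply: smooth_weight_approximable; rewrite indic0.
    by split => //; [exact: smooth_cst|move=> x; rewrite lexx ler01].
  - move=> B [mB aB]; rewrite setTD preimage_setC; split; first exact: measurableC.
    rewrite (_ : \1_ _ = (fun x => 1 - \1_(h @^-1` B) x)); last first.
      by apply/funext => x; rewrite !indicE in_setC; case: (_ \in _); rewrite /= ?subr0 ?subrr.
    exact: weight_approximable_compl.
  - move=> B HB; split.
      by rewrite preimage_bigcup; apply: bigcupT_measurable => n; case: (HB n).
    (* The indicator of the complement of the first [n] sets; [1 - P n] increases to the indicator
       of the union. *)
    pose P n (x : 'rV[R]_N) : R := \prod_(j < n) (1 - \1_(h @^-1` B j) x).
    have aP n : weight_approximable (P n).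
      elim: n => [|n IH].
        rewrite (_ : P 0%N = fun=> 1); last by apply/funext => x; rewrite /P big_ord0.
        apply: smooth_weight_approximable.
        by split => //; [exact: smooth_cst|move=> x; rewrite lexx ler01].
      rewrite (_ : P n.+1 = fun x => P n x * (1 - \1_(h @^-1` B n) x)); last first.
        by apply/funext => x; rewrite /P big_ord_recr.
      apply: weight_approximable_mul => //; apply: weight_approximable_compl.
      by case: (HB n).
    apply: (@weight_approximable_limit (fun n x => 1 - P n x)).
    - apply: measurable_indic; rewrite preimage_bigcup.
      by apply: bigcupT_measurable => n; case: (HB n).
    - by move=> x; rewrite indicE; case: (_ \in _); rewrite /= ?lexx ?ler01.
    - by move=> n; exact: weight_approximable_compl.
    move=> x _; have [[m _ /= Bm]|nB] := pselect ((h @^-1` (\bigcup_n B n)) x).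
      rewrite indicE mem_set /=; last by exists m.
      apply: cvg_near_cst.
      exists m.+1 => // n /= mn.
      rewrite /P (bigD1 (Ordinal mn)) //= indicE mem_set//= subrr mul0r subr0//.
    rewrite indicE memNset //=.
    rewrite (_ : (fun n => 1 - P n x) = fun=> 0); first exact: cvg_cst.
    apply/funext => n; rewrite /P big1 ?subrr// => j _.
    rewrite indicE memNset ?subr0// => Bj; apply: nB; exists j => //.
pose S := [set B : set 'rV[R]_N | measurable B /\ weight_approximable \1_B].
suff : measurable `<=` S by move=> H /H[].
apply: smallest_sub; first exact: (sig _ id).
rewrite -bigcup_seq => B [i _ [C mC <-]]; rewrite setTI.
suff : [set D : set R | measurable ((fun v : 'rV[R]_N => v ord0 i) @^-1` D) /\
   weight_approximable \1_((fun v : 'rV[R]_N => v ord0 i) @^-1` D)] C by [].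
have {}mC : (@ocitv R).-sigma.-measurable C by [].
move: mC; rewrite RGenOInfty.measurableE; move: C.
apply: smallest_sub; first exact: (sig _ _).
move=> _ [a ->] /=.
rewrite (_ : _ @^-1` _ = [set x : 'rV[R]_N | a < x ord0 i]); last first.
  by apply/seteqP; split=> x /=; rewrite in_itv/= andbT.
split; last exact: weight_approximable_halfspace.
rewrite [X in measurable X](_ : _ = (fun x : 'rV[R]_N => x ord0 i) @^-1` `]a, +oo[%classic).
  by rewrite -[X in measurable X]setTI; apply: measurable_coord.
by apply/seteqP; split=> x /=; rewrite in_itv/= andbT.
Qed.

End smooth_periodic.

(** * Smooth weights that make the mean positive *)

Section positive_weight.
Context {R : realType} {N : nat}.
Local Notation mu := (leb R N).
Local Notation Q := (@hobox R N 0 1).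
Implicit Types (f g psi : 'rV[R]_N -> R) (M : R).

(** Every point lies in the translate of [Q] by the vector of its integer parts, and there are
    countably many such vectors. *)
Lemma ae_lattice_translates (P : set 'rV[R]_N) :
  (forall z : 'rV[R]_N, \forall y \ae mu, Q y -> P (y + z)) -> \forall x \ae mu, P x.
Proof.
move=> H.
pose z (n : nat) : 'rV[R]_N :=
  if unpickle n is Some v then \row_i ((v : 'rV[int]_N) ord0 i)%:~R else 0.
have : \forall x \ae mu, forall n, Q (x - z n) -> P x.
  apply: ae_foralln => n; have := ae_shift (- z n) (H (z n)).
  by apply: filterS => x; rewrite subrK.
apply: filterS => x Px.
apply: (Px (pickle (\row_i Num.floor (x ord0 i) : 'rV[int]_N))) => i.
rewrite /z pickleK !mxE subr_ge0; have /andP[-> /=] := floor_itv (x ord0 i).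
by rewrite intrD ltrBlDl.
Qed.

Lemma bounded_periodic_mean_gt0 M g : bounded_periodic M g -> (forall x, 0 <= g x) ->
  ~ (g = cst 0 %[ae mu]) -> (0 < \int[mu]_(y in Q) (g y)%:E)%E.
Proof.
move=> gp g0 gN0; rewrite lt_neqAle integral_ge0 ?andbT; last by move=> x _; rewrite lee_fin.
apply/negP => /eqP g00; apply: gN0.
apply: ae_lattice_translates => z.
have [mg _ _] := bounded_periodic_shift z gp.
have me : measurable_fun Q (fun x : 'rV[R]_N => (g (x + z))%:E).
  by apply/measurable_EFinP; exact: measurable_funTS.
have := (ae_eq_integral_abs mu (@measurable_hobox R N 0 1) me).1.
rewrite (eq_integral (fun x : 'rV[R]_N => (g (x + z))%:E)); last first.
  by move=> y _; rewrite abse_EFin ger0_norm.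
rewrite (periodic_mean_shift z gp) => /(_ (esym g00)).
by apply: filterS => y H Qy; have [] := H Qy.
Qed.

Lemma bounded_periodic_mul_weight M g psi : smooth_weight psi -> bounded_periodic M g ->
  bounded_periodic M (fun x => g x * psi x).
Proof.
move=> wp [mg gM pg]; have [_ p01 pp] := wp; split.
- by apply: measurable_funM => //; exact: smooth_weight_measurable.
- move=> x; have /andP[p0 p1] := p01 x; rewrite normrM (ger0_norm p0).
  by rewrite (le_trans _ (gM x))// ler_piMr.
- by apply: filterS pg => y H i; rewrite H pp.
Qed.

Lemma positive_weight M g : bounded_periodic M g -> ~ (g^\+ = cst 0 %[ae mu]) ->
  exists2 psi, smooth_weight psi & 0 < \int[mu]_(y in Q) (g y * psi y).
Proof.
move=> gp gN0; have [mg gM pg] := gp.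
have M0 : 0 <= M by rewrite (le_trans _ (gM 0)).
have mgp : measurable_fun [set: 'rV[R]_N] g^\+ by exact: measurable_funrpos.
have gpM x : `|g^\+ x| <= M.
  rewrite ger0_norm ?funrpos_ge0// /funrpos ge_max M0 andbT.
  by rewrite (le_trans (ler_norm _)).
have I0 : (0 < \int[mu]_(y in Q) (g^\+ y)%:E)%E.
  apply: (@bounded_periodic_mean_gt0 M) => //.
  by split => //; apply: filterS pg => y H i; rewrite /funrpos H.
have igp := integrable_bounded_hobox mgp gpM.
have Ifin : (\int[mu]_(y in Q) (g^\+ y)%:E \is a fin_num)%E.
  by apply: integrable_fin_num igp; exact: measurable_hobox.
pose I := fine (\int[mu]_(y in Q) (g^\+ y)%:E)%E.
have {}I0 : 0 < I by rewrite fine_gt0// I0 ltey_eq Ifin.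
pose A := [set x | 0 < g x].
have mA : measurable A.
  rewrite [X in measurable X](_ : _ = g @^-1` `]0, +oo[%classic).
    by rewrite -[X in measurable X]setTI; apply: mg.
  by apply/seteqP; split=> x /=; rewrite in_itv/= andbT.
have [m1 _ Happrox] := weight_approximable_indic mA.
(* [I] is the integral of [g] over [A] within [Q]. As [|g| <= M], an L^1 error below [I / (M + 1)]
   changes it by less than [I]. *)
have d0 : 0 < I / (M + 1) by rewrite divr_gt0// ltr_wpDl.
have [psi wp pd] := Happrox _ d0; exists psi => //.
have mp := smooth_weight_measurable wp.
have [mgpsi gpsiM _] := bounded_periodic_mul_weight wp gp.
have ip := integrable_bounded_hobox mgpsi gpsiM.
have id : mu.-integrable Q (EFin \o (fun y => `|psi y - \1_A y|)).
  apply: (@integrable_bounded_hobox _ _ 1).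
    by apply: measurableT_comp; [exact: normr_measurable|exact: measurable_funB].
  move=> x; rewrite normr_id ler_norml.
  have [_ /(_ x)/andP[? ?] _] := wp.
  by rewrite indicE; case: (_ \in _) => /=; apply/andP; split; lra.
have iM : mu.-integrable Q (EFin \o (fun y => M * `|psi y - \1_A y|)).
  exact: (integrableZl (@measurable_hobox R N 0 1) M id).
have pdR : M * \int[mu]_(y in Q) `|psi y - \1_A y| < I.
  have : \int[mu]_(y in Q) `|psi y - \1_A y| < I / (M + 1).
    rewrite -lte_fin /Rintegral fineK//.
    by apply: integrable_fin_num id; exact: measurable_hobox.
  rewrite ltr_pdivlMr ?ltr_wpDl// => H.
  apply: le_lt_trans H; rewrite mulrC ler_wpM2l ?lerDl//.
  by apply: Rintegral_ge0 => x _.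
apply: lt_le_trans (_ : I - M * \int[mu]_(y in Q) `|psi y - \1_A y| <= _); first by rewrite
  subr_gt0.
rewrite -RintegralZl//; last exact: measurable_hobox.
rewrite -[I]/(\int[mu]_(y in Q) g^\+ y) -RintegralB//; last exact: measurable_hobox.
apply: le_Rintegral => //.
- exact: measurable_hobox.
- exact: (integrableB (@measurable_hobox R N 0 1) igp iM).
move=> x _.
have -> : g^\+ x = g x * \1_A x.
  rewrite /funrpos indicE; have [gx|gx] := leP (g x) 0.
    by rewrite memNset ?mulr0//= /A /= ltNge gx.
  by rewrite mem_set//= mulr1.
rewrite lerBlDr -lerBlDl -mulrBr (le_trans (ler_norm _))// normrM distrC.
by rewrite ler_wpM2r.
Qed.

End positive_weight.

(** * L^p estimates *)

Section lower_integral.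
Local Open Scope ereal_scope.
Context {d} {T : measurableType d} {R : realType}.
Variable mu : {measure set T -> \bar R}.
Implicit Types (f g : T -> \bar R) (D : set T).
Import HBNNSimple.

Lemma ge0_le_integral_nonmeasurable f g : (forall x, 0 <= f x) ->
  (forall x, f x <= g x) -> \int[mu]_x f x <= \int[mu]_x g x.
Proof.
move=> f0 fg; have g0 x : 0 <= g x by exact: le_trans (fg x).
rewrite !ge0_integralTE//; apply: ge_ereal_sup => _ [h /= hf <-].
by apply: ereal_sup_ubound; exists h => //= x; exact: le_trans (fg x).
Qed.

(* The integral is a supremum over simple functions, hence monotone almost
   everywhere also on non-measurable functions. *)
Lemma ge0_ae_le_integral_nonmeasurable f g : (forall x, 0 <= f x) -> (forall x, 0 <= g x) ->
  (\forall x \ae mu, f x <= g x) -> \int[mu]_x f x <= \int[mu]_x g x.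
Proof.
move=> f0 g0 [A [mA A0 fgA]]; rewrite [leLHS]ge0_integralTE//.
apply: ge_ereal_sup => _ [h /= hf <-]; rewrite -integralT_nnsfun.
rewrite (_ : \int[mu]_x (h x)%:E = \int[mu]_x (EFin \o h \_ (~` A)) x); last first.
  apply: ae_eq_integral => //.
  - by apply/measurable_EFinP.
  - apply/measurable_EFinP; apply/(measurable_restrictT _ _).1 => //; first exact: measurableC.
    exact: measurable_funTS.
  exists A; split => // x /= H; apply: contrapT => nA; apply: H => _.
  by rewrite patchE mem_set.
apply: ge0_le_integral_nonmeasurable => x /=.
  by rewrite patchE; case: ifPn => // _; rewrite lee_fin.
rewrite patchE; case: ifPn => // /set_mem nA.
by apply: (le_trans (hf x)); apply: contrapT => H; apply: nA; exact: fgA.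
Qed.

(** Serves the energy: [Phi x (sob_grad w x)] can be compared with powers of the gradient without
    the measurability of this composition. *)
Lemma ae_le_integral_nonmeasurable D f g : measurable D ->
  (\forall x \ae mu, D x -> 0 <= f x <= g x) ->
  0 <= \int[mu]_(x in D) f x <= \int[mu]_(x in D) g x.
Proof.
move=> mD fg.
have neg0 (h : T -> \bar R) : (\forall x \ae mu, D x -> 0 <= h x) -> \int[mu]_(x in D) h^\- x = 0.
  move=> h0; apply/eqP; rewrite eq_le integral_ge0 ?andbT; last by move=> x _; exact: funeneg_ge0.
  rewrite integral_mkcond -[leRHS](integral0 mu setT).
  apply: ge0_ae_le_integral_nonmeasurable => //.
    by move=> x; rewrite patchE; case: ifPn => // _; exact: funeneg_ge0.
  apply: filterS h0 => x hx; rewrite patchE; case: ifPn => // /set_mem /hx hx0.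
  by rewrite funenegE ge_max oppe_le0 hx0 lexx.
have f0 : \forall x \ae mu, D x -> 0 <= f x.
  by apply: filterS fg => x hx /hx /andP[].
have g0 : \forall x \ae mu, D x -> 0 <= g x.
  by apply: filterS fg => x hx /hx /andP[]; exact: le_trans.
rewrite (integralE mu D f) (integralE mu D g) (neg0 f f0) (neg0 g g0) !sube0.
apply/andP; split; first by apply: integral_ge0 => x _; exact: funepos_ge0.
rewrite (integral_mkcond D f^\+) (integral_mkcond D g^\+).
apply: ge0_ae_le_integral_nonmeasurable.
- by move=> x; rewrite patchE; case: ifPn => // _; exact: funepos_ge0.
- by move=> x; rewrite patchE; case: ifPn => // _; exact: funepos_ge0.
apply: filterS fg => x hx; rewrite !patchE; case: ifPn => // /set_mem /hx /andP[_ fgx].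
by rewrite !funeposE ge_max !le_max fgx lexx orbT.
Qed.

End lower_integral.

Section powR_distance.
Context {R : realType}.
Implicit Types (a b p t : R).

Lemma powR_onem_le p t : 1 < p -> 0 < t <= 2^-1 ->
  (1 - t) `^ (1 - p) <= 1 + p * 2 `^ p * t.
Proof.
move=> p1 /andP[t0 t1].
have s0 : 0 < 1 - t by lra.
have m1 : 1 <= 1 + 2 * t by lra.
apply: (@le_trans _ _ ((1 + 2 * t) `^ p)).
  apply: (@le_trans _ _ ((1 + 2 * t) `^ (p - 1))); last by rewrite ler_powR//; lra.
  rewrite (_ : 1 - p = - (p - 1)); last by ring.
  rewrite powRN -powR_inv1 ?powR_ge0// -powRrM mulrC powRrM powR_inv1 ?(ltW s0)//.
  apply: ge0_ler_powR; rewrite ?nnegrE; [lra|by rewrite invr_ge0 ltW|lra|].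
  by rewrite -[leLHS]mul1r ler_pdivrMr//; nra.
(* The tangent of the p-th power at [1 + 2 t], evaluated at 1, bounds [(1 + 2 t)^p - 1] by
   [2 p t (1 + 2 t)^(p - 1)]. *)
have := young_tangent p1 ler01 (le_trans ler01 m1).
rewrite powR1 mulr1.
have mE : (1 + 2 * t) `^ p = (1 + 2 * t) * (1 + 2 * t) `^ (p - 1).
  by rewrite mulr_powRB1//; lra.
have X2 : (1 + 2 * t) `^ (p - 1) <= 2 `^ (p - 1).
  by apply: ge0_ler_powR; rewrite ?nnegrE; lra.
have mE2 : 2 `^ p = 2 * 2 `^ (p - 1).
  by rewrite mulr_powRB1//; lra.
have X0 := powR_ge0 (1 + 2 * t) (p - 1).
rewrite mE mE2; move: ((1 + 2 * t) `^ (p - 1)) (2 `^ (p - 1)) X2 X0 => X Y X2 X0 H.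
have : p * t * X <= p * t * Y by rewrite ler_wpM2l// mulr_ge0; lra.
nra.
Qed.

(** The form that yields a linear rate: with [t = e] and [|a - b|] of order [e] in L^p, both terms
    are of order [e] after integration. *)
Lemma powR_norm_dist (a b : R) p t : 1 < p -> 0 < t <= 2^-1 ->
  `| `|a| `^ p - `|b| `^ p| <=
  p * 2 `^ p * t * (`|a| `^ p + `|b| `^ p) + t `^ (1 - p) * `|a - b| `^ p.
Proof.
move=> p1 th; have /andP[t0 t1] := th.
have t01 : 0 < t < 1 by lra.
have c1 := powR_onem_le p1 th.
have H (x y : R) : `|x| `^ p <= (1 - t) `^ (1 - p) * `|y| `^ p + t `^ (1 - p) * `|x - y| `^ p.
  have := powR_norm_add_weighted y (x - y) p1 t01.
  by rewrite (_ : y + (x - y) = x)//; ring.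
have ab := H a b; have := H b a; rewrite distrC => ba.
have A0 : 0 <= `|a| `^ p by exact: powR_ge0.
have B0 : 0 <= `|b| `^ p by exact: powR_ge0.
have K0 : 0 <= p * 2 `^ p * t by rewrite !mulr_ge0 ?powR_ge0//; lra.
have KA := mulr_ge0 K0 A0; have KB := mulr_ge0 K0 B0.
have cA := ler_wpM2r A0 c1; have cB := ler_wpM2r B0 c1.
rewrite ler_norml; apply/andP; split; lra.
Qed.

End powR_distance.

Section powR_integrals.
Context {d} {T : measurableType d} {R : realType}.
Variable mu : {measure set T -> \bar R}.
Implicit Types (u v : T -> R) (D : set T) (p t : R).

Definition powR_integrable p u := measurable_fun setT u /\
  mu.-integrable setT (fun x => (`|u x| `^ p)%:E).

Lemma powR_integrableP p u : measurable_fun setT u ->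
  (\int[mu]_x (`|u x| `^ p)%:E < +oo)%E -> powR_integrable p u.
Proof.
move=> mu_ fin; split => //; apply/integrableP; split.
  by apply/measurable_EFinP; exact: measurable_powR_norm_fun.
by under eq_integral do rewrite abse_EFin ger0_norm ?powR_ge0//.
Qed.

Lemma powR_integrable_lty p u : powR_integrable p u ->
  (\int[mu]_x (`|u x| `^ p)%:E < +oo)%E.
Proof.
move=> [_ /integrableP[_]].
by under eq_integral do rewrite abse_EFin ger0_norm ?powR_ge0//.
Qed.

Lemma powR_integrable_on p u D : measurable D -> powR_integrable p u ->
  mu.-integrable D (fun x => (`|u x| `^ p)%:E).
Proof. by move=> mD [_]; apply: integrableS. Qed.

Lemma powR_integrableD p u v : 0 <= p -> powR_integrable p u -> powR_integrable p v ->
  powR_integrable p (fun x => u x + v x).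
Proof.
move=> p0 [mu_ iu] [mv iv]; split; first exact: measurable_funD.
apply: (@le_integrable _ _ _ mu setT measurableT _
  (fun x => ((2 `^ p)%:E * ((`|u x| `^ p)%:E + (`|v x| `^ p)%:E))%E)).
- by apply/measurable_EFinP; apply: measurable_powR_norm_fun; exact: measurable_funD.
- move=> x _; rewrite -EFinD -EFinM !abse_EFin lee_fin (ger0_norm (powR_ge0 _ _)).
  rewrite [leRHS]ger0_norm; first exact: powR_norm_add_le.
  by rewrite mulr_ge0 ?addr_ge0 ?powR_ge0.
- by apply: integrableZl => //; exact: integrableD.
Qed.

Lemma powR_integrableN p u : powR_integrable p u -> powR_integrable p (fun x => - u x).
Proof.
move=> [mu_ iu]; split; first exact: measurable_funN.
by under [X in mu.-integrable _ X]eq_fun do rewrite normrN.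
Qed.

Lemma powR_integrableB p u v : 0 <= p -> powR_integrable p u -> powR_integrable p v ->
  powR_integrable p (fun x => u x - v x).
Proof. by move=> p0 iu iv; apply: powR_integrableD => //; exact: powR_integrableN. Qed.

Lemma Rintegral_powR_dist p t u v D : 1 < p -> 0 < t <= 2^-1 -> measurable D ->
  powR_integrable p u -> powR_integrable p v ->
  \int[mu]_(x in D) `| `|u x| `^ p - `|v x| `^ p| <=
  p * 2 `^ p * t * (\int[mu]_(x in D) (`|u x| `^ p) + \int[mu]_(x in D) (`|v x| `^ p))
  + t `^ (1 - p) * \int[mu]_(x in D) (`|u x - v x| `^ p).
Proof.
move=> p1 t01 mD iu iv; have p0 : 0 <= p by lra.
have iuv := powR_integrableB p0 iu iv.
have [iu' iv'] := (powR_integrable_on mD iu, powR_integrable_on mD iv).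
have iuv' := powR_integrable_on mD iuv.
have isum := integrableD mD iu' iv'.
have iZ := integrableZl mD (p * 2 `^ p * t) isum.
have iZ2 := integrableZl mD (t `^ (1 - p)) iuv'.
have iB := integrableB mD iu' iv'.
rewrite -RintegralD// -!RintegralZl// -RintegralD//.
apply: le_Rintegral => //.
- exact: (integrable_abse iB).
- exact: (integrableD mD iZ iZ2).
by move=> x _; exact: powR_norm_dist.
Qed.

(** Continuity at [u] of the p-th power as a map from L^p to L^1. The weight [t] is fixed first and
    controls the linear term; [n] then absorbs [t^(1 - p)]. *)
Lemma Rintegral_powR_dist_small p u (e : R) D : 1 < p -> measurable D ->
  powR_integrable p u -> 0 < e ->
  exists2 n : R, 0 < n & forall v, powR_integrable p v ->
    \int[mu]_x (`|u x - v x| `^ p) <= n ->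
    \int[mu]_(x in D) `| `|u x| `^ p - `|v x| `^ p| <= e.
Proof.
move=> p1 mD iu e0; have p0 : 0 <= p by lra.
pose A := \int[mu]_(x in D) (`|u x| `^ p).
have A0 : 0 <= A by apply: Rintegral_ge0 => x _; exact: powR_ge0.
(* Coefficient of [t], in which [2^p (A + 1)] bounds the integral of [|v|^p] once [n <= 1]. *)
pose K := p * 2 `^ p * (A + 2 `^ p * (A + 1)).
have K0 : 0 <= K by rewrite !(mulr_ge0, addr_ge0) ?powR_ge0.
pose t := Num.min 2^-1 (e / 2 / (K + 1)).
have t0 : 0 < t by rewrite lt_min invr_gt0 ltr0n/= !divr_gt0//; lra.
have tle : t <= 2^-1 by rewrite ge_min lexx.
have Kt : K * t <= e / 2.
  apply: (@le_trans _ _ ((K + 1) * t)); first by rewrite ler_wpM2r ?(ltW t0)//; lra.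
  by rewrite -ler_pdivlMl 1?mulrC ?ge_min ?lexx ?orbT//; lra.
pose n := Num.min 1 (e / 2 / t `^ (1 - p)).
have tp0 : 0 < t `^ (1 - p) by exact: powR_gt0.
exists n; first by rewrite lt_min ltr01 /= !divr_gt0.
move=> v iv uvn.
have iuv := powR_integrableB p0 iu iv.
have ivu := powR_integrableB p0 iv iu.
have D_le : \int[mu]_(x in D) (`|u x - v x| `^ p) <= n.
  apply: le_trans uvn; rewrite /Rintegral fine_le//.
  - by apply: integrable_fin_num => //; exact: powR_integrable_on.
  - by apply: integrable_fin_num => //; exact: (iuv.2).
  apply: ge0_subset_integral => //.
  - by apply: measurable_int (iuv.2).
have B_le : \int[mu]_(x in D) (`|v x| `^ p) <= 2 `^ p * (A + 1).
  apply: (@le_trans _ _ (2 `^ p * (A + \int[mu]_(x in D) (`|u x - v x| `^ p)))).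
    rewrite -RintegralD//; [|exact: powR_integrable_on|exact: powR_integrable_on].
    have isum := integrableD mD (powR_integrable_on mD iu) (powR_integrable_on mD iuv).
    rewrite -RintegralZl//; apply: le_Rintegral => //.
    - exact: powR_integrable_on.
    - exact: (integrableZl mD (2 `^ p) isum).
    move=> x _; have := @powR_norm_add_le _ (u x) (v x - u x) p p0.
    by rewrite [u x + _]addrC subrK [`|v x - u x|]distrC.
  rewrite ler_wpM2l ?powR_ge0// lerD2l (le_trans D_le)//.
  by rewrite ge_min lexx.
have tt : 0 < t <= 2^-1 by rewrite t0.
have := Rintegral_powR_dist p1 tt mD iu iv; move/le_trans; apply.
rewrite (splitr e) lerD//.
  apply: le_trans Kt; rewrite /K [leRHS]mulrAC ler_wpM2l ?lerD2l//.
  by rewrite !mulr_ge0 ?powR_ge0// ltW.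
apply: (@le_trans _ _ (t `^ (1 - p) * n)); first by rewrite ler_wpM2l ?powR_ge0.
by rewrite -ler_pdivlMl 1?mulrC ?ge_min ?lexx ?orbT.
Qed.

End powR_integrals.

(** * Mass of test functions against the oscillating weight *)

Section oscillating_mass.
Context {R : realType} {N : nat}.
Local Notation mu := (leb R N).
Local Notation Q := (@hobox R N 0 1).
Implicit Types (f g phi rho : 'rV[R]_N -> R) (L M p e : R).

Lemma powR_integrable_vanishes_off L phi p : 0 < p -> continuous phi ->
  vanishes_off L phi -> powR_integrable mu p phi.
Proof.
move=> p0 cf vp; split; first exact: measurable_continuous_rV.
apply: (integrable_cvanishes_off (continuous_powR_norm_fun p0 cf)).
by apply: vanishes_off_powR_norm vp => //; exact: lt0r_neq0.
Qed.

Lemma powR_integrable_shift p phi (h : 'rV[R]_N) : powR_integrable mu p phi ->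
  powR_integrable mu p (fun x => phi (x + h)).
Proof.
move=> [mf fi]; split; last exact: (integrable_shift h fi).
by apply: (measurableT_comp mf); exact: measurable_shift_rV.
Qed.

Lemma Rintegral_powR_shift p phi (h : 'rV[R]_N) : powR_integrable mu p phi ->
  \int[mu]_x (`|phi ((x : 'rV[R]_N) + h)| `^ p) = \int[mu]_x (`|phi x| `^ p).
Proof. by move=> [mf fi]; congr fine; exact: (integral_shift h fi). Qed.

Lemma bounded_periodicN M rho : bounded_periodic M rho -> bounded_periodic M (fun x => - rho x).
Proof.
move=> [mr rM pr]; split; first exact: measurable_funN.
  by move=> x; rewrite normrN.
by apply: filterS pr => y H i; rewrite H.
Qed.

Lemma integrable_oscillating M rho (c : R) f : bounded_periodic M rho ->
  mu.-integrable setT (EFin \o f) -> mu.-integrable setT (fun x => (rho (c *: x) * f x)%:E).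
Proof.
move=> [mr rM _] fi; have := integrable_mul_bounded c 0 mr rM fi.
by under eq_fun do rewrite addr0.
Qed.

Lemma oscillating_mass_le (i0 : 'I_N) L M p rho : 0 <= L -> 1 < p -> bounded_periodic M rho ->
  \int[mu]_(y in Q) rho y <= 0 ->
  exists2 C : R, 0 <= C & forall e, 0 < e <= 2^-1 ->
  forall phi, smooth phi -> vanishes_off L phi ->
    \int[mu]_x (rho (e^-1 *: (x : 'rV[R]_N)) * `|phi x| `^ p) <=
    C * e * \sum_(i < N) \int[mu]_x (`|partial i phi x| `^ p).
Proof.
move=> L0 p1 rp mean; have [mr rM _] := rp; have p0 : 0 < p by lra.
have M0 : 0 <= M by rewrite (le_trans _ (rM 0)).
have c1 : 0 <= p * 2 `^ p * ((2 * L + 1) `^ p * 2) by rewrite !mulr_ge0 ?powR_ge0// ltW.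
have c2 : 0 <= (2 `^ p) ^+ N by rewrite exprn_ge0// powR_ge0.
exists (M * (p * 2 `^ p * ((2 * L + 1) `^ p * 2) + (2 `^ p) ^+ N)).
  by rewrite mulr_ge0// addr_ge0.
move=> e /andP[e0 e2] phi sp vp.
have cphi := smooth_continuous sp.
have ip := powR_integrable_vanishes_off p0 cphi vp.
have idp i : powR_integrable mu p (partial i phi).
  apply: (powR_integrable_vanishes_off p0); last exact: (vanishes_off_partial _ vp).
  exact: smooth_continuous (smooth_partial i sp).
pose E := \sum_(i < N) \int[mu]_x (`|partial i phi x| `^ p).
have EE : (\sum_(i < N) \int[mu]_x (`|partial i phi x| `^ p)%:E = E%:E)%E.
  rewrite /E -sumEFin; apply: eq_bigr => i _; rewrite /Rintegral fineK//.
  by apply: integrable_fin_num => //; exact: (idp i).2.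
have E0 i : 0 <= \int[mu]_x (`|partial i phi x| `^ p).
  by apply: Rintegral_ge0 => x _; exact: powR_ge0.
have FE : \int[mu]_x (`|phi x| `^ p) <= (2 * L + 1) `^ p * E.
  have := poincare_rV i0 L0 p1 sp vp.
  rewrite -lee_fin /Rintegral fineK; last by apply: integrable_fin_num => //; exact: ip.2.
  move/le_trans; apply; rewrite EFinM lee_pmul2l ?lte_fin ?powR_gt0 ?fin_numE//; last lra.
  rewrite /E (bigD1 i0)//= EFinD /Rintegral fineK; last first.
    by apply: integrable_fin_num => //; exact: (idp i0).2.
  by rewrite leeDl// lee_fin; apply: sumr_ge0 => i _; exact: E0.
apply/ler_addgt0Pr => d d0.
(* For [- rho], of nonnegative mean, this gives a translate of [phi] whose [rho]-mass is at most
   [d]. *)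
have [y Qy] := averaging_point (bounded_periodicN rp) (lt0r_neq0 e0) ip.2 d0.
pose h : 'rV[R]_N := - (e *: y).
have ish := powR_integrable_shift h ip.
have RN (D : set 'rV[R]_N) (f : 'rV[R]_N -> R) : measurable D -> mu.-integrable D (EFin \o f) ->
    \int[mu]_(x in D) (- f x) = - \int[mu]_(x in D) f x.
  move=> mD fi; rewrite -[RHS]mulN1r -RintegralZl//.
  by apply: eq_Rintegral => x _; rewrite mulN1r.
rewrite RN; [|exact: measurable_hobox|exact: integrable_bounded_hobox mr rM].
have iosc := integrable_oscillating e^-1 rp ip.2.
have iosch := integrable_oscillating e^-1 rp ish.2.
rewrite (_ : \int[mu]_x (- rho (e^-1 *: (x : 'rV[R]_N)) * `|phi ((x : 'rV[R]_N) - e *: y)| `^ p) =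
   - \int[mu]_x (rho (e^-1 *: (x : 'rV[R]_N)) * `|phi ((x : 'rV[R]_N) + h)| `^ p)); last first.
  by rewrite -RN//; apply: eq_Rintegral => x _; rewrite mulNr.
rewrite mulNr -opprD ltrN2 => lt1.
have lt2 : \int[mu]_x (rho (e^-1 *: (x : 'rV[R]_N)) * `|phi ((x : 'rV[R]_N) + h)| `^ p) <= d.
  rewrite (le_trans (ltW lt1))// gerDr mulr_le0_ge0//.
  by apply: Rintegral_ge0 => x _; exact: powR_ge0.
have iB := integrableB measurableT ip.2 ish.2.
have diff : \int[mu]_x (rho (e^-1 *: (x : 'rV[R]_N)) * `|phi x| `^ p) -
  \int[mu]_x (rho (e^-1 *: (x : 'rV[R]_N)) * `|phi ((x : 'rV[R]_N) + h)| `^ p) <=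
  M * \int[mu]_x `| `|phi x| `^ p - `|phi ((x : 'rV[R]_N) + h)| `^ p |.
  rewrite -RintegralB// -RintegralZl//; last exact: (integrable_abse iB).
  apply: le_Rintegral => //.
  - exact: (integrableB measurableT iosc iosch).
  - exact: (integrableZl measurableT M (integrable_abse iB)).
  move=> x _; rewrite -mulrBr (le_trans (ler_norm _))// normrM.
  by rewrite ler_wpM2r.
have ee : 0 < e <= 2^-1 by rewrite e0.
(* Here [t = e]. The translation moves each coordinate by at most [e], so the integral behind the
   factor [e^(1 - p)] is of order [e^p]. *)
have dist := Rintegral_powR_dist p1 ee measurableT ip ish.
have shE := Rintegral_powR_shift h ip.
have hr (i : 'I_N) : `|h ord0 i| <= e.
  rewrite !mxE normrN normrM (gtr0_norm e0) ler_piMr ?(ltW e0)//.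
  by have /andP[y0 /ltW y1] := Qy i; rewrite ger0_norm.
have trans := ge0_integral_diff_powR p1 sp hr.
have iuv := powR_integrableB (ltW p0) ip ish.
have {}trans : \int[mu]_x (`|phi x - phi ((x : 'rV[R]_N) + h)| `^ p) <= (2 `^ p) ^+ N * e `^ p *
  E.
  rewrite -lee_fin /Rintegral fineK; last by apply: integrable_fin_num => //; exact: iuv.2.
  rewrite [leRHS]EFinM -EE; apply: le_trans trans.
  by under eq_integral do rewrite distrC.
have tail : e `^ (1 - p) * \int[mu]_x (`|phi x - phi ((x : 'rV[R]_N) + h)| `^ p) <=
    e * ((2 `^ p) ^+ N * E).
  apply: (le_trans (ler_wpM2l (powR_ge0 _ _) trans)).
  have swap (a b c : R) : a * (b * c * E) = a * c * (b * E) by ring.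
  rewrite swap -powRD; last first.
    by rewrite (gt_eqF e0) implybT.
  by rewrite subrK powRr1 ?(ltW e0).
have : M * \int[mu]_x `| `|phi x| `^ p - `|phi ((x : 'rV[R]_N) + h)| `^ p | <=
  M * (p * 2 `^ p * ((2 * L + 1) `^ p * 2) + (2 `^ p) ^+ N) * e * E.
  rewrite -!mulrA ler_wpM2l//; apply: (le_trans dist); rewrite shE.
  have k0 : 0 <= p * 2 `^ p * e by rewrite !mulr_ge0 ?powR_ge0// ltW.
  have := ler_wpM2l k0 FE; rewrite -/E.
  move: tail; rewrite -/E.
  move: (\int[mu]_x (`|phi x| `^ p)) (e `^ (1 - p) * _) (2 `^ p) ((2 * L + 1) `^ p) => F X P S.
  move: (P ^+ N) => PN tail FS; rewrite mulrDr.
  rewrite [leRHS](_ : _ = p * P * e * (S * E) + p * P * e * (S * E) + e * (PN * E)); last by ring.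
  by rewrite !lerD.
rewrite lerBlDr in diff => /(le_trans (_ : _ <= _)) H.
by rewrite (le_trans diff)// lerD//; exact: H.
Qed.

End oscillating_mass.

(** * Elements of the Sobolev space *)

Section Lq_space.
Context {R : realType} {N : nat} (p : R) (p_gt1 : 1 < p).
Local Notation mu := (leb R N).
Local Notation Lp := (LfunType mu (lee1_of_gt1 p_gt1)).
Implicit Types (f g : 'rV[R]_N -> R).

Let p_gt0 : 0 < p. Proof. exact: lt_trans ltr01 p_gt1. Qed.

Lemma ereal_powR_norm f : (fun x => `|(f x)%:E| `^ p)%E = (fun x => (`|f x| `^ p)%:E).
Proof. by apply/funext => x; rewrite abse_EFin poweR_EFin. Qed.

Lemma LfunType_powR_integrable (f : Lp) : powR_integrable mu p f.
Proof.
apply: powR_integrableP; first exact: measurable_funPT.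
have := poweR_Lnorm mu (EFin \o f) (lt0r_neq0 p_gt0).
rewrite /= ereal_powR_norm => <-; apply: poweR_lty; exact: Lfunction_finite.
Qed.

Lemma powR_integrable_Lfun f : powR_integrable mu p f -> f \in Lfun mu p%:E.
Proof.
move=> [mf fi]; rewrite inE; apply/andP; split; rewrite inE //=.
rewrite /finite_norm unlock /= ereal_powR_norm; apply: poweR_lty.
by apply: powR_integrable_lty; split.
Qed.

Lemma fine_Lnorm_powR f : powR_integrable mu p f ->
  fine ('N[mu]_p%:E[EFin \o f])%E = (\int[mu]_x (`|f x| `^ p)) `^ p^-1.
Proof.
move=> [mf fi]; rewrite unlock /= ereal_powR_norm /Rintegral.
have : (\int[mu]_x (`|f x| `^ p)%:E)%E \is a fin_num by exact: integrable_fin_num.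
by move: (integral _ _ _) => [r| |].
Qed.

Lemma Lq_ball_powR (f g : Lp) (r : R) :
  Lq_ball f r g <-> (\int[mu]_x (`|f x - g x| `^ p)) `^ p^-1 < r.
Proof.
rewrite -fine_Lnorm_powR//; apply: powR_integrableB; rewrite ?ltW//;
  exact: LfunType_powR_integrable.
Qed.

(** A ball of radius [n^(1/p)] in the product topology controls the function and all its partial
    derivatives at once. *)
Lemma closure_test_pairs O (w : Lp_pairs N p_gt1) (n : R) : closure (test_pairs O) w -> 0 < n ->
  exists2 phi, test_function O phi &
    \int[mu]_x (`|sob_fun w x - phi x| `^ p) <= n /\
    forall i, \int[mu]_x (`|sob_grad w x ord0 i - partial i phi x| `^ p) <= n.
Proof.
move=> cw n0; have r0 : 0 < n `^ p^-1 by exact: powR_gt0.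
have [v [[phi tphi [vE gE]] [b1 [_ b2]]]] := cw _ (nbhsx_ballx w _ r0).
have key (f g : Lp) : Lq_ball f (n `^ p^-1) g -> \int[mu]_x (`|f x - g x| `^ p) <= n.
  move=> /Lq_ball_powR /ltW.
  have I0 : 0 <= \int[mu]_x (`|f x - g x| `^ p) by apply: Rintegral_ge0 => x _; exact: powR_ge0.
  move=> /(ge0_ler_powR (ltW p_gt0)); rewrite !nnegrE !powR_ge0 => /(_ isT isT).
  by rewrite -!powRrM mulVf ?gt_eqF// !powRr1// ltW.
exists phi => //; split.
  rewrite (@eq_Rintegral _ _ _ mu setT (fun x => `|(w.1 : Lp) x - (v.1 : Lp) x| `^ p)).
    exact: key b1.
  by move=> x _; rewrite -vE.
move=> i; rewrite (@eq_Rintegral _ _ _ mu setT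
  (fun x => `|(w.2 ord0 i : Lp) x - (v.2 ord0 i : Lp) x| `^ p)).
  exact: key (b2 ord0 i).
by move=> x _; rewrite -gE /sob_grad !mxE.
Qed.

Definition mk_pair (u : 'rV[R]_N -> R) (G : 'I_N -> 'rV[R]_N -> R)
    (iu : powR_integrable mu p u) (iG : forall i, powR_integrable mu p (G i)) : Lp_pairs N p_gt1
      :=
  (Lfun_Sub (lee1_of_gt1 p_gt1) (powR_integrable_Lfun iu) : Lp,
   \row_i (Lfun_Sub (lee1_of_gt1 p_gt1) (powR_integrable_Lfun (iG i)) : Lp)).

Lemma sob_fun_mk_pair u G iu iG : sob_fun (@mk_pair u G iu iG) = u.
Proof. by []. Qed.

Lemma sob_grad_mk_pair u G iu iG x i : sob_grad (@mk_pair u G iu iG) x ord0 i = G i x.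
Proof. by rewrite !mxE. Qed.

Lemma mk_pairN u u' G G' iu iu' iG iG' : (forall x, u' x = - u x) ->
  (forall i x, G' i x = - G i x) -> @mk_pair u' G' iu' iG' = - @mk_pair u G iu iG.
Proof.
move=> uu' GG'; congr pair; first by apply/LfuneqP => x; exact: uu'.
by apply/rowP => i; rewrite !mxE; apply/LfuneqP => x; exact: GG'.
Qed.

Lemma test_function_powR_integrable O phi : test_function O phi ->
  powR_integrable mu p phi /\ forall i, powR_integrable mu p (partial i phi).
Proof.
move=> tphi; have [L vL] := test_function_vanishes_off tphi; have [sphi _ _] := tphi.
split; first exact: (powR_integrable_vanishes_off p_gt0 (smooth_continuous sphi) vL).
move=> i; apply: (powR_integrable_vanishes_off p_gt0 _ (vanishes_off_partial i vL)).
exact: smooth_continuous (smooth_partial i sphi).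
Qed.

Lemma mk_pair_W01p O phi iphi iG : test_function O phi ->
  W01p O (@mk_pair phi (fun i => partial i phi) iphi iG).
Proof.
move=> tphi; split; last first.
  apply: subset_closure; exists phi => //; split => // x i.
  exact: sob_grad_mk_pair.
move=> psi tpsi i; rewrite sob_fun_mk_pair.
have [L vL] := test_function_vanishes_off tphi; have [sphi _ _] := tphi; have [spsi _ _] := tpsi.
rewrite (integration_by_parts_rV i sphi spsi vL); congr (- _).
by apply: eq_Rintegral => x _; rewrite sob_grad_mk_pair.
Qed.

End Lq_space.

Section linear_combinations.
Context {R : realType} {N : nat} (p : R) (p_gt1 : 1 < p) (k : nat).
Local Notation mu := (leb R N).
Local Notation Lp := (LfunType mu (lee1_of_gt1 p_gt1)).
Implicit Types (t s : 'rV[R]_k).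

Let p_gt0 : 0 < p. Proof. exact: lt_trans ltr01 p_gt1. Qed.

Definition lincomb (u : 'I_k -> 'rV[R]_N -> R) t (x : 'rV[R]_N) : R :=
  \sum_(j < k) t ord0 j * u j x.

Lemma smooth_lincomb u t : (forall j, smooth (u j)) -> smooth (lincomb u t).
Proof.
by move=> su; apply: smooth_sum => j; apply: smoothM => //; exact: smooth_cst.
Qed.

Lemma partial_sum n (F : 'I_n -> 'rV[R]_N -> R) i : (forall j, smooth (F j)) ->
  partial i (fun x => \sum_(j < n) F j x) = fun x => \sum_(j < n) partial i (F j) x.
Proof.
elim: n F => [|n IH] F sF.
  under eq_fun do rewrite big_ord0; rewrite partial_cst.
  by apply/funext => x; rewrite big_ord0.
under eq_fun do rewrite big_ord_recr/=.
rewrite partialD//; last by apply: smooth_sum => j; exact: sF.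
by rewrite IH//; apply/funext => x; rewrite big_ord_recr.
Qed.

Lemma partial_lincomb u t i : (forall j, smooth (u j)) ->
  partial i (lincomb u t) = lincomb (fun j => partial i (u j)) t.
Proof.
move=> su; rewrite /lincomb partial_sum; last first.
  by move=> j; apply: smoothM => //; exact: smooth_cst.
apply/funext => x; apply: eq_bigr => j _.
by rewrite partialM//; [rewrite partial_cst mul0r addr0|exact: smooth_cst].
Qed.

Lemma powR_integrable_sum n (F : 'I_n -> 'rV[R]_N -> R) :
  (forall j, powR_integrable mu p (F j)) -> powR_integrable mu p (fun x => \sum_(j < n) F j x).
Proof.
elim: n F => [|n IH] F iF.
  under eq_fun do rewrite big_ord0.
  apply: powR_integrableP; first exact: measurable_cst.
  by rewrite integral0_eq// => x _; rewrite normr0 powR0// gt_eqF.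
under eq_fun do rewrite big_ord_recr/=.
by apply: powR_integrableD; [exact: ltW|apply: IH => j; exact: iF|exact: iF].
Qed.

Lemma powR_integrable_scale c (f : 'rV[R]_N -> R) : powR_integrable mu p f ->
  powR_integrable mu p (fun x => c * f x).
Proof.
move=> [mf fi]; split; first by apply: measurable_funM => //; exact: measurable_cst.
under eq_fun do rewrite normrM powRM//; exact: (integrableZl measurableT (`|c| `^ p) fi).
Qed.

Lemma powR_integrable_norm (f : 'rV[R]_N -> R) : powR_integrable mu p f ->
  powR_integrable mu p (fun x => `|f x|).
Proof.
move=> [mf fi]; split; first exact: measurableT_comp.
by under eq_fun do rewrite normr_id.
Qed.

Lemma powR_integrable_lincomb u t : (forall j, powR_integrable mu p (u j)) ->
  powR_integrable mu p (lincomb u t).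
Proof. by move=> iu; apply: powR_integrable_sum => j; exact: powR_integrable_scale. Qed.

(** Pointwise the difference is at most [|t - s|] times the sum of the [|u j|], since the norm on
    coefficients is the sup norm. *)
Lemma lincomb_dist u t s : (forall j, powR_integrable mu p (u j)) ->
  (\int[mu]_x (`|lincomb u t x - lincomb u s x| `^ p)) `^ p^-1 <=
  `|t - s| * (\int[mu]_x (`|\sum_(j < k) `|u j x| | `^ p)) `^ p^-1.
Proof.
move=> iu.
have iU : powR_integrable mu p (fun x => \sum_(j < k) `|u j x|).
  by apply: powR_integrable_sum => j; exact: powR_integrable_norm.
have I0 : 0 <= \int[mu]_x (`|\sum_(j < k) `|u j x| | `^ p).
  by apply: Rintegral_ge0 => x _; exact: powR_ge0.
have -> : `|t - s| = (`|t - s| `^ p) `^ p^-1 by rewrite -powRrM mulfV ?gt_eqF// powRr1.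
rewrite -powRM ?powR_ge0//; apply: ge0_ler_powR; rewrite ?nnegrE.
- by rewrite invr_ge0 ltW.
- by apply: Rintegral_ge0 => x _; exact: powR_ge0.
- by rewrite mulr_ge0// powR_ge0.
rewrite -RintegralZl//; last exact: iU.2.
apply: le_Rintegral => //.
- exact: (powR_integrableB (ltW p_gt0) (powR_integrable_lincomb t iu) (powR_integrable_lincomb s
  iu)).2.
- exact: (integrableZl measurableT (`|t - s| `^ p) iU.2).
move=> x _; rewrite -powRM//; apply: ge0_ler_powR; rewrite ?nnegrE ?mulr_ge0 ?(ltW p_gt0)//.
rewrite /lincomb -sumrB; apply: le_trans (ler_norm_sum _ _ _) _.
rewrite [`|\sum__ _|]ger0_norm ?sumr_ge0// mulr_sumr; apply: ler_sum => j _.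
rewrite -mulrBl normrM ler_wpM2r//.
have := @le_bigmax _ _ _ 0 (fun ij => `|(t - s) ij.1 ij.2|) (ord0, j).
by rewrite /= !mxE -mx_normrE.
Qed.

Lemma lincomb_dist_near t (r : R) u : 0 < r -> (forall j, powR_integrable mu p (u j)) ->
  \forall s \near t, (\int[mu]_x (`|lincomb u t x - lincomb u s x| `^ p)) `^ p^-1 < r.
Proof.
move=> r0 iv.
pose K := (\int[mu]_x (`|\sum_(j < k) `|u j x| | `^ p)) `^ p^-1.
have H s : (\int[mu]_x (`|lincomb u t x - lincomb u s x| `^ p)) `^ p^-1 <= `|t - s| * K.
  exact: lincomb_dist.
have K0 : 0 <= K by exact: powR_ge0.
have r1 : 0 < r / (K + 1) by rewrite divr_gt0// ltr_wpDl.
have := nbhsx_ballx t _ r1; rewrite -ball_normE; apply: filterS => s /= ts.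
apply: (le_lt_trans (H s)).
apply: (@le_lt_trans _ _ (`|t - s| * (K + 1))); first by rewrite ler_wpM2l// lerDl.
by rewrite -ltr_pdivlMr ?ltr_wpDl.
Qed.

Variable u : 'I_k -> 'rV[R]_N -> R.
Hypothesis (iu : forall j, powR_integrable mu p (u j)).
Hypothesis (idu : forall i j, powR_integrable mu p (partial i (u j))).

Definition lincomb_pair t : Lp_pairs N p_gt1 :=
  mk_pair p_gt1 (powR_integrable_lincomb t iu)
    (fun i => powR_integrable_lincomb t (idu i)).

Lemma lincomb_pairN t : lincomb_pair (- t) = - lincomb_pair t.
Proof.
apply: mk_pairN => [x|i x]; rewrite /lincomb -sumrN; apply: eq_bigr => j _;
  by rewrite mxE mulNr.
Qed.

Lemma lincomb_pair_continuous : continuous lincomb_pair.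
Proof.
move=> t; apply/(cvg_ballP (FF := nbhs_filter t)) => r r0.
have k2 : \forall s \near t, forall i, (\int[mu]_x (`|lincomb (fun j => partial i (u j)) t x -
    lincomb (fun j => partial i (u j)) s x| `^ p)) `^ p^-1 < r.
  by apply: (@filter_forall _ _ _ (nbhs t) (nbhs_filter t)) => i; exact: lincomb_dist_near.
have k1 := lincomb_dist_near t r0 iu.
apply: (@filterS2 _ (nbhs t) (nbhs_filter t) _ _ _ _ k1 k2) => s h1 h2; split.
  by apply/Lq_ball_powR; exact: h1.
by split => // i0 i; rewrite !mxE; apply/Lq_ball_powR; exact: (h2 i).
Qed.

Lemma lincomb_pair_W01p O t : test_function O (lincomb u t) -> (forall j, smooth (u j)) ->
  W01p O (lincomb_pair t).
Proof.
move=> tf su.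
have E i : partial i (lincomb u t) = lincomb (fun j => partial i (u j)) t by exact:
  partial_lincomb.
have iG i : powR_integrable mu p (partial i (lincomb u t)).
  by rewrite E; exact: powR_integrable_lincomb.
have -> : lincomb_pair t = mk_pair p_gt1 (powR_integrable_lincomb t iu) iG.
  congr pair; apply/rowP => i; rewrite !mxE; apply/LfuneqP => x.
  by rewrite /= -[RHS]/(partial i (lincomb u t) x) E.
exact: mk_pair_W01p.
Qed.

End linear_combinations.

Section euclidean_norm.
Context {R : realType} {N : nat}.
Implicit Types (u v w : 'rV[R]_N) (c : R).

Lemma dotvv_ge0 u : 0 <= dotv u u.
Proof. by apply: sumr_ge0 => i _; rewrite -expr2 sqr_ge0. Qed.

Lemma enorm_ge0 u : 0 <= enorm u. Proof. exact: sqrtr_ge0. Qed.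

Lemma coord_le_enorm u i : `|u ord0 i| <= enorm u.
Proof.
rewrite /enorm -sqrtr_sqr ler_wsqrtr// /dotv (bigD1 i)//= -expr2 lerDl.
by apply: sumr_ge0 => j _; rewrite -expr2 sqr_ge0.
Qed.

Lemma enorm_le_sup u c : (forall i, `|u ord0 i| <= c) -> enorm u <= N%:R * `|c|.
Proof.
move=> uc; case: N u uc => [|n] u uc.
  by rewrite /enorm /dotv big_ord0 sqrtr0 mul0r.
have c0 : 0 <= c by exact: le_trans (uc ord0).
rewrite (ger0_norm c0) -[leRHS]ger0_norm ?mulr_ge0// -sqrtr_sqr ler_wsqrtr// exprMn.
apply: (@le_trans _ _ (\sum_(i < n.+1) c ^+ 2)).
  apply: ler_sum => i _; rewrite -expr2 -real_normK ?num_real//.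
  by rewrite lerXn2r ?nnegrE.
rewrite sumr_const card_ord -[leLHS]mulr_natl ler_wpM2r ?sqr_ge0// -natrX ler_nat.
by rewrite expnS leq_pmulr.
Qed.

Lemma enorm_le_sum u : enorm u <= \sum_i `|u ord0 i|.
Proof.
have s0 : 0 <= \sum_i `|u ord0 i| by exact: sumr_ge0.
rewrite -[leRHS](ger0_norm s0) -sqrtr_sqr ler_wsqrtr// expr2 mulr_suml.
apply: ler_sum => i _; rewrite -expr2 -real_normK ?num_real// expr2 ler_wpM2l//.
by rewrite (bigD1 i)//= lerDl sumr_ge0.
Qed.

Lemma dotv_le_enorm u v : dotv u v <= enorm u * enorm v.
Proof.
(* Cauchy-Schwarz: this is the square of the Euclidean norm of [(v . v) u - (u . v) v]. *)
have q : 0 <= dotv v v * (dotv v v * dotv u u - dotv u v ^+ 2).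
  rewrite (_ : _ * _ = dotv (dotv v v *: u - dotv u v *: v) (dotv v v *: u - dotv u v *: v)).
    exact: dotvv_ge0.
  have expand (b e : R) : dotv (b *: u - e *: v) (b *: u - e *: v) =
      b ^+ 2 * dotv u u - 2 * b * e * dotv u v + e ^+ 2 * dotv v v.
    rewrite /dotv !mulr_sumr -sumrN -!big_split/=; apply: eq_bigr => i _.
    by rewrite !mxE; ring.
  by rewrite expand; ring.
have [v0|v0] := eqVneq (dotv v v) 0.
  have vi i : v ord0 i = 0.
    apply/eqP; rewrite -sqrf_eq0 expr2; move: v0 => /eqP.
    rewrite psumr_eq0; last by move=> j _; rewrite -expr2 sqr_ge0.
    by move=> /allP/(_ i); rewrite mem_index_enum => /(_ isT).
  by rewrite /dotv big1 ?mulr_ge0 ?enorm_ge0// => i _; rewrite vi mulr0.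
have {}v0 : 0 < dotv v v by rewrite lt_neqAle eq_sym v0 dotvv_ge0.
move: q; rewrite pmulr_rge0// subr_ge0 => q.
rewrite (le_trans (ler_norm _))// -sqrtr_sqr /enorm -sqrtrM ?dotvv_ge0//.
by rewrite ler_wsqrtr// mulrC.
Qed.

Lemma measurable_enorm : measurable_fun [set: 'rV[R]_N] (@enorm R N).
Proof.
apply: (@measurableT_comp _ _ _ _ _ _ (@Num.sqrt R)).
  by apply: continuous_measurable_fun; exact: sqrt_continuous.
apply: measurable_sum => i; apply: measurable_funM; exact: measurable_coord.
Qed.

End euclidean_norm.

(** * The potential and the energy *)

Section energy_bounds.
Context {R : realType} {N : nat} (p : R) (p_gt1 : 1 < p).
Local Notation mu := (leb R N).
Variables (O : set 'rV[R]_N) (alpha beta c : R) (a : 'rV[R]_N -> 'rV[R]_N -> 'rV[R]_N).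
Variable Phi : 'rV[R]_N -> 'rV[R]_N -> R.
Hypothesis aS : structure_conditions O p alpha beta c a.
Hypothesis PhiP : is_potential O p a Phi.

(** The derivative at 0 of [t -> Phi x ((1 + t) xi)] is [p (a . xi)] by the gradient and [p Phi] by
    homogeneity. *)
Lemma potential_euler : \forall x \ae mu, O x -> forall xi, Phi x xi = dotv (a x xi) xi.
Proof.
have p0 : p != 0 by rewrite gt_eqF// (lt_trans ltr01).
apply: filterS2 (pot_homogeneous PhiP) (pot_gradient PhiP) => x hom grad Ox xi.
have [dPhi dPhiE] := grad Ox xi.
have d1 : is_derive xi xi (Phi x) (p * dotv (a x xi) xi).
  have := DeriveDef (diff_derivable dPhi) (deriveE xi dPhi).
  by rewrite dPhiE.
have {}d1 := iffLR (is_derive_line _ _ _ _) d1.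
have d2 : is_derive (0 : R) 1 (fun t : R => Phi x (t *: xi + xi)) (p * Phi x xi).
  have h : is_derive (0 : R) 1 (fun t : R => (t + 1) `^ p * Phi x xi) (p * Phi x xi).
    pose sh (t : R) := t + 1.
    have shift1 : is_derive (0 : R) 1 sh 1.
      by rewrite -[X in is_derive _ _ _ X]addr0; apply: is_deriveD.
    have pw : is_derive (sh 0) 1 (@powR R ^~ p) (p * sh 0 `^ (p - 1)).
      by apply: is_derive1_powR; rewrite /sh add0r.
    have d : is_derive (0 : R) 1 ((@powR R ^~ p) \o sh) p.
      by have := is_derive1_comp pw shift1; rewrite (_ : sh 0 = 1) ?powR1 ?mulr1// /sh add0r.
    have := is_deriveZ (Phi x xi) d.
    by rewrite (_ : _ \*: _ = (fun t : R => (t + 1) `^ p * Phi x xi)) ?[_ *: p]mulrC//;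
      apply/funext => t; rewrite /= mulrC.
  apply: near_eq_is_derive h.
  near=> t; rewrite -hom//; last first.
    rewrite -ltrBlDr sub0r; near: t; apply: lt_nbhsr; by rewrite ltrN10.
  by rewrite scalerDl scale1r.
by apply: (mulfI p0); rewrite -(@derive_val _ _ _ _ _ _ _ d2) -(@derive_val _ _ _ _ _ _ _ d1).
Unshelve. all: by end_near. Qed.

Lemma potential_bounds : \forall x \ae mu, O x -> forall xi,
  alpha * enorm xi `^ p <= Phi x xi <= beta * enorm xi `^ p.
Proof.
have p0 : 0 < p by rewrite (lt_trans ltr01).
apply: filterS3 potential_euler (sc_coercive aS) (sc_bounded aS) => x euler coer bd Ox xi.
rewrite euler// coer//= (le_trans (dotv_le_enorm _ _))//.
rewrite -(mulr_powRB1 (enorm_ge0 xi) p0) [X in beta * X]mulrC mulrA.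
by rewrite ler_wpM2r ?enorm_ge0// bd.
Qed.

Lemma powR_integrable_enorm_grad (w : Lp_pairs N p_gt1) :
  powR_integrable mu p (fun x => enorm (sob_grad w x)).
Proof.
have p0 : 0 < p by rewrite (lt_trans ltr01).
have mg : measurable_fun [set: 'rV[R]_N] (sob_grad w).
  apply/measurable_rVP => i; rewrite (_ : (fun x => _) = (w.2 ord0 i : LfunType mu (lee1_of_gt1
    p_gt1))).
    exact: measurable_funPT.
  by apply/funext => x; rewrite mxE.
have iS : powR_integrable mu p (fun x => \sum_i `|sob_grad w x ord0 i|).
  apply: (powR_integrable_sum p_gt1) => i; apply: powR_integrable_norm.
  rewrite (_ : (fun x => _) = (w.2 ord0 i : LfunType mu (lee1_of_gt1 p_gt1))).
    exact: LfunType_powR_integrable.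
  by apply/funext => x; rewrite mxE.
have me : measurable_fun [set: 'rV[R]_N] (fun x => enorm (sob_grad w x)).
  by apply: measurableT_comp mg; exact: measurable_enorm.
split => //; apply: le_integrable iS.2 => //.
  by apply/measurable_EFinP; exact: measurable_powR_norm_fun.
move=> x _; rewrite !abse_EFin lee_fin (ger0_norm (powR_ge0 _ _)) (ger0_norm (powR_ge0 _ _)).
apply: ge0_ler_powR; rewrite ?nnegrE ?(ltW p0)//.
by rewrite !ger0_norm ?enorm_ge0 ?sumr_ge0//; exact: enorm_le_sum.
Qed.

Lemma energy_bounds (w : Lp_pairs N p_gt1) : measurable O -> 0 <= alpha ->
  alpha * \int[mu]_(x in O) (enorm (sob_grad w x) `^ p) <= energy O Phi w <=
  beta * \int[mu]_(x in O) (enorm (sob_grad w x) `^ p).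
Proof.
move=> mO alpha0.
have [_ iE] := powR_integrable_enorm_grad w.
have {}iE : mu.-integrable O (EFin \o (fun x => enorm (sob_grad w x) `^ p)).
  have := integrableS measurableT mO (@subsetT _ O) iE.
  by under eq_fun do rewrite ger0_norm ?enorm_ge0//.
have iZ b : mu.-integrable O (EFin \o (fun x => b * enorm (sob_grad w x) `^ p)).
  exact: (integrableZl mO b iE).
have /andP[I0 Iub] : (0 <= \int[mu]_(x in O) (Phi x (sob_grad w x))%:E <=
   \int[mu]_(x in O) (beta * enorm (sob_grad w x) `^ p)%:E)%E.
  apply: ae_le_integral_nonmeasurable => //.
  apply: filterS potential_bounds => x H Ox; have /andP[H1 H2] := H Ox (sob_grad w x).
  by rewrite !lee_fin H2 (le_trans _ H1)// mulr_ge0// powR_ge0.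
have /andP[_ Ilb] : (0 <= \int[mu]_(x in O) (alpha * enorm (sob_grad w x) `^ p)%:E <=
   \int[mu]_(x in O) (Phi x (sob_grad w x))%:E)%E.
  apply: ae_le_integral_nonmeasurable => //.
  apply: filterS potential_bounds => x H Ox; have /andP[H1 H2] := H Ox (sob_grad w x).
  by rewrite !lee_fin H1 mulr_ge0// powR_ge0.
have fin b := integrable_fin_num mO (iZ b).
(* Finiteness matters because [fine] would send an infinite integral to the default value 0. *)
have Ifin : (\int[mu]_(x in O) (Phi x (sob_grad w x))%:E)%E \is a fin_num.
  by rewrite ge0_fin_numE// (le_lt_trans Iub)// ltey_eq fin.
rewrite -!RintegralZl//; apply/andP; split; apply: fine_le => //; exact: fin.
Qed.

End energy_bounds.

(** * Lower bound of the first eigenvalue *)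

Section eigenvalue_lower_bound.
Context {R : realType} {N : nat} (p : R) (p_gt1 : 1 < p).
Local Notation mu := (leb R N).
Local Notation Q := (@hobox R N 0 1).
Local Notation pairs := (Lp_pairs N p_gt1).
Implicit Types (O : set 'rV[R]_N) (rho phi : 'rV[R]_N -> R) (w : pairs).

Let p_gt0 : 0 < p. Proof. exact: lt_trans ltr01 p_gt1. Qed.

Lemma test_function_off O phi x : test_function O phi -> ~ O x ->
  phi x = 0 /\ forall i, partial i phi x = 0.
Proof.
move=> [_ _ sub] Ox.
have ncl : ~ closure [set y | phi y != 0] x by move=> /sub.
have near0 : \forall y \near x, 0 = phi y.
  have : nbhs x (~` closure [set y | phi y != 0]).
    by apply: open_nbhs_nbhs; split => //; exact: closed_openC (@closed_closure _ _).
  apply: filterS => y ny; apply/eqP; rewrite eq_sym; apply: contrapT => /negP py.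
  by apply: ny; exact: subset_closure.
split; first by rewrite -(nbhs_singleton near0).
move=> i; rewrite /partial.
rewrite -(@near_eq_derive _ _ _ (cst 0) phi x (unit_vec i)); first exact: derive_cst.
exact: near0.
Qed.

Lemma Rintegral_supported O (f : 'rV[R]_N -> R) : (forall x, ~ O x -> f x = 0) ->
  \int[mu]_x f x = \int[mu]_(x in O) f x.
Proof.
move=> f0; rewrite [RHS]Rintegral_mkcond; apply: eq_Rintegral => x _.
by rewrite patchE; case: ifPn => // /negP H; rewrite f0// => Ox; apply: H; rewrite inE.
Qed.

Lemma sob_fun_powR_integrable w : powR_integrable mu p (sob_fun w).
Proof. exact: LfunType_powR_integrable. Qed.

Lemma sob_grad_powR_integrable w i : powR_integrable mu p (fun x => sob_grad w x ord0 i).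
Proof.
rewrite (_ : (fun x => _) = (w.2 ord0 i : LfunType mu (lee1_of_gt1 p_gt1))).
  exact: LfunType_powR_integrable.
by apply/funext => x; rewrite mxE.
Qed.

Lemma integrable_mass M rho O (c : R) (u : 'rV[R]_N -> R) : measurable O -> bounded_periodic M
  rho ->
  powR_integrable mu p u -> mu.-integrable O (fun x => (rho (c *: x) * `|u x| `^ p)%:E).
Proof.
move=> mO rp iu; apply: integrableS (integrable_oscillating c rp iu.2) => //.
Qed.

(** Extends [oscillating_mass_le] from test functions to their closure. As [O] is bounded, all test
    functions vanish off one common ball, so [C] is uniform. *)
Lemma weighted_mass_le (i0 : 'I_N) O M rho : measurable O -> bounded_set O ->
  bounded_periodic M rho -> \int[mu]_(y in Q) rho y <= 0 ->
  exists2 C : R, 0 <= C & forall e, 0 < e <= 2^-1 -> forall w, W01p O w ->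
    weighted_mass O (dilate e rho) w <=
    C * e * \sum_(i < N) \int[mu]_(x in O) (`|sob_grad w x ord0 i| `^ p).
Proof.
move=> mO [L [_ OL]] rp mean; have [mr rM _] := rp.
have M0 : 0 <= M by rewrite (le_trans _ (rM 0)).
have [C C0 HC] := oscillating_mass_le i0 (normr_ge0 (`|L| + 1)) p_gt1 rp mean.
exists C => // e ee w [_ cw]; have /andP[e0 _] := ee.
apply/ler_addgt0Pr => d d0.
(* Replacing [w] by [phi] costs [M * t] in the mass and [C * e * N * t] in the gradients, so
   [t = d / K] keeps the total below [d]. *)
pose K := C * e * N%:R + M + 1.
have K0 : 0 < K by rewrite ltr_wpDl// addr_ge0// !mulr_ge0// ltW.
pose t := d / K; have t0 : 0 < t by rewrite divr_gt0.
have iu := sob_fun_powR_integrable w.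
have [n0 n00 Hn0] := Rintegral_powR_dist_small p_gt1 mO iu t0.
have /choice[n Hn] : forall i, exists n : R, 0 < n /\ forall v, powR_integrable mu p v ->
    \int[mu]_x (`|sob_grad w x ord0 i - v x| `^ p) <= n ->
    \int[mu]_(x in O) `| `|sob_grad w x ord0 i| `^ p - `|v x| `^ p| <= t.
  move=> i; have [n ? ?] := Rintegral_powR_dist_small p_gt1 mO (sob_grad_powR_integrable w i) t0.
  by exists n.
pose m := \big[Num.min/n0]_(i < N) n i.
have m0 : 0 < m by apply: lt_bigmin => // i _; have [] := Hn i.
have [phi tphi [d1 d2]] := closure_test_pairs cw m0.
have [iphi idphi] := test_function_powR_integrable p_gt1 tphi.
have := Hn0 _ iphi (le_trans d1 (bigmin_le_id _ _ _ _)).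
have {}Hn i : \int[mu]_(x in O) `| `|sob_grad w x ord0 i| `^ p - `|partial i phi x| `^ p| <= t.
  by apply: (Hn i).2 => //; rewrite (le_trans (d2 i))//; exact: bigmin_le_cond.
move=> {}Hn0.
have vphi : vanishes_off `| `|L| + 1| phi.
  move=> x Lx; apply: (test_function_off tphi _).1 => Ox.
  have : `|x| <= `|L| + 1 by apply: OL => //; rewrite (le_lt_trans (ler_norm _))// ltrDl.
  by apply/negP; rewrite -ltNge (le_lt_trans (ler_norm _)).
have [sphi _ _] := tphi.
have := HC e ee phi sphi vphi.
rewrite (@Rintegral_supported O); last first.
  by move=> x Ox; have [-> _] := test_function_off tphi Ox; rewrite normr0 powR0 ?mulr0// gt_eqF.
under [X in _ <= _ * X]eq_bigr => i _.
  rewrite (@Rintegral_supported O); last first.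
    by move=> x Ox; have [_ ->] := test_function_off tphi Ox; rewrite normr0 powR0// gt_eqF.
  over.
move=> Hphi.
have iO u v : powR_integrable mu p u -> powR_integrable mu p v ->
    mu.-integrable O (EFin \o (fun x => `| `|u x| `^ p - `|v x| `^ p|)).
  move=> iu' iv'; exact: integrable_abse (integrableB mO (powR_integrable_on mO iu')
    (powR_integrable_on mO iv')).
have mass1 : weighted_mass O (dilate e rho) w <=
    \int[mu]_(x in O) (rho (e^-1 *: (x : 'rV[R]_N)) * `|phi x| `^ p) + M * t.
  apply: (@le_trans _ _ (\int[mu]_(x in O) (rho (e^-1 *: (x : 'rV[R]_N)) * `|phi x| `^ p) +
     M * \int[mu]_(x in O) `| `|sob_fun w x| `^ p - `|phi x| `^ p|)); last first.
    by rewrite lerD2l ler_wpM2l.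
  have i1 := integrable_mass e^-1 mO rp iphi.
  have i2 := integrableZl mO M (iO _ _ iu iphi).
  rewrite -RintegralZl//; last exact: iO.
  rewrite -RintegralD//; apply: le_Rintegral => //.
  - exact: (integrable_mass e^-1 mO rp iu).
  - exact: (integrableD mO i1 i2).
  move=> x _; rewrite -lerBlDl -mulrBr (le_trans (ler_norm _))// normrM.
  by rewrite ler_wpM2r//; exact: rM.
have grad1 i : \int[mu]_(x in O) (`|partial i phi x| `^ p) <=
    \int[mu]_(x in O) (`|sob_grad w x ord0 i| `^ p) + t.
  rewrite (le_trans _ (lerD (lexx _) (Hn i)))//.
  have i1 := powR_integrable_on mO (sob_grad_powR_integrable w i).
  have i2 := iO _ _ (sob_grad_powR_integrable w i) (idphi i).
  rewrite -RintegralD//; apply: le_Rintegral => //.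
  - exact: (powR_integrable_on mO (idphi i)).
  - exact: (integrableD mO i1 i2).
  by move=> x _; rewrite -lerBlDl distrC ler_norm.
apply: (le_trans mass1); apply: (@le_trans _ _ (C * e *
   (\sum_(i < N) (\int[mu]_(x in O) (`|sob_grad w x ord0 i| `^ p) + t)) + M * t)).
  rewrite lerD2r (le_trans Hphi)// ler_wpM2l ?mulr_ge0 ?(ltW e0)//.
  by apply: ler_sum => i _; exact: grad1.
rewrite big_split/= sumr_const card_ord mulrDr -addrA lerD2l.
rewrite -[t *+ N]mulr_natl mulrA -mulrDl.
apply: (@le_trans _ _ (K * t)); first by rewrite ler_wpM2r ?(ltW t0)// /K lerDl.
by rewrite /t mulrC divfK// gt_eqF.
Qed.

Lemma genus_family_neq0 (A : set pairs) k C : (0 < k)%N -> genus_family A k C -> C !=set0.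
Proof.
move=> k0 [_ _ _]; apply: contraPP => /nonemptyPn ->; apply/negP; rewrite -ltNge.
apply: (@le_lt_trans _ _ 0%E); last by rewrite lte_fin ltr0n.
(* The empty set has genus 0 through the vacuous map to R^0, so an admissible [C] is nonempty and
   its supremum is not [-oo]. *)
apply: ereal_inf_lbound; exists 0%N => //.
exists (fun=> 0); split => //; apply: continuous_subspaceT; exact: cst_continuous.
Qed.

Lemma eigenvalue_pos_ge O Phi rho k (m : R) : (0 < k)%N ->
  (forall w, W01p O w -> 0 < weighted_mass O rho w -> m * weighted_mass O rho w <= energy O Phi
    w) ->
  (m%:E <= eigenvalue_pos p_gt1 O Phi rho k)%E.
Proof.
move=> k0 H; apply: le_ereal_inf_tmp => _ [C CM <-].
have [w Cw] := genus_family_neq0 k0 CM; have [_ _ CsubM _] := CM.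
have [Ww mw] := CsubM w Cw.
apply: (@le_trans _ _ (rayleigh_quotient O Phi rho w)).
  by rewrite /rayleigh_quotient lee_fin ler_pdivlMr//; exact: H.
by apply: ereal_sup_ubound; exists w.
Qed.

Lemma sum_powR_grad_le O w : measurable O ->
  \sum_(i < N) \int[mu]_(x in O) (`|sob_grad w x ord0 i| `^ p) <=
  N%:R * \int[mu]_(x in O) (enorm (sob_grad w x) `^ p).
Proof.
move=> mO; apply: (@le_trans _ _ (\sum_(i < N) \int[mu]_(x in O) (enorm (sob_grad w x) `^ p))).
  have iE := powR_integrable_on mO (powR_integrable_enorm_grad w).
  apply: ler_sum => i _; apply: le_Rintegral => //.
  - exact: (powR_integrable_on mO (sob_grad_powR_integrable w i)).
  - by move: iE; under eq_fun do rewrite ger0_norm ?enorm_ge0//.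
  move=> x _; apply: ge0_ler_powR; rewrite ?nnegrE ?enorm_ge0 ?(ltW p_gt0)//.
  exact: coord_le_enorm.
by rewrite sumr_const card_ord mulr_natl.
Qed.

Lemma eigenvalue_pos_lower_bound O M rho (alpha : R) : (0 < N)%N -> measurable O -> bounded_set
  O ->
  bounded_periodic M rho -> \int[mu]_(y in Q) rho y <= 0 -> 0 < alpha ->
  exists2 m : R, 0 < m & forall e Phi, 0 < e <= 2^-1 ->
    (forall w, alpha * \int[mu]_(x in O) (enorm (sob_grad w x) `^ p) <= energy O Phi w) ->
    ((m / e)%:E <= eigenvalue_pos p_gt1 O Phi (dilate e rho) 1)%E.
Proof.
move=> N0 mO bO rp mean alpha0.
have [C C0 HC] := weighted_mass_le (Ordinal N0) mO bO rp mean.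
have K0 : 0 < C * N%:R + 1 by rewrite ltr_wpDl// mulr_ge0.
(* [N] comes from the sum of the partial derivatives; the 1 keeps the denominator positive when
   [C = 0]. *)
exists (alpha / (C * N%:R + 1)); first by rewrite divr_gt0.
move=> e Phi ee HE; have /andP[e0 _] := ee.
apply: eigenvalue_pos_ge => // w Ww mw.
apply: (le_trans _ (HE w)).
have I0 : 0 <= \int[mu]_(x in O) (enorm (sob_grad w x) `^ p).
  by apply: Rintegral_ge0 => x _; exact: powR_ge0.
rewrite -!mulrA ler_wpM2l ?(ltW alpha0)// mulrA -invfM ler_pdivrMl ?mulr_gt0//.
apply: (le_trans (HC e ee w Ww)).
apply: (le_trans (ler_wpM2l _ (sum_powR_grad_le w mO))); first by rewrite mulr_ge0// ltW.
rewrite mulrA ler_wpM2r// mulrAC [leRHS]mulrDl mul1r.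
by rewrite lerDl ltW.
Qed.

End eigenvalue_lower_bound.

(** * Upper bounds of the eigenvalues *)

Section periodic_bounded.
Context {R : realType} {N : nat}.
Implicit Types (f psi : 'rV[R]_N -> R).

Lemma unit_periodic_nat f i n x : unit_periodic f -> f (x + n%:R *: unit_vec i) = f x.
Proof.
move=> pf; elim: n => [|n IH]; first by rewrite scale0r addr0.
by rewrite -natr1 scalerDl scale1r addrA pf.
Qed.

Lemma unit_periodic_int f (z : 'I_N -> int) x : unit_periodic f ->
  f (x + \sum_i (z i)%:~R *: unit_vec i) = f x.
Proof.
move=> pf; have H (s : seq 'I_N) : forall x, f (x + \sum_(i <- s) (z i)%:~R *: unit_vec i) = f x.
  elim: s => [|i s IH] y; first by rewrite big_nil addr0.
  rewrite big_cons addrA IH; case: (z i) => n; first exact: unit_periodic_nat.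
  by rewrite NegzE mulrNz scaleNr -[LHS](unit_periodic_nat i n.+1 _ pf) subrK.
exact: H.
Qed.

(** Subtracting integer parts brings every point into the unit ball of the sup norm, where [|f|]
    attains its maximum. *)
Lemma unit_periodic_bounded f : continuous f -> unit_periodic f ->
  exists2 B : R, 0 <= B & forall x, `|f x| <= B.
Proof.
move=> cf pf.
have [||c _ Hc] := @EVT_max_rV R N (fun x => `|f x|) (cball 1) _ (@compact_cball R N 1).
- by exists 0; rewrite /cball/= normr0.
- apply: continuous_subspaceT => x; apply: (@continuous_comp _ _ _ f Num.norm); first exact: cf.
  exact: norm_continuous.
exists `|f c| => // x.
rewrite -(unit_periodic_int (fun i => - Num.floor (x ord0 i)) x pf).
apply: Hc; rewrite inE /cball/= [leLHS]mx_normrE; apply: bigmax_le => // -[i0 i] _ /=.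
rewrite (ord1 i0) !mxE summxE (bigD1 i)//= big1 ?addr0; last first.
  by move=> j ji; rewrite !mxE eqxx eq_sym (negPf ji) mulr0.
rewrite !mxE !eqxx mulr1 mulrNz.
by have /andP[f1 f2] := floor_itv (x ord0 i); rewrite intrD in f2; rewrite ger0_norm; lra.
Qed.

Lemma partial_unit_periodic f i : smooth f -> unit_periodic f -> unit_periodic (partial i f).
Proof.
move=> sf pf x j; have := @partial_affine R N f 1 (unit_vec j) i sf.
rewrite (_ : (fun y => f (1 *: y + _)) = f); last first.
  by apply/funext => y; rewrite scale1r pf.
by move=> /(congr1 (@^~ x)); rewrite scale1r mul1r.
Qed.

End periodic_bounded.

Section radial_bump.
Context {R : realType} {N : nat}.
Local Notation mu := (leb R N).

Definition rbump (r : R) (x : 'rV[R]_N) : R := flat_exp (r ^+ 2 - \sum_i x ord0 i ^+ 2).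

Lemma smooth_rbump r : smooth (rbump r).
Proof.
apply: smooth_flat_exp; apply: smoothB; first exact: smooth_cst.
apply: smooth_sum => i; under eq_fun do rewrite expr2.
by apply: smoothM; exact: smooth_coord.
Qed.

Lemma rbump_ge0 r x : 0 <= rbump r x. Proof. exact: flat_exp_ge0. Qed.

Lemma rbump_le1 r x : rbump r x <= 1. Proof. exact: flat_exp_le1. Qed.

Lemma rbump_neq0 r x : 0 < r -> rbump r x != 0 -> forall i, `|x ord0 i| < r.
Proof.
move=> r0 bx i; rewrite -ltr_sqr ?nnegrE ?(ltW r0)// real_normK ?num_real//.
apply: contra_neqT bx; rewrite -leNgt => rx; apply: flat_exp_le0.
rewrite subr_le0 (le_trans rx)// (bigD1 i)//= lerDl.
by apply: sumr_ge0 => j _; exact: sqr_ge0.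
Qed.

Lemma rbump_vanishes_off r : 0 < r -> vanishes_off r (rbump r).
Proof.
move=> r0 x rx; apply/eqP; apply: contraPT rx => bx; apply/negP; rewrite -leNgt.
rewrite [leLHS]mx_normrE; apply: bigmax_le; rewrite ?(ltW r0)// => -[i0 i] _ /=.
by rewrite (ord1 i0) ltW// (rbump_neq0 r0 bx).
Qed.

Lemma rbump_integral_gt0 r p : 0 < r -> 0 < p -> 0 < \int[mu]_x (`|rbump r x| `^ p).
Proof.
move=> r0 p0.
(* Small enough for the cube of side [h] at the origin to lie inside the Euclidean ball of radius
   [r], where the bump is positive. *)
pose h := r / (N%:R + 1) / 2.
have N1 : 0 < N%:R + 1 :> R by rewrite ltr_wpDl.
have h0 : 0 < h by rewrite !divr_gt0.
have hsum : N%:R * h ^+ 2 < r ^+ 2.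
  rewrite [ltRHS](_ : _ = (2 * (N%:R + 1)) ^+ 2 * h ^+ 2); last first.
    by rewrite /h; field; rewrite gt_eqF.
  rewrite ltr_pM2r ?exprn_gt0//.
  have : 0 <= N%:R :> R by []. 
  by nra.
pose c := flat_exp (r ^+ 2 - N%:R * h ^+ 2).
have c0 : 0 < c by apply: flat_exp_gt0; rewrite subr_gt0.
have cb x : hobox 0 h x -> c <= rbump r x.
  move=> hx; rewrite /c /rbump !flat_expE; last 2 first.
  - rewrite subr_gt0 (le_lt_trans _ hsum)// -[N in N%:R]card_ord mulr_natl -sumr_const.
    apply: ler_sum => i _; have /andP[x0 /ltW x1] := hx i.
    by rewrite lerXn2r ?nnegrE ?(ltW h0).
  - by rewrite subr_gt0.
  have le : \sum_i x ord0 i ^+ 2 <= N%:R * h ^+ 2.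
    rewrite -[N in N%:R]card_ord mulr_natl -sumr_const.
    apply: ler_sum => i _; have /andP[x0 /ltW x1] := hx i.
    by rewrite lerXn2r ?nnegrE ?(ltW h0).
  rewrite ler_expR lerN2 lef_pV2 ?posrE ?subr_gt0 ?(le_lt_trans le)//.
  by rewrite lerD2l lerN2.
have [mb ib] := powR_integrable_vanishes_off p0 (smooth_continuous (smooth_rbump r))
  (rbump_vanishes_off r0).
apply: (@lt_le_trans _ _ (c `^ p * h ^+ N)).
  by rewrite mulr_gt0 ?powR_gt0// exprn_gt0.
rewrite -lee_fin /Rintegral fineK; last exact: integrable_fin_num.
have -> : ((c `^ p * h ^+ N)%:E = \int[mu]_(x in @hobox R N 0 h) (c `^ p)%:E)%E.
  rewrite integral_cst; last exact: measurable_hobox.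
  rewrite [X in (_ * X)%E](_ : _ = (h ^+ N)%:E) ?EFinM//.
  by have := @leb_hobox R N 0 h (ltW h0); rewrite subr0.
apply: (@le_trans _ _ (\int[mu]_(x in @hobox R N 0 h) (`|rbump r x| `^ p)%:E)%E).
  apply: ge0_le_integral => //.
  - exact: measurable_hobox.
  - by move=> x _; rewrite lee_fin powR_ge0.
  - by apply/measurable_EFinP; apply: measurable_funTS; exact: measurable_powR_norm_fun.
  move=> x hx; rewrite lee_fin (ger0_norm (rbump_ge0 r x)).
  by apply: ge0_ler_powR; rewrite ?nnegrE ?rbump_ge0 ?(ltW c0) ?(ltW p0)//; exact: cb.
apply: ge0_subset_integral => //; first exact: measurable_hobox.
exact: measurable_int ib.
Qed.

End radial_bump.

(** * Genus of odd images of the sphere *)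

Section sphere_genus.
Context {R : realType} {N : nat} (p : R) (p_gt1 : 1 < p) (k : nat).
Local Notation pairs := (Lp_pairs N p_gt1).
Variable W : 'rV[R]_k -> pairs.
Hypothesis cW : continuous W.
Hypothesis oddW : forall t, W (- t) = - W t.

(** An odd nonvanishing map on the image, composed with [W], is one on the l1 sphere, so
    [borsuk_ulam] bounds its target dimension from below. Injectivity of [W] does not enter. *)
Lemma genus_sphere_image : ((k%:R)%:E <= genus (W @` @l1sphere R k))%E.
Proof.
apply: le_ereal_inf_tmp => _ [m [f [cf of_ nf]] <-]; rewrite lee_fin ler_nat.
apply: (@borsuk_ulam R k m (f \o W)).
- apply/subspace_continuousP => t St.
  have /subspace_continuousP/(_ (W t)) := cf.
  move=> /(_ (ex_intro2 _ _ t St erefl)) fW.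
  apply: (cvg_trans _ fW) => P /= PfW.
  have Wnear : nbhs t (W @^-1` [set y | (W @` @l1sphere R k) y -> P (f y)]).
    have cWt : W s @[s --> t] --> W t := @cW t.
    exact: (cWt _ PfW).
  apply: (@filterS _ (nbhs t) (nbhs_filter t) _ _ _ Wnear) => s /= H Ss.
  by apply: H; exists s.
- by move=> t St /=; rewrite oddW of_//; exists t.
- by move=> t St; apply: nf; exists t.
Qed.

Lemma sphere_genus_family (M : set pairs) :
  (forall t, l1sphere t -> M (W t)) -> genus_family M k (W @` @l1sphere R k).
Proof.
move=> WM; split.
- apply: continuous_compact; first exact: continuous_subspaceT.
  exact: compact_l1sphere.
- apply/seteqP; split => [_ [_ [t St <-] <-]|_ [t St <-]].
    by exists (- t); [exact: l1sphereN|].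
  by exists (W (- t)); [exists (- t) => //; exact: l1sphereN|rewrite oddW opprK].
- by move=> _ [t St <-]; exact: WM.
- exact: genus_sphere_image.
Qed.

Lemma eigenvalue_pos_le_sphere O Phi rho (E m : R) : 0 < m ->
  (forall t, l1sphere t -> [/\ W01p O (W t), energy O Phi (W t) <= E,
     0 <= E & m <= weighted_mass O rho (W t)]) ->
  (eigenvalue_pos p_gt1 O Phi rho k <= (E / m)%:E)%E.
Proof.
move=> m0 H; apply: ge_ereal_inf.
exists (ereal_sup (rayleigh_quotient O Phi rho @` (W @` @l1sphere R k))).
  exists (W @` @l1sphere R k) => //; apply: sphere_genus_family => t St.
  by have [? _ _ ?] := H t St; split => //; exact: lt_le_trans m0 _.
apply: ge_ereal_sup => _ [_ [t St <-] <-]; have [_ HE E0 Hm] := H t St.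
rewrite lee_fin ler_pdivrMr ?(lt_le_trans m0)//.
apply: (le_trans HE); rewrite -mulrA ler_peMr// mulrC ler_pdivlMr// mul1r//.
Qed.

End sphere_genus.

Section weight_root.
Context {R : realType} {N : nat} (p : R) (p_gt1 : 1 < p).
Implicit Types (psi : 'rV[R]_N -> R).

Let p_gt0 : 0 < p. Proof. exact: lt_trans ltr01 p_gt1. Qed.

Lemma powR_npos_le (a b q : R) : 0 < a <= b -> q <= 0 -> b `^ q <= a `^ q.
Proof.
move=> /andP[a0 ab] q0; have b0 := lt_le_trans a0 ab.
rewrite -(opprK q) !(powRN _ (- q)) lef_pV2 ?posrE ?powR_gt0//.
by apply: ge0_ler_powR => //; [rewrite oppr_ge0|rewrite nnegrE ltW|rewrite nnegrE ltW].
Qed.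

(** The p-th root is taken so that [|b h|^p] equals [|b|^p (d + c psi)], which is affine in
    [psi]. *)
Definition weight_root (d c : R) psi (x : 'rV[R]_N) : R := (d + c * psi x) `^ p^-1.

(** By the chain rule the derivative carries a factor [c] and the power [1/p - 1 < 0] of a base at
    least [d]. Thus [K] depends on [d] but not on [c]. *)
Lemma weight_root_bounds d psi : 0 < d <= 1 -> smooth_weight psi ->
  exists2 K : R, 0 <= K & forall c, 0 < c <= 1 ->
  [/\ smooth (weight_root d c psi),
      forall x, 0 <= weight_root d c psi x <= 2,
      forall x, weight_root d c psi x `^ p = d + c * psi x &
      forall i x, `|partial i (weight_root d c psi) x| <= K * c].
Proof.
move=> /andP[d0 d1] [sp p01 pp].
have /choice[B HB] : forall i, exists B : R, 0 <= B /\ forall x, `|partial i psi x| <= B.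
  move=> i; have [B ? ?] := unit_periodic_bounded (smooth_continuous (smooth_partial i sp))
    (partial_unit_periodic i sp pp).
  by exists B.
have B0 i : 0 <= B i by have [] := HB i.
exists (p^-1 * d `^ (p^-1 - 1) * \sum_i B i).
  by rewrite !mulr_ge0 ?powR_ge0 ?sumr_ge0// invr_ge0 ltW.
move=> c /andP[c0 c1].
have pos x : d <= d + c * psi x <= 2.
  by have /andP[? ?] := p01 x; apply/andP; split; nra.
have gt0 x : 0 < d + c * psi x by have /andP[+ _] := pos x; exact: lt_le_trans.
have sl : smooth (fun x => d + c * psi x).
  exact: (smoothD (smooth_cst d) (smoothM (smooth_cst c) sp)).
have pE i : partial i (fun x => d + c * psi x) = fun x => c * partial i psi x.
  have sc : smooth (fun x => c * psi x) := smoothM (smooth_cst c) sp.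
  rewrite (partialD i (smooth_cst d) sc) (partialM i (smooth_cst c) sp) !partial_cst.
  by apply/funext => x; rewrite mul0r addr0 add0r.
split.
- exact: smooth_powR.
- move=> x; rewrite powR_ge0/=; have /andP[_ le2] := pos x.
  apply: (@le_trans _ _ (2 `^ p^-1)).
    by apply: ge0_ler_powR; rewrite ?nnegrE ?invr_ge0 ?(ltW p_gt0) ?(ltW (gt0 x)).
  by apply: ler1_powR; [rewrite ler1n|rewrite invf_le1// ltW].
- by move=> x; rewrite /weight_root -powRrM mulVf ?gt_eqF// powRr1// ltW.
- move=> i x.
  have -> : partial i (weight_root d c psi) =
      fun x => p^-1 * (d + c * psi x) `^ (p^-1 - 1) * (c * partial i psi x).
    apply: is_derive_partial => z.
    have := is_derive_comp1 (smooth_is_derive i z sl) (is_derive1_powR p^-1 (gt0 z)).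
    by rewrite pE.
  rewrite !normrM (ger0_norm (powR_ge0 _ _)) (gtr0_norm c0) (ger0_norm (_ : 0 <= p^-1)); last
    first.
    by rewrite invr_ge0 ltW.
  have h1 : (d + c * psi x) `^ (p^-1 - 1) <= d `^ (p^-1 - 1).
    apply: powR_npos_le; first by have /andP[-> _] := pos x; rewrite d0.
    by rewrite subr_le0 invf_le1// ltW.
  have h2 : `|partial i psi x| <= \sum_i B i.
    rewrite (le_trans ((HB i).2 x))// (bigD1 i)//= lerDl.
    by apply: sumr_ge0 => j _; exact: B0.
  apply: (@le_trans _ _ (p^-1 * d `^ (p^-1 - 1) * (c * \sum_i B i))); last first.
    by rewrite [X in _ * X]mulrC mulrA.
  have q0 : 0 <= p^-1 by rewrite invr_ge0 ltW.
  apply: ler_pM; rewrite ?mulr_ge0 ?powR_ge0 ?(ltW c0)//; first by rewrite ler_wpM2l.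
  by rewrite ler_wpM2l// ltW.
Qed.

End weight_root.

Section sums.
Context {R : realType}.

(** Some coordinate has absolute value at least [1 / k], and it alone gives the bound. *)
Lemma l1sphere_powR_sum k (p : R) (t : 'rV[R]_k) : (0 < k)%N -> 0 < p -> l1sphere t ->
  (k%:R^-1) `^ p <= \sum_(j < k) `|t ord0 j| `^ p.
Proof.
move=> k0 p0 St.
have [j tj] : exists j, k%:R^-1 <= `|t ord0 j|.
  apply/existsP; apply: contraT; rewrite negb_exists => /forallP H.
  have : \sum_(j < k) `|t ord0 j| < \sum_(j < k) k%:R^-1 :> R.
    apply: ltr_sum; first by apply/hasP; exists (Ordinal k0) => //; rewrite mem_index_enum.
    by move=> j _; rewrite ltNge.
  rewrite sumr_const card_ord -[k%:R^-1 *+ k]mulr_natl mulfV ?pnatr_eq0 -?lt0n//.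
  by rewrite -[X in X < _]/(l1norm t) St ltxx.
rewrite (bigD1 j)//= ler_wpDr//; first by apply: sumr_ge0 => i _; exact: powR_ge0.
by apply: ge0_ler_powR; rewrite ?nnegrE ?invr_ge0 ?(ltW p0).
Qed.

Lemma powR_norm_sum_disjoint k (p : R) (a : 'I_k -> R) : p != 0 ->
  (forall i j, a i != 0 -> j != i -> a j = 0) ->
  `|\sum_j a j| `^ p = \sum_j `|a j| `^ p.
Proof.
move=> p0 H; have [[i ai]|/forallNP H0] := pselect (exists i, a i != 0).
  rewrite (bigD1 i)//= [X in _ + X]big1 ?addr0; last by move=> j ji; exact: (H i).
  by rewrite [RHS](bigD1 i)//= big1 ?addr0// => j ji; rewrite (H i)// normr0 powR0.
have a0 j : a j = 0 by apply/eqP; apply: contrapT => /negP; exact: H0.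
by rewrite !big1 ?normr0 ?powR0// => j _; rewrite a0 normr0 ?powR0.
Qed.

Lemma Rintegral_sum d (T : measurableType d) (mu : {measure set T -> \bar R}) (D : set T)
    n (F : 'I_n -> T -> R) : measurable D -> (forall j, mu.-integrable D (EFin \o F j)) ->
  mu.-integrable D (fun x => (\sum_(j < n) F j x)%:E) /\
  \int[mu]_(x in D) (\sum_(j < n) F j x) = \sum_(j < n) \int[mu]_(x in D) F j x.
Proof.
move=> mD; elim: n F => [|n IH] F iF.
  rewrite big_ord0; split.
    by under eq_fun do rewrite big_ord0; exact: integrable0.
  rewrite (@eq_Rintegral _ _ _ mu D (fun=> 0)); last by move=> x _; rewrite big_ord0.
  by rewrite /Rintegral integral0.
have [i1 e1] := IH (fun j => F (widen_ord (leqnSn n) j)) (fun j => iF _).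
have iD := integrableD mD i1 (iF ord_max).
have E x : \sum_(j < n.+1) F j x = \sum_(j < n) F (widen_ord (leqnSn n) j) x + F ord_max x.
  by rewrite big_ord_recr.
split; first by under eq_fun do rewrite E; exact: iD.
rewrite (@eq_Rintegral _ _ _ mu D _ _ (fun x _ => E x)) RintegralD// e1.
by rewrite big_ord_recr.
Qed.

End sums.

Section eigenvalue_upper_bound.
Context {R : realType} {N : nat} (p : R) (p_gt1 : 1 < p).
Local Notation mu := (leb R N).
Local Notation Q := (@hobox R N 0 1).
Local Notation pairs := (Lp_pairs N p_gt1).
Implicit Types (O : set 'rV[R]_N) (rho psi h : 'rV[R]_N -> R) (r e M : R).

Let p_gt0 : 0 < p. Proof. exact: lt_trans ltr01 p_gt1. Qed.

Lemma bounded_periodic_weight M rho psi (d c : R) : 0 <= d <= 1 -> 0 <= c <= 1 ->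
  smooth_weight psi -> bounded_periodic M rho ->
  bounded_periodic (M * 2) (fun x => rho x * (d + c * psi x)).
Proof.
move=> /andP[d0 d1] /andP[c0 c1] wp [mr rM pr]; have [sp p01 pp] := wp; split.
- apply: measurable_funM => //; apply: measurable_funD; first exact: measurable_cst.
  by apply: measurable_funM; [exact: measurable_cst|exact: smooth_weight_measurable].
- move=> x; rewrite normrM; have /andP[? ?] := p01 x.
  have e0 : 0 <= d + c * psi x by nra.
  by rewrite (ger0_norm e0) ler_pM//; nra.
- by apply: filterS pr => y H i; rewrite H pp.
Qed.

(** Only the bump moves with [z]; [h] stays in phase with [rho (x / e)], so [h^p] can be absorbed
    into the periodic weight before averaging. *)
Definition cell (b : 'rV[R]_N -> R) e (z : 'rV[R]_N) h (x : 'rV[R]_N) : R :=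
  b (x - z) * h (e^-1 *: x).

Lemma smooth_sub (b : 'rV[R]_N -> R) (z : 'rV[R]_N) : smooth b -> smooth (fun x => b (x - z)).
Proof.
move=> sb; have := smooth_affine 1 (- z) sb.
by congr smooth; apply/funext => x; rewrite scale1r.
Qed.

Lemma smooth_dilate e h : smooth h -> smooth (fun x => h (e^-1 *: x)).
Proof.
move=> sh; have := smooth_affine e^-1 0 sh.
by congr smooth; apply/funext => x; rewrite addr0.
Qed.

Lemma cell_smooth b e z h : smooth b -> smooth h -> smooth (cell b e z h).
Proof. by move=> sb sh; exact: (smoothM (smooth_sub z sb) (smooth_dilate e sh)). Qed.

Lemma partial_cell_bound b e z h (B K : R) i x : 0 < e -> smooth b -> smooth h ->
  (forall x, 0 <= b x <= 1) -> (forall x, 0 <= h x <= 2) ->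
  (forall i x, `|partial i b x| <= B) -> (forall i x, `|partial i h x| <= K) ->
  `|partial i (cell b e z h) x| <= 2 * B + K / e.
Proof.
move=> e0 sb sh b01 h02 bB hK.
have p1 : partial i (fun x : 'rV[R]_N => b (x - z)) = fun x => partial i b (x - z).
  have := partial_affine 1 (- z) i sb.
  under eq_fun do rewrite scale1r; move=> ->.
  by apply/funext => y; rewrite scale1r mul1r.
have p2 : partial i (fun x : 'rV[R]_N => h (e^-1 *: x)) = fun x => e^-1 * partial i h (e^-1 *: x).
  have := partial_affine e^-1 0 i sh.
  under eq_fun do rewrite addr0; move=> ->.
  by apply/funext => y; rewrite addr0.
have -> : partial i (cell b e z h) x =
    h (e^-1 *: x) * partial i b (x - z) + b (x - z) * (e^-1 * partial i h (e^-1 *: x)).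
  have := congr1 (@^~ x) (partialM i (smooth_sub z sb) (smooth_dilate e sh)).
  by rewrite p1 p2 => ->; rewrite addrC mulrC.
apply: (le_trans (ler_normD _ _)).
have /andP[h0 h2] := h02 (e^-1 *: x); have /andP[b0 b1] := b01 (x - z).
have ei0 : 0 <= e^-1 by rewrite invr_ge0 ltW.
apply: lerD; rewrite !normrM; first by rewrite (ger0_norm h0) ler_pM.
rewrite (ger0_norm b0) (ger0_norm ei0) mulrA [K / e]mulrC.
apply: ler_pM => //; first by rewrite mulr_ge0.
by rewrite -[leRHS]mul1r ler_wpM2r.
Qed.

Lemma exists_bump r : 0 < r -> exists b : 'rV[R]_N -> R,
  [/\ smooth b, forall x, 0 <= b x <= 1, forall x, b x != 0 -> forall i, `|x ord0 i| < r,
      vanishes_off r b & 0 < \int[mu]_x (`|b x| `^ p)].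
Proof.
move=> r0; exists (rbump r); split.
- exact: smooth_rbump.
- by move=> x; rewrite rbump_ge0 rbump_le1.
- by move=> x; exact: rbump_neq0.
- exact: rbump_vanishes_off.
- exact: rbump_integral_gt0.
Qed.

(** Disjoint supports make the mass additive, with coefficients [|t_j|^p] whose sum is bounded below
    on the l1 sphere. *)
Lemma mass_lincomb k O M rho e (u : 'I_k -> 'rV[R]_N -> R) (t : 'rV[R]_k) (m : R) :
  (0 < k)%N -> l1sphere t -> 0 <= m -> measurable O -> bounded_periodic M rho ->
  (forall j, powR_integrable mu p (u j)) ->
  (forall j x, ~ O x -> u j x = 0) ->
  (forall i j x, u i x != 0 -> j != i -> u j x = 0) ->
  (forall j, m <= \int[mu]_x (rho (e^-1 *: (x : 'rV[R]_N)) * `|u j x| `^ p)) ->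
  k%:R^-1 `^ p * m <= \int[mu]_(x in O) (rho (e^-1 *: (x : 'rV[R]_N)) * `|lincomb u t x| `^ p).
Proof.
move=> k0 St m0 mO rp iu u0 udisj um.
pose F j (x : 'rV[R]_N) := `|t ord0 j| `^ p * (rho (e^-1 *: x) * `|u j x| `^ p).
have i1 j := integrable_mass e^-1 mO rp (iu j).
have iF j : mu.-integrable O (EFin \o F j) by exact: (integrableZl mO _ (i1 j)).
have -> : \int[mu]_(x in O) (rho (e^-1 *: (x : 'rV[R]_N)) * `|lincomb u t x| `^ p) =
    \int[mu]_(x in O) \sum_(j < k) F j x.
  apply: eq_Rintegral => x _; rewrite /lincomb powR_norm_sum_disjoint ?gt_eqF//.
    rewrite mulr_sumr; apply: eq_bigr => j _.
    by rewrite /F normrM powRM// mulrCA.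
  move=> i j; rewrite mulf_eq0 negb_or => /andP[_ ui] ji.
  by rewrite (udisj i j x ui ji) mulr0.
have [_ ->] := Rintegral_sum mO iF.
apply: (@le_trans _ _ ((\sum_(j < k) `|t ord0 j| `^ p) * m)).
  by rewrite ler_wpM2r// l1sphere_powR_sum.
rewrite mulr_suml; apply: ler_sum => j _; rewrite /F RintegralZl//; last exact: i1.
rewrite ler_wpM2l ?powR_ge0// (le_trans (um j))//.
rewrite (@Rintegral_supported _ _ O)// => x Ox.
by rewrite u0// normr0 powR0 ?mulr0// gt_eqF.
Qed.

(** On the l1 sphere the absolute values of the coefficients add up to 1, so the bound [G] passes
    from the [u j] to their combinations. *)
Lemma energy_lincomb_le k O (Phi : 'rV[R]_N -> 'rV[R]_N -> R) (w : pairs) (beta G : R)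
   (u : 'I_k -> 'rV[R]_N -> R) (t : 'rV[R]_k) : measurable O -> (mu O < +oo)%E ->
  0 <= beta -> 0 <= G -> l1sphere t ->
  energy O Phi w <= beta * \int[mu]_(x in O) (enorm (sob_grad w x) `^ p) ->
  (forall i x, sob_grad w x ord0 i = lincomb (fun j => partial i (u j)) t x) ->
  (forall i j x, `|partial i (u j) x| <= G) ->
  energy O Phi w <= beta * ((N%:R * G) `^ p * fine (mu O)).
Proof.
move=> mO Ofin beta0 G0 St HE gE uG.
apply: (le_trans HE); rewrite ler_wpM2l//.
rewrite -Rintegral_cst//; apply: le_Rintegral => //.
- have := powR_integrable_on mO (powR_integrable_enorm_grad w).
  by under eq_fun do rewrite ger0_norm ?enorm_ge0//.
- apply/integrableP; split; first exact: measurable_cst.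
  by rewrite integral_cst// lte_mul_pinfty.
move=> x _; apply: ge0_ler_powR; rewrite ?nnegrE ?enorm_ge0 ?mulr_ge0 ?(ltW p_gt0)//.
rewrite -(ger0_norm G0); apply: enorm_le_sup => i; rewrite gE /lincomb.
rewrite (le_trans (ler_norm_sum _ _ _))//.
apply: (@le_trans _ _ (\sum_(j < k) `|t ord0 j| * G)).
  by apply: ler_sum => j _; rewrite normrM ler_wpM2l.
by rewrite -mulr_suml -[\sum__ _]/(l1norm t) St mul1r.
Qed.

Lemma test_function_in_ball O (z : 'rV[R]_N) (r : R) phi : smooth phi ->
  (forall x, `|z - x| <= r -> O x) -> (forall x, phi x != 0 -> `|z - x| <= r) ->
  test_function O phi.
Proof.
move=> sphi rO phir.
pose K := [set x : 'rV[R]_N | `|z - x| <= r].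
have cK : closed K.
  rewrite (_ : K = (fun x : 'rV[R]_N => `|z - x|) @^-1` [set y | y <= r])//.
  apply: preimage_closed; last exact: closed_le.
  move=> x _; apply: (@continuous_comp _ _ _ (fun x : 'rV[R]_N => z - x) Num.norm).
    by apply: continuousB; [exact: cst_continuous|].
  exact: norm_continuous.
have subK : closure [set x | phi x != 0] `<=` K.
  by rewrite closureE => x; apply; split.
split => //; last by move=> x /subK; exact: rO.
apply: bounded_closed_compact; last exact: closed_closure.
exists (`|z| + r); split; first exact: num_real.
move=> y yr x /subK Kx /=; rewrite (le_trans _ (ltW yr))//.
have -> : x = z - (z - x) by rewrite opprB addrC subrK.
by rewrite (le_trans (ler_normB _ _))// lerD2l.
Qed.

Lemma eigenvalue_pos_upper_bound (i0 : 'I_N) O M rho psi (beta d : R) k : open O -> bounded_set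
  O ->
  O !=set0 -> bounded_periodic M rho -> smooth_weight psi -> 0 <= beta -> 0 < d <= 1 -> (0 <
    k)%N ->
  exists r C : R, [/\ 0 < r, 0 <= C & forall e c kap Phi,
    0 < e < r -> 0 < c <= 1 -> 0 < kap ->
    kap <= \int[mu]_(y in Q) (rho y * (d + c * psi y)) ->
    (forall w : pairs, energy O Phi w <= beta * \int[mu]_(x in O) (enorm (sob_grad w x) `^ p)) ->
    (eigenvalue_pos p_gt1 O Phi (dilate e rho) k <= (C * (1 + c / e) `^ p / kap)%:E)%E].
Proof.
move=> oO bO [z0 Oz0] rp wp beta0 d01 k0.
have mO : measurable O by exact: measurable_open_rV.
have Ofin : (mu O < +oo)%E by exact: leb_bounded_lty.
have /nbhs_ballP[R0 /= R00] := open_nbhs_nbhs (conj oO Oz0).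
rewrite -ball_normE => ballO.
(* Spacing of the centres [z0 + j s e_i0]. With bump radius [r] and shift at most [r], a support
   reaches less than [r] below and [2 r] above its centre; [s = 4 r] keeps supports disjoint, and
   all stay within [(k + 1) s = R0 / 2] of [z0]. *)
pose s := R0 / (2 * (k%:R + 1)).
have k1 : 0 < k%:R + 1 :> R by rewrite ltr_wpDl.
have s0 : 0 < s by rewrite divr_gt0// mulr_gt0.
have sE : (k%:R + 1) * s = R0 / 2 by rewrite /s; field; rewrite gt_eqF.
pose r := s / 4; have r0 : 0 < r by rewrite divr_gt0.
have [b [sb b01 b_near bz m00]] := exists_bump r0.
have /choice[B HB] : forall i, exists B : R, 0 <= B /\ forall x, `|partial i b x| <= B.
  move=> i; exact: (vanishes_off_bounded (smooth_continuous (smooth_partial i sb))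
    (vanishes_off_partial i bz)).
pose SB := \sum_i B i.
have SB0 : 0 <= SB by apply: sumr_ge0 => i _; have [] := HB i.
have HSB i x : `|partial i b x| <= SB.
  rewrite (le_trans ((HB i).2 x))// /SB (bigD1 i)//= lerDl.
  by apply: sumr_ge0 => j _; have [] := HB j.
have [K K0 HK] := weight_root_bounds p_gt1 d01 wp.
pose G0 := 2 * SB + K.
have G00 : 0 <= G0 by rewrite addr_ge0// mulr_ge0.
set m0 := \int[mu]_x (`|b x| `^ p) in m00.
have ib := powR_integrable_vanishes_off p_gt0 (smooth_continuous sb) bz.
pose kp := k%:R^-1 `^ p : R.
have kp0 : 0 < kp by rewrite powR_gt0// invr_gt0 ltr0n.
(* The energy bound over the mass bound, without the factors that depend on [e], [c] and [kap]. *)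
pose C := beta * ((N%:R * G0) `^ p * fine (mu O)) / (kp * (m0 / 2)).
have fO0 : 0 <= fine (mu O) by exact: fine_ge0.
exists r, C; split => //.
  rewrite divr_ge0 ?mulr_ge0 ?powR_ge0 ?(ltW kp0)// ltW//.
move=> e c kap Phi /andP[e0 er] c01 kap0 kapQ HE.
have /andP[c0 c1] := c01.
have [h [sh h02 hp hK]] : exists h, [/\ smooth h, forall x, 0 <= h x <= 2,
    forall x, h x `^ p = d + c * psi x & forall i x, `|partial i h x| <= K * c].
  by exists (weight_root p d c psi); exact: HK.
pose z (j : 'I_k) : 'rV[R]_N := z0 + (j%:R * s) *: unit_vec i0.
have gp : bounded_periodic (M * 2) (fun x => rho x * (d + c * psi x)).
  apply: bounded_periodic_weight => //; first by have /andP[/ltW -> ->] := d01.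
  by rewrite (ltW c0).
(* The slack allowed in [averaging_point]: half of the guaranteed mean [kap * m0]. *)
have km0 : 0 < kap * m0 / 2 by rewrite divr_gt0// mulr_gt0.
have /choice[y Hy] : forall j : 'I_k, exists y : 'rV[R]_N, Q y /\
    kap * m0 / 2 <= \int[mu]_x (rho (e^-1 *: (x : 'rV[R]_N)) * `|cell b e (z j + e *: y) h x| `^
      p).
  move=> j; have ibz := powR_integrable_shift (- z j) ib.
  have [y Qy Hy] := averaging_point gp (lt0r_neq0 e0) ibz.2 km0.
  exists y; split; first exact: Qy.
  have := Rintegral_powR_shift (- z j) ib => shE.
  rewrite shE in Hy.
  have E : \int[mu]_x (rho (e^-1 *: (x : 'rV[R]_N)) * `|cell b e (z j + e *: y) h x| `^ p) =
      \int[mu]_x (rho (e^-1 *: (x : 'rV[R]_N)) * (d + c * psi (e^-1 *: x)) * `|b ((x : 'rV[R]_N)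
        - e *: y - z j)| `^ p).
    apply: eq_Rintegral => x _; rewrite /cell normrM powRM// -mulrA; congr (_ * _).
    rewrite mulrC opprD addrA addrAC; congr (_ * _).
    by have /andP[h0 _] := h02 (e^-1 *: x); rewrite ger0_norm// hp.
  rewrite E; apply: ltW; apply: le_lt_trans Hy.
  rewrite -/m0 -[X in X <= _](_ : kap * m0 - kap * m0 / 2 = _); last by field.
  by rewrite lerD2r ler_wpM2r ?(ltW m00).
pose u (j : 'I_k) := cell b e (z j + e *: y j) h.
have offi (j : 'I_k) i : 0 <= e * y j ord0 i <= r.
  have [/(_ i)/andP[y0 /ltW y1] _] := Hy j.
  rewrite mulr_ge0 ?(ltW e0)//= -[leRHS]mulr1 ler_pM ?(ltW e0)//; exact: ltW.
have u_coord (j : 'I_k) x : u j x != 0 -> forall i, `|x ord0 i - (z j ord0 i + e * y j ord0 i)|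
  < r.
  rewrite /u /cell mulf_eq0 negb_or => /andP[bx _] i.
  by have := b_near _ bx i; rewrite !mxE.
have zi (j : 'I_k) i : z j ord0 i = z0 ord0 i + (j%:R * s) * (i == i0)%:R.
  by rewrite !mxE eqxx.
have r4 : s = 4 * r by rewrite /r; field.
have js (j : 'I_k) : 0 <= j%:R * s <= k%:R * s.
  by rewrite mulr_ge0 ?(ltW s0)//= ler_wpM2r ?(ltW s0)// ler_nat ltnW.
have u_near (j : 'I_k) x : u j x != 0 -> `|z0 - x| <= R0 / 2.
  move=> ux; rewrite [leLHS]mx_normrE; apply: bigmax_le; first by rewrite divr_ge0// ltW.
  move=> -[l i] _ /=; have -> : l = ord0 by rewrite (ord1 l).
  rewrite !mxE -sE mulrDl mul1r.
  have := u_coord j x ux i; rewrite zi.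
  have /andP[y1 y2] := offi j i; have /andP[n1 n2] := js j.
  rewrite ltr_norml ler_norml => /andP[]; case: (i == i0) => /=; rewrite ?mulr1 ?mulr0 => H1 H2;
    by apply/andP; split; lra.
have halfO x : `|z0 - x| <= R0 / 2 -> O x.
  move=> xz; apply: ballO => /=; apply: (le_lt_trans xz).
  by rewrite ltr_pdivrMr// mulr_natr mulr2n ltrDl.
have u_disj (i j : 'I_k) x : u i x != 0 -> j != i -> u j x = 0.
  move=> ux ji; apply/eqP; apply: contraT => vx; exfalso.
  have := u_coord i x ux i0; have := u_coord j x vx i0; rewrite !zi !eqxx !mulr1.
  have /andP[a1 a2] := offi i i0; have /andP[b1 b2] := offi j i0.
  rewrite !ltr_norml => /andP[H1 H2] /andP[H3 H4].
  have : (j < i)%N || (i < j)%N by rewrite -neq_ltn.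
  move=> /orP[] lt.
    have : (j%:R + 1) * s <= i%:R * s by rewrite ler_wpM2r ?(ltW s0)// natr1 ler_nat.
    by rewrite mulrDl mul1r; lra.
  have : (i%:R + 1) * s <= j%:R * s by rewrite ler_wpM2r ?(ltW s0)// natr1 ler_nat.
  by rewrite mulrDl mul1r; lra.
have su j : smooth (u j) by exact: cell_smooth.
have tu t : test_function O (lincomb u t).
  apply: (test_function_in_ball (smooth_lincomb t su) halfO) => x.
  move=> lx; have [j ujx] : exists j, u j x != 0.
    apply/existsP; apply: contraNT lx; rewrite negb_exists => /forallP H.
    rewrite /lincomb big1// => j _; have := H j; rewrite negbK => /eqP ->.
    by rewrite mulr0.
  exact: u_near ujx.
have tuj j : test_function O (u j).
  by apply: (test_function_in_ball (su j) halfO) => x; exact: u_near.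
have iu j := (test_function_powR_integrable p_gt1 (tuj j)).1.
have idu i j := (test_function_powR_integrable p_gt1 (tuj j)).2 i.
have uoff j x : ~ O x -> u j x = 0 by move=> Ox; have [] := test_function_off (tuj j) Ox.
pose G := G0 * (1 + c / e).
have ce0 : 0 <= c / e by rewrite divr_ge0// ltW.
have G_ge0 : 0 <= G by rewrite mulr_ge0// addr_ge0.
have uG i j x : `|partial i (u j) x| <= G.
  apply: (le_trans (partial_cell_bound (z j + e *: y j) i x e0 sb sh b01 h02 HSB hK)).
  rewrite /G /G0 -[K * c / e]mulrA.
  have := mulr_ge0 SB0 ce0; move: (c / e) => q SBq.
  by rewrite mulrDr mulr1; lra.
pose E := beta * ((N%:R * G) `^ p * fine (mu O)).
have E0 : 0 <= E by rewrite !mulr_ge0// powR_ge0.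
have cW : continuous (lincomb_pair p_gt1 iu idu) by exact: lincomb_pair_continuous.
have oW t : lincomb_pair p_gt1 iu idu (- t) = - lincomb_pair p_gt1 iu idu t.
  exact: lincomb_pairN.
have := @eigenvalue_pos_le_sphere R N p p_gt1 k _ cW oW O Phi (dilate e rho) E (kp * (kap * m0 /
  2)).
rewrite mulr_gt0// => /(_ isT) H.
have -> : C * (1 + c / e) `^ p / kap = E / (kp * (kap * m0 / 2)).
  have GE : (N%:R * G) `^ p = (N%:R * G0) `^ p * (1 + c / e) `^ p.
    by rewrite /G mulrA [LHS]powRM// ?mulr_ge0// addr_ge0.
  rewrite /E /C GE; move: ((N%:R * G0) `^ p) ((1 + c / e) `^ p) (fine (mu O)) => X Y Z.
  by field; rewrite !gt_eqF.
apply: H => t St; split => //.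
- exact: lincomb_pair_W01p.
- apply: (energy_lincomb_le mO Ofin beta0 G_ge0 St (HE _)) => // i x.
  exact: sob_grad_mk_pair.
- by apply: (mass_lincomb k0 St (ltW km0) mO rp iu uoff u_disj) => j; have [] := Hy j.
Qed.

End eigenvalue_upper_bound.

(** * Asymptotics of the eigenvalues *)

Section weight_reduction.
Context {R : realType} {N : nat}.
Local Notation mu := (leb R N).
Local Notation Q := (@hobox R N 0 1).
Implicit Types (rho : 'rV[R]_N -> R) (M : R).

(** Truncation at an essential bound gives a bound at every point and preserves measurability and
    almost everywhere periodicity. *)
Lemma bounded_periodic_representative rho : rho \in Lfun mu +oo%E -> cube_periodic rho ->
  exists M rho', [/\ bounded_periodic M rho', \forall x \ae mu, rho x = rho' x &
    measurable_fun [set: 'rV[R]_N] rho].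
Proof.
move=> /andP[/set_mem/= mr /set_mem/= nr] pr.
have [M HM] : exists M : R, \forall x \ae mu, `|rho x| <= M.
  have muT : (0 < mu setT)%E.
    apply: (@lt_le_trans _ _ (mu Q)); first by rewrite leb_unit_hobox.
    by apply: le_measure; rewrite ?inE//; exact: measurable_hobox.
  move: nr; rewrite /finite_norm unlock /= muT.
  set y := (X in (X < _)%E) => yfin; exists (fine y).
  have /ess_supP : (y <= y)%E by [].
  apply: filterS => x; move: yfin; case: y => [y| |]//= _.
pose rho' x := Num.max (- `|M|) (Num.min `|M| (rho x)).
exists `|M|, rho'; split => //.
  split.
  - apply: measurable_maxr; first exact: measurable_cst.
    by apply: measurable_minr => //; exact: measurable_cst.
  - move=> x; rewrite ler_norml /rho' le_max lexx /= ge_max ge_min lexx /= andbT.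
    by rewrite (@le_trans _ _ 0)// oppr_le0.
  - by apply: filterS pr => x H i; rewrite /rho' H.
apply: filterS HM => x Hx.
have : `|rho x| <= `|M| by rewrite (le_trans Hx)// ler_norm.
by rewrite ler_norml /rho' => /andP[h1 h2]; rewrite min_r// max_r.
Qed.

(** The closed and the half-open cube differ only on faces [x_i = 1], which are null by
    [leb_slab0]. *)
Lemma unit_cube_mean M rho rho' : bounded_periodic M rho' -> measurable_fun [set: 'rV[R]_N] rho ->
  (\forall x \ae mu, rho x = rho' x) ->
  \int[mu]_(y in unit_cube) rho y = \int[mu]_(y in Q) rho' y.
Proof.
move=> [mr' _ _] mr rr.
rewrite [LHS]Rintegral_mkcond [RHS]Rintegral_mkcond; congr fine.
have mcube : measurable (@unit_cube R N).
  have := @measurable_forall_coord R N (fun=> `[0, 1]%classic) (fun=> measurable_itv _).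
  by congr measurable; apply/seteqP; split => y H i; have := H i; rewrite /= in_itv.
apply: ae_eq_integral => //.
- by apply/measurable_EFinP; exact: (measurable_restrictT rho mcube).1 (measurable_funTS mr).
- apply/measurable_EFinP.
  exact: (measurable_restrictT rho' (@measurable_hobox R N 0 1)).1 (measurable_funTS mr').
have nslab : \forall x \ae mu, forall i : 'I_N, (x : 'rV[R]_N) ord0 i != 1.
  apply: filter_forall => i; exists [set v : 'rV[R]_N | v ord0 i = 1]; split.
  - rewrite [X in measurable X](_ : _ = (fun x : 'rV[R]_N => x ord0 i) @^-1` [set 1])//.
    by rewrite -[X in measurable X]setTI; apply: measurable_coord.
  - exact: leb_slab0.
  - by move=> x /= /negP; rewrite negbK => /eqP.
apply: filterS2 nslab rr => x ns rx _; congr EFin; rewrite !patchE rx.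
congr (if _ then _ else _); apply/idP/idP; rewrite !inE => H i.
  by have /andP[-> x1] := H i; rewrite lt_neqAle ns.
by have /andP[-> /ltW] := H i.
Qed.

End weight_reduction.

Section reductions.
Context {R : realType} {N : nat} (p : R) (p_gt1 : 1 < p).
Local Notation mu := (leb R N).
Local Notation Q := (@hobox R N 0 1).
Local Notation pairs := (Lp_pairs N p_gt1).
Implicit Types (O : set 'rV[R]_N) (rho g : 'rV[R]_N -> R) (M : R).

Lemma eq_eigenvalue_pos O Phi rho rho' k :
  (forall w : pairs, weighted_mass O rho w = weighted_mass O rho' w) ->
  eigenvalue_pos p_gt1 O Phi rho k = eigenvalue_pos p_gt1 O Phi rho' k.
Proof.
move=> E.
have EM : Mpos O rho = Mpos O rho' :> set pairs.
  by apply/seteqP; split => w [Ww mw]; split => //; move: mw; rewrite E.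
have ER : rayleigh_quotient O Phi rho = rayleigh_quotient O Phi rho' :> (pairs -> _).
  by apply/funext => w; rewrite /rayleigh_quotient E.
by rewrite /eigenvalue_pos EM ER.
Qed.

(** A change of sign of the mass exchanges [Mneg] with [Mpos] and a supremum of infima with minus an
    infimum of suprema. The hypothesis concerns masses because weights are compared only up to null
    sets. *)
Lemma eigenvalue_negE O Phi rho rho' k :
  (forall w : pairs, weighted_mass O rho w = - weighted_mass O rho' w) ->
  (eigenvalue_neg p_gt1 O Phi rho k = - eigenvalue_pos p_gt1 O Phi rho' k)%E.
Proof.
move=> E.
have EM : Mneg O rho = Mpos O rho' :> set pairs.
  by apply/seteqP; split => w [Ww mw]; split => //; move: mw; rewrite E oppr_lt0.
have ER (w : pairs) : (rayleigh_quotient O Phi rho w = - rayleigh_quotient O Phi rho' w)%E.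
  by rewrite /rayleigh_quotient E invrN mulrN.
rewrite /eigenvalue_neg /eigenvalue_pos EM -ereal_supN; congr ereal_sup.
have inner (C : set pairs) : (ereal_inf (rayleigh_quotient O Phi rho @` C) =
    - ereal_sup (rayleigh_quotient O Phi rho' @` C))%E.
  rewrite -ereal_infN; congr ereal_inf; apply/seteqP; split.
    by move=> _ [w Cw <-]; exists (rayleigh_quotient O Phi rho' w); [exists w|rewrite ER].
  by move=> _ [_ [w Cw <-] <-]; exists w => //; rewrite ER.
apply/seteqP; split.
  by move=> _ [C HC <-]; exists (ereal_sup (rayleigh_quotient O Phi rho' @` C)); [exists
    C|rewrite inner].
by move=> _ [_ [C HC <-] <-]; exists C => //; rewrite inner.
Qed.

Lemma weighted_mass_dilate_ae O rho rho' (e : R) (w : pairs) : measurable O -> e != 0 ->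
  measurable_fun [set: 'rV[R]_N] rho -> measurable_fun [set: 'rV[R]_N] rho' ->
  (\forall x \ae mu, rho x = rho' x) ->
  weighted_mass O (dilate e rho) w = weighted_mass O (dilate e rho') w.
Proof.
move=> mO e0 mr mr' rr.
have mint (f : 'rV[R]_N -> R) : measurable_fun [set: 'rV[R]_N] f ->
    measurable_fun O (fun x => (dilate e f x * `|sob_fun w x| `^ p)%:E).
  move=> mf; apply/measurable_EFinP; apply: measurable_funTS; apply: measurable_funM.
    apply: (measurableT_comp mf); have := rV_affine_measurable e^-1 (0 : 'rV[R]_N).
    by under eq_fun do rewrite addr0.
  by apply: measurable_powR_norm_fun; have [] := sob_fun_powR_integrable w.
congr fine; apply: ae_eq_integral => //; [exact: mint|exact: mint|].
by apply: filterS (ae_dilate e0 rr) => x rx _; rewrite /dilate rx.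
Qed.

End reductions.

Section eigenvalue_asymptotics.
Context {R : realType} {N : nat} (p : R) (p_gt1 : 1 < p).
Local Notation mu := (leb R N).
Local Notation Q := (@hobox R N 0 1).
Local Notation pairs := (Lp_pairs N p_gt1).
Variables (O : set 'rV[R]_N) (alpha beta M : R) (Phi : R -> 'rV[R]_N -> 'rV[R]_N -> R).
Variable rho : 'rV[R]_N -> R.
Hypotheses (N0 : (0 < N)%N) (oO : open O) (bO : bounded_set O) (O0 : O !=set0).
Hypotheses (alpha0 : 0 < alpha) (beta0 : 0 < beta).
Hypothesis HPhi : forall e, 0 < e -> forall w : pairs,
  alpha * \int[mu]_(x in O) (enorm (sob_grad w x) `^ p) <= energy O (Phi e) w <=
  beta * \int[mu]_(x in O) (enorm (sob_grad w x) `^ p).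
Hypothesis rp : bounded_periodic M rho.
Local Notation lambda e k := (eigenvalue_pos p_gt1 O (Phi e) (dilate e rho) k).

Let p_gt0 : 0 < p. Proof. exact: lt_trans ltr01 p_gt1. Qed.
Let mO : measurable O. Proof. exact: measurable_open_rV. Qed.

Lemma eigenvalue_ge0 e k : 0 < e -> (0 < k)%N -> (0 <= lambda e k)%E.
Proof.
move=> e0 k0; apply: eigenvalue_pos_ge => // w _ _; rewrite mul0r.
have /andP[H _] := HPhi e0 w; apply: le_trans H; rewrite mulr_ge0 ?(ltW alpha0)//.
by apply: Rintegral_ge0 => x _; exact: powR_ge0.
Qed.

Lemma mean_weight psi (d c : R) : smooth_weight psi ->
  \int[mu]_(y in Q) (rho y * (d + c * psi y)) =
  d * \int[mu]_(y in Q) rho y + c * \int[mu]_(y in Q) (rho y * psi y).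
Proof.
move=> wp; have [mr rM _] := rp.
have [mrp rpM _] := bounded_periodic_mul_weight wp rp.
have i1 := integrable_bounded_hobox mr rM; have i2 := integrable_bounded_hobox mrp rpM.
have mQ := @measurable_hobox R N 0 1.
rewrite -!RintegralZl// -RintegralD//; last 2 first.
- exact: (integrableZl mQ d i1).
- exact: (integrableZl mQ c i2).
by apply: eq_Rintegral => y _; ring.
Qed.

Lemma eigenvalue_mean0 k : (0 < k)%N -> \int[mu]_(y in Q) rho y = 0 ->
  ~ (rho^\+ = cst 0 %[ae mu]) ->
  exists K : R, \forall e \near 0^'+, (`|lambda e k| <= (K / e)%:E)%E.
Proof.
move=> k0 mean rN0; have [psi wp psi0] := positive_weight rp rN0.
set kap0 := \int[mu]_(y in Q) _ in psi0.
have d01 : 0 < (1 : R) <= 1 by rewrite ltr01 lexx.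
have [r [C [r0 C0 H]]] := eigenvalue_pos_upper_bound p_gt1 (Ordinal N0) oO bO O0 rp wp (ltW
  beta0) d01 k0.
(* With [c = e] the gradient factor is [2^p], and the mean of the weighted [rho] is [e * kap0]. *)
exists (C * 2 `^ p / kap0); near=> e.
have e0 : 0 < e by near: e; exact: nbhs_right_gt.
have er : e < r by near: e; exact: nbhs_right_lt.
have e1 : e < 1 by near: e; exact: nbhs_right_lt.
rewrite gee0_abs ?eigenvalue_ge0//.
have := H e e (e * kap0) (Phi e); rewrite e0 er (ltW e1) divff ?gt_eqF// => /(_ isT isT).
rewrite mulr_gt0// (mean_weight _ _ wp) mean mulr0 add0r lexx => /(_ isT isT).
move=> /(_ (fun w => (andP (HPhi e0 w)).2)); move/le_trans; apply.
by rewrite lee_fin invfM mulrA mulrAC.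
Unshelve. all: by end_near. Qed.

Lemma eigenvalue_mean_lt0 k : (0 < k)%N -> \int[mu]_(y in Q) rho y < 0 ->
  ~ (rho^\+ = cst 0 %[ae mu]) ->
  exists K : R, \forall e \near 0^'+, (`|(e `^ p)%:E * lambda e k| <= K%:E)%E.
Proof.
move=> k0 mean rN0; have [psi wp psi0] := positive_weight rp rN0.
set kap0 := \int[mu]_(y in Q) _ in psi0.
set m := \int[mu]_(y in Q) rho y in mean.
(* This makes [d * - m] at most [kap0 / 2], so for [c = 1] the mean [d * m + kap0] is at least
   [kap0 / 2]. *)
pose d := Num.min 1 (kap0 / (2 * - m)).
have m2 : 0 < 2 * - m by rewrite mulr_gt0// oppr_gt0.
have d01 : 0 < d <= 1 by rewrite lt_min ltr01 divr_gt0//= ge_min lexx.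
have [r [C [r0 C0 H]]] := eigenvalue_pos_upper_bound p_gt1 (Ordinal N0) oO bO O0 rp wp (ltW
  beta0) d01 k0.
exists (C * 2 `^ p / (kap0 / 2)); near=> e.
have e0 : 0 < e by near: e; exact: nbhs_right_gt.
have er : e < r by near: e; exact: nbhs_right_lt.
have e1 : e < 1 by near: e; exact: nbhs_right_lt.
have lam0 := eigenvalue_ge0 e0 k0.
rewrite gee0_abs ?mule_ge0// ?lee_fin ?powR_ge0//.
have := H e 1 (kap0 / 2) (Phi e); rewrite e0 er ltr01 lexx => /(_ isT isT).
rewrite divr_gt0// (mean_weight _ _ wp) -/m -/kap0 !mul1r => /(_ isT).
have -> : kap0 / 2 <= d * m + kap0.
  have : d * (2 * - m) <= kap0 by rewrite -ler_pdivlMr// ge_min lexx orbT.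
  lra.
move=> /(_ isT (fun w => (andP (HPhi e0 w)).2)) lamC.
apply: (@le_trans _ _ ((e `^ p)%:E * (C * (1 + e^-1) `^ p / (kap0 / 2))%:E)%E).
  by rewrite lee_pmul2l// ?lte_fin ?powR_gt0.
rewrite -EFinM lee_fin.
have -> : e `^ p * (C * (1 + e^-1) `^ p / (kap0 / 2)) = C * (e `^ p * (1 + e^-1) `^ p) / (kap0 /
  2) by ring.
rewrite ler_wpM2r ?invr_ge0 ?divr_ge0 ?(ltW psi0)// ler_wpM2l// -powRM ?(ltW e0)//; last first.
  by rewrite addr_ge0// invr_ge0 ltW.
(* The base is [e * (1 + e^-1) = e + 1], at most 2 since [e < 1]. *)
rewrite mulrDr mulr1 mulfV ?gt_eqF//; apply: ge0_ler_powR; rewrite ?nnegrE ?(ltW p_gt0)//; lra.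
Unshelve. all: by end_near. Qed.

Lemma eigenvalue_lower : \int[mu]_(y in Q) rho y < 0 ->
  exists2 m : R, 0 < m & \forall e \near 0^'+, (m%:E <= `|e%:E * lambda e 1%N|)%E.
Proof.
move=> mean.
have [m m0 H] := eigenvalue_pos_lower_bound p_gt1 N0 mO bO rp (ltW mean) alpha0.
exists m => //; near=> e.
have e0 : 0 < e by near: e; exact: nbhs_right_gt.
have e2 : e <= 2^-1.
  by apply: ltW; near: e; apply: nbhs_right_lt; rewrite invr_gt0.
rewrite gee0_abs ?mule_ge0 ?eigenvalue_ge0// ?lee_fin ?(ltW e0)//.
have ee : 0 < e <= 2^-1 by rewrite e0.
have := H e (Phi e) ee (fun w => (andP (HPhi e0 w)).1).
have -> : (m%:E = e%:E * (m / e)%:E)%E by rewrite -EFinM mulrC divfK// gt_eqF.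
by rewrite lee_pmul2l// lte_fin.
Unshelve. all: by end_near. Qed.

End eigenvalue_asymptotics.

Theorem theorem1p3 (R : realType) (N : nat) (N_gt0 : (0 < N)%N)
  (p : R) (p_gt1 : 1 < p)
  (Omega : set 'rV[R]_N) (Omega_open : open Omega)
  (Omega_bounded : bounded_set Omega) (Omega_neq0 : Omega !=set0)
  (alpha beta c : R) (alpha_gt0 : 0 < alpha) (beta_gt0 : 0 < beta)
  (c_gt0 : 0 < c)
  (a : R -> 'rV[R]_N -> 'rV[R]_N -> 'rV[R]_N)
  (a_structure : forall e : R, 0 < e ->
    structure_conditions Omega p alpha beta c (a e))
  (Phi : R -> 'rV[R]_N -> 'rV[R]_N -> R)
  (Phi_potential : forall e : R, 0 < e ->
    is_potential Omega p (a e) (Phi e))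
  (rho : 'rV[R]_N -> R)
  (rho_bounded : rho \in Lfun (leb R N) +oo%E)
  (rho_periodic : cube_periodic rho)
  (rho_pos : ~ (rho^\+ = cst 0 %[ae (leb R N)]))
  (rho_neg : ~ (rho^\- = cst 0 %[ae (leb R N)])) :
  let rho_mean := \int[leb R N]_(y in unit_cube) rho y in
  let lambda_pos (e : R) (k : nat) : \bar R :=
    eigenvalue_pos p_gt1 Omega (Phi e) (dilate e rho) k in
  let lambda_neg (e : R) (k : nat) : \bar R :=
    eigenvalue_neg p_gt1 Omega (Phi e) (dilate e rho) k in
  [/\ (rho_mean = 0 ->
        exists K : R, \forall e \near 0^'+,
          (`|lambda_pos e 1%N| <= (K / e)%:E)%E /\
          (`|lambda_neg e 1%N| <= (K / e)%:E)%E),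
      (0 < rho_mean ->
        exists2 m : R, 0 < m & \forall e \near 0^'+,
          (m%:E <= `|e%:E * lambda_neg e 1%N|)%E),
      (rho_mean < 0 ->
        exists2 m : R, 0 < m & \forall e \near 0^'+,
          (m%:E <= `|e%:E * lambda_pos e 1%N|)%E) &
      forall a0 : 'rV[R]_N -> 'rV[R]_N -> 'rV[R]_N,
        cube_periodic a0 ->
        (forall e : R, 0 < e ->
          \forall x \ae leb R N, Omega x -> a e x = dilate e a0 x) ->
        forall k : nat, (0 < k)%N ->
        [/\ (rho_mean = 0 ->
              exists K : R, \forall e \near 0^'+,
                (`|lambda_pos e k| <= (K / e)%:E)%E /\
                (`|lambda_neg e k| <= (K / e)%:E)%E),
            (0 < rho_mean ->
              exists K : R, \forall e \near 0^'+,
                (`|(e `^ p)%:E * lambda_neg e k| <= K%:E)%E) &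
            (rho_mean < 0 ->
              exists K : R, \forall e \near 0^'+,
                (`|(e `^ p)%:E * lambda_pos e k| <= K%:E)%E)]].
Proof.
move=> rho_mean lambda_pos lambda_neg.
have mO : measurable Omega by exact: measurable_open_rV.
have HPhi e : 0 < e -> forall w : Lp_pairs N p_gt1,
    alpha * \int[leb R N]_(x in Omega) (enorm (sob_grad w x) `^ p) <= energy Omega (Phi e) w <=
    beta * \int[leb R N]_(x in Omega) (enorm (sob_grad w x) `^ p).
  by move=> e0 w; exact: (energy_bounds (a_structure e e0) (Phi_potential e e0) w mO (ltW
    alpha_gt0)).
have [M [rho' [rp rr mr]]] := bounded_periodic_representative rho_bounded rho_periodic.
have rpN := bounded_periodicN rp; have [mr' rM' _] := rp.
have meanE : rho_mean = \int[leb R N]_(y in @hobox R N 0 1) rho' y by exact: unit_cube_mean rp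
  mr rr.
have meanNE : \int[leb R N]_(y in @hobox R N 0 1) (- rho' y) = - rho_mean.
  rewrite meanE -[RHS]mulN1r -RintegralZl//; last 2 first.
  - exact: measurable_hobox.
  - exact: integrable_bounded_hobox mr' rM'.
  by apply: eq_Rintegral => y _; rewrite mulN1r.
have posN0 : ~ (rho'^\+ = cst 0 %[ae leb R N]).
  move=> H; apply: rho_pos; apply: filterS2 H rr => x Hx rx Dx.
  by have := Hx Dx; rewrite /funrpos /= rx.
have negN0 : ~ ((fun x => - rho' x)^\+ = cst 0 %[ae leb R N]).
  move=> H; apply: rho_neg; apply: filterS2 H rr => x Hx rx Dx.
  by have := Hx Dx; rewrite /funrpos /funrneg /= rx.
have posE e k : 0 < e -> lambda_pos e k = eigenvalue_pos p_gt1 Omega (Phi e) (dilate e rho') k.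
  move=> e0; apply: eq_eigenvalue_pos => w.
  by apply: weighted_mass_dilate_ae => //; rewrite gt_eqF.
(* Negative eigenvalues become positive ones for the truncated weight [- rho']. *)
have negE e k : 0 < e -> lambda_neg e k =
    (- eigenvalue_pos p_gt1 Omega (Phi e) (dilate e (fun x => - rho' x)%R) k)%E.
  move=> e0; apply: eigenvalue_negE => w.
  rewrite (weighted_mass_dilate_ae _ mO _ mr mr' rr) ?gt_eqF//.
  have i1 := integrable_mass e^-1 mO rp (sob_fun_powR_integrable w).
  rewrite /weighted_mass -[RHS]mulN1r -RintegralZl//; last first.
    exact: (integrable_mass e^-1 mO rpN (sob_fun_powR_integrable w)).
  by apply: eq_Rintegral => x _; rewrite /dilate mulN1r mulNr opprK.
clearbody lambda_pos lambda_neg.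
(* Both [rho'] and [- rho'] have mean zero and a nontrivial positive part, so the same bound applies
   to both signs; the larger constant serves both. *)
have A k : (0 < k)%N -> rho_mean = 0 -> exists K : R, \forall e \near 0^'+,
    (`|lambda_pos e k| <= (K / e)%:E)%E /\ (`|lambda_neg e k| <= (K / e)%:E)%E.
  move=> k0 mean0.
  have [K1 H1] := eigenvalue_mean0 N_gt0 Omega_open Omega_bounded Omega_neq0 alpha_gt0 beta_gt0
    HPhi rp
    k0 (etrans (esym meanE) mean0) posN0.
  have meanN0 : \int[leb R N]_(y in @hobox R N 0 1) (- rho' y) = 0 by rewrite meanNE mean0 oppr0.
  have [K2 H2] := eigenvalue_mean0 N_gt0 Omega_open Omega_bounded Omega_neq0 alpha_gt0 beta_gt0
    HPhi rpN
    k0 meanN0 negN0.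
  exists (Num.max K1 K2); near=> e.
  have e0 : 0 < e by near: e; exact: nbhs_right_gt.
  rewrite posE// negE//; split.
    apply: (@le_trans _ _ (K1 / e)%:E); first by near: e.
    by rewrite lee_fin ler_wpM2r ?invr_ge0 ?(ltW e0)// le_max lexx.
  rewrite abseN; apply: (@le_trans _ _ (K2 / e)%:E); first by near: e.
  by rewrite lee_fin ler_wpM2r ?invr_ge0 ?(ltW e0)// le_max lexx orbT.
split.
- exact: A.
- move=> mean; have meanN : \int[leb R N]_(y in @hobox R N 0 1) (- rho' y) < 0 by rewrite meanNE
  oppr_lt0.
  have [m m0 H] := eigenvalue_lower N_gt0 Omega_open Omega_bounded alpha_gt0 HPhi rpN meanN.
  exists m; first exact: m0.
  near=> e.
  have e0 : 0 < e by near: e; exact: nbhs_right_gt.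
  by rewrite negE// muleN abseN; near: e.
- rewrite meanE => mean.
  have [m m0 H] := eigenvalue_lower N_gt0 Omega_open Omega_bounded alpha_gt0 HPhi rp mean.
  exists m; first exact: m0.
  near=> e.
  have e0 : 0 < e by near: e; exact: nbhs_right_gt.
  by rewrite posE//; near: e.
move=> _ _ _ k k0; split.
- exact: A.
- move=> mean; have meanN : \int[leb R N]_(y in @hobox R N 0 1) (- rho' y) < 0 by rewrite meanNE
  oppr_lt0.
  have [K H] := eigenvalue_mean_lt0 N_gt0 Omega_open Omega_bounded Omega_neq0 alpha_gt0 beta_gt0
    HPhi rpN
    k0 meanN negN0.
  exists K; near=> e.
  have e0 : 0 < e by near: e; exact: nbhs_right_gt.
  by rewrite negE// muleN abseN; near: e.
- rewrite meanE => mean.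
  have [K H] := eigenvalue_mean_lt0 N_gt0 Omega_open Omega_bounded Omega_neq0 alpha_gt0 beta_gt0
    HPhi rp
    k0 mean posN0.
  exists K; near=> e.
  have e0 : 0 < e by near: e; exact: nbhs_right_gt.
  by rewrite posE//; near: e.
Unshelve. all: by end_near. Qed.
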